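(* Let $N\ge2$ and consider the Cuntz algebra $O_N$ with groupoid $G_N$, measure $\mu_{G_N}$ and operator $D$ on $L^2(G_N,\mu_{G_N})$ as described in the context. For every $t>\log(N)(1-N^{-1})^{-1}$ the heat operator $\mathrm e^{-t|D|}$ is defined by an integral kernel $$K_t\in L^1(G_N\times G_N,\mu_{G_N}\times\mu_{G_N})\cap C(G_N\times G_N)$$ given by $$K_t(g_1,g_2)=\begin{cases}\mathrm e^{-t|\gamma|}\left(h_\gamma(t)+H_\gamma(t)\,\mathrm d_\gamma(g_1,g_2)^{-\delta+\delta't}\right),&\text{if } g_1,g_2\in G_\gamma \text{ for some }\gamma\in I_N,\\ 0,&\text{otherwise,}\end{cases}$$ where $$h_\gamma(t)=N^{|s(\gamma)|}\left(1-\frac{(N-1)\mathrm e^{-t}}{N\mathrm e^{-t(1-N^{-1})}-1}\right),\qquad H_\gamma(t)=\frac{N-N\mathrm e^{-t(1-N^{-1})}}{N\mathrm e^{-t(1-N^{-1})}-1}\,\mathrm e^{-t(1-(1-N^{-1})|s(\gamma)|)}.$$ In particular, the heat operators $\mathrm e^{-t|D|}$ are Riesz potential operators, in the sense that on each $L^2(G_\gamma,\mu_\gamma)$ the operator $\mathrm e^{-t|D|}$ equals $\mathrm e^{-t|\gamma|}\bigl(h_\gamma(t)N^{-|s(\gamma)|}P_{\Delta_\gamma}+H_\gamma(t)R_{\gamma,\delta't}\bigr)$, where $P_{\Delta_\gamma}$ is the orthogonal projection onto the constant functions on $G_\gamma$ and $R_{\gamma,s}f(g_1)=\int_{G_\gamma}\mathrm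 d_\gamma(g_1,g_2)^{-\delta+s}f(g_2)\,\mathrm d\mu_\gamma(g_2)$ is the Riesz potential operator.
   Context: **Full $N$-shift.** $V_N$ is the set of all finite words in $\{1,\dots,N\}$ including the empty word $\emptyset$, $|\alpha|$ is the length of $\alpha$. $\Sigma_N=\{1,\dots,N\}^{\mathbb N}$ with shift $\sigma$, and $C(\alpha)$ is the cylinder set of sequences starting with $\alpha$. Fix $\lambda>1$ and let $\mathrm d(x,y)=\lambda^{-\inf\{n-1:x_n\ne y_n\}}$; $\mu$ is the measure with $\mu(C(\alpha))=N^{-|\alpha|}$. Put $\delta=\log_\lambda(N)$ and $\delta'=(1-N^{-1})\log_\lambda(\mathrm e)$, so $\delta/\delta'=\log(N)(1-N^{-1})^{-1}$. **Groupoid.** $G_N=\{(x,n,y)\in\Sigma_N\times\mathbb Z\times\Sigma_N:\exists k\ge0,\ n+k\ge0,\ \sigma^{n+k}(x)=\sigma^k(y)\}$, $s(x,n,y)=y$, $r(x,n,y)=x$, $c(x,n,y)=n$, $\kappa(x,n,y)=\min\{k\ge\max\{0,-n\}:\sigma^{n+k}(x)=\sigma^k(y)\}$, with the coarsest topology making $s,r,\kappa,c$ continuous. To $g=(x,n,y)$ one associates the words $\ell_r(g)$ of length $n+\kappa(g)$ and $\ell_s(g)$ of length $\kappa(g)+1$ with $x=\ell_r(g)\sigma^{\kappa(g)}(y)$, $y=\ell_s(g)\sigma^{\kappa(g)+1}(y)$. $I_N$ is the image of $g\mapsto\ell_r(g).\ell_s(g)$, i.e. the pairs $\gamma=\alpha.\beta$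 with $\alpha\in V_N$, $\beta\in V_N\setminus\{\emptyset\}$ and $\alpha_{|\alpha|}\neq\beta_{|\beta|-1}$ whenever $\alpha\ne\emptyset$ and $|\beta|\ge2$. Write $r(\gamma)=\alpha$, $s(\gamma)=\beta$, $|\gamma|=|\alpha|+|\beta|$, and $G_\gamma$ for the clopen set of $g$ with $\ell_r(g)=\alpha,\ell_s(g)=\beta$. Then $G_N=\bigsqcup_{\gamma\in I_N}G_\gamma$, and $s$ restricts to a homeomorphism $s_\gamma:G_\gamma\to C(s(\gamma))$. $\mathrm d_\gamma,\mu_\gamma$ are the pull-backs of $\mathrm d,\mu$ along $s_\gamma$; $\mu_{G_N}$ restricts to $\mu_\gamma$ on $G_\gamma$; $\mathrm d_{G_N}$ equals $\mathrm d_\gamma$ on $G_\gamma$ and $\infty$ between different $G_\gamma$'s. $C_c^\infty(G_N)$ denotes the compactly supported locally constant functions. **Operators.** $\Delta$ is the positive self-adjoint closure of $\Delta f(g_1)=\int_{G_N}\frac{f(g_1)-f(g_2)}{\mathrm d_{G_N}(g_1,g_2)^\delta}\mathrm d\mu_{G_N}(g_2)$, $f\in C_c^\infty(G_N)$ (with $\infty^{-\delta}=0$). $M_\ell$ is multiplication by $\ell$, $\ell|_{G_\gamma}=|\gamma|$. $P$ is the orthogonal projection onto the closed span of the characteristic functions $\chi_{G_\gamma}$ with $|s(\gamma)|=1$. $D=(2P-1)(\Delta+M_\ell)$, so $|D|=\Delta+M_\ell$. *)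

(* Defs.v *)
From HB Require Import structures.
From mathcomp Require Import all_boot all_order all_algebra.
From mathcomp Require Import complex.
From mathcomp Require Import all_classical all_reals all_analysis.

Set Implicit Arguments.
Unset Strict Implicit.
Unset Printing Implicit Defensive.

Import Order.TTheory GRing.Theory Num.Theory.
Import numFieldNormedType.Exports.

Local Open Scope classical_set_scope.
Local Open Scope complex_scope.
Local Open Scope ring_scope.

(* The complex Hilbert space L^2(mu) is handled through representatives:
   vectors are square-integrable functions T -> R[i], understood up to equality
   almost everywhere, and a (possibly unbounded) operator is its graph, a set of
   pairs of functions.  All the graphs built below contain every representative
   of the classes they relate, so equality of graphs is equality of operators,
   domains included. *)
Section operators_on_L2.
Context d (T : measurableType d) (R : realType).
Variable mu : {measure set T -> \bar R}.

Definition cfun := T -> R[i].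
Definition operator := set (cfun * cfun).

Implicit Types (f g h : cfun) (A B : operator).

Definition sqmod (z : R[i]) : R := complex.Re z ^+ 2 + complex.Im z ^+ 2.

Definition cmeasurable f : Prop :=
  measurable_fun setT (fun x => complex.Re (f x)) /\
  measurable_fun setT (fun x => complex.Im (f x)).

Definition cintegrable (D : set T) f : Prop :=
  mu.-integrable D (fun x => (complex.Re (f x))%:E) /\
  mu.-integrable D (fun x => (complex.Im (f x))%:E).

Definition cintegral (D : set T) f : R[i] :=
  (\int[mu]_(x in D) complex.Re (f x)) +i* (\int[mu]_(x in D) complex.Im (f x)).

Definition L2 : set cfun :=
  [set f | cmeasurable f /\ (\int[mu]_x (sqmod (f x))%:E < +oo)%E].

Definition ae_eq2 f g : Prop := {ae mu, forall x, f x = g x}.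

(* linear in the first argument *)
Definition dot f g : R[i] := cintegral setT (fun x => f x * conjc (g x)).

Definition sqdist f g : \bar R := (\int[mu]_x (sqmod (f x - g x))%:E)%E.

Definition op_id : operator :=
  [set fg | [/\ L2 fg.1, L2 fg.2 & ae_eq2 fg.2 fg.1]].

Definition op_scale (c : R[i]) A : operator :=
  [set fg | exists2 u, A (fg.1, u) &
              L2 fg.2 /\ ae_eq2 fg.2 (fun x => c * u x)].

Definition op_add A B : operator :=
  [set fg | exists u v, [/\ A (fg.1, u), B (fg.1, v), L2 fg.2 &
              ae_eq2 fg.2 (fun x => u x + v x)]].

(* first B, then A *)
Definition op_comp A B : operator :=
  [set fg | exists2 u, B (fg.1, u) & A (u, fg.2)].

Definition op_closure A : operator :=
  [set fg | [/\ L2 fg.1, L2 fg.2 & forall e : R, 0 < e ->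
     exists2 uv, A uv &
       (sqdist fg.1 uv.1 < e%:E)%E /\ (sqdist fg.2 uv.2 < e%:E)%E]].

(* multiplication by l on its maximal domain *)
Definition op_mult (l : T -> R) : operator :=
  [set fg | [/\ L2 fg.1, L2 fg.2 & ae_eq2 fg.2 (fun x => (l x)%:C * fg.1 x)]].

Definition int_op (K : T -> T -> R) : operator :=
  [set fg | [/\ L2 fg.1, L2 fg.2 & {ae mu, forall x,
     cintegrable setT (fun y => (K x y)%:C * fg.1 y) /\
     fg.2 x = cintegral setT (fun y => (K x y)%:C * fg.1 y)}]].

Definition lin_span (S : set cfun) : set cfun :=
  [set f | exists n (c : 'I_n -> R[i]) (u : 'I_n -> cfun),
     (forall i, S (u i)) /\ f = (fun x => \sum_(i < n) c i * u i x)].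

Definition closed_span (S : set cfun) : set cfun :=
  [set f | L2 f /\ forall e : R, 0 < e ->
     exists2 u, lin_span S u & (sqdist f u < e%:E)%E].

Definition ortho_proj (V : set cfun) : operator :=
  [set fg | [/\ L2 fg.1, V fg.2 &
     forall v, V v -> dot (fun x => fg.1 x - fg.2 x) v = 0]].

Definition cindic (X : set T) : cfun := fun x => (\1_X x : R)%:C.

(* L^2(X) inside L^2(T) *)
Definition vanish_off (X : set T) f : Prop :=
  {ae mu, forall x, ~ X x -> f x = 0}.

Definition op_restr (X : set T) A : operator :=
  [set fg | A fg /\ vanish_off X fg.1].

(* E is a projection-valued measure on the Borel sets of the real line, and
   m f is the scalar measure U |-> <E(U) f, f>; the sigma-additivity of E is
   carried by the type of m f. *)
Definition is_pvm (E : set R -> cfun -> cfun)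
    (m : cfun -> {measure set R -> \bar R}) : Prop :=
  forall f, L2 f ->
    [/\ ae_eq2 (E setT f) f,
        forall U, measurable U -> L2 (E U f),
        forall U g, measurable U -> L2 g -> dot (E U f) g = dot f (E U g),
        forall U V, measurable U -> measurable V ->
          ae_eq2 (E U (E V f)) (E (U `&` V) f) &
        forall U, measurable U ->
          m f U = (complex.Re (dot (E U f) f))%:E].

Section spectral_integral.
Variables (m : cfun -> {measure set R -> \bar R}).
Variable phi : R -> R.

Definition spectral_dom : set cfun :=
  [set f | L2 f /\ (\int[m f]_x (phi x ^+ 2)%:E < +oo)%E].

(* \int phi dm_(f,h), where m_(f,h) = <E(.) f, h> is recovered from the
   measures m by polarization *)
Definition spectral_form f h : R[i] :=
  4^-1 * \sum_(k < 4) 'i ^+ k *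
    (\int[m (fun x => f x + 'i ^+ k * h x)]_x phi x)%:C.

(* the operator \int phi dE *)
Definition spectral_int : operator :=
  [set fg | [/\ spectral_dom fg.1, L2 fg.2 &
     forall h, spectral_dom h -> dot fg.2 h = spectral_form fg.1 h]].

End spectral_integral.

(* phi(A) for a self-adjoint A: the integral of phi against the spectral
   resolution of A.  If A has no spectral resolution, the graph is empty. *)
Definition fun_calc (phi : R -> R) A : operator :=
  [set fg | exists E m, [/\ is_pvm E m, A = spectral_int m idfun &
                            spectral_int m phi fg]].

End operators_on_L2.

(* The letters 1, ..., N are represented by the elements 0, ..., N - 1 of 'I_N. *)
Definition letter (N : nat) & (2 <= N)%N : Type := 'I_N.

Section letter_instances.
Variables (N : nat) (N2 : (2 <= N)%N).
HB.instance Definition _ := Finite.on (letter N2).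
HB.instance Definition _ := isPointed.Build (letter N2) (Ordinal (ltnW N2)).
HB.instance Definition _ := hasNbhs.Build (letter N2) principal_filter.
HB.instance Definition _ := Discrete_ofNbhs.Build (letter N2) erefl.
End letter_instances.

(* Sequences are indexed from 0: x k is the (k+1)-st letter of x. *)
Definition full_shift (N : nat) (N2 : (2 <= N)%N) : Type :=
  prod_topology (fun _ : nat => letter N2).

Section full_shift.
Variables (N : nat) (N2 : (2 <= N)%N).

HB.instance Definition _ := Pointed.on (full_shift N2).
HB.instance Definition _ := Nbhs.on (full_shift N2).
HB.instance Definition _ := Topological.on (full_shift N2).

Definition word : Type := seq (letter N2).

Definition shift_map (x : full_shift N2) : full_shift N2 := fun k => x k.+1.

Definition cylinder (a : word) : set (full_shift N2) :=
  [set x | mkseq x (size a) = a].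

(* (x, n, y) satisfies n + k >= 0 and sigma^(n+k)(x) = sigma^k(y); the first
   condition amounts to k >= max(0, -n). *)
Definition tail_at (p : full_shift N2 * int * full_shift N2) (k : nat) : bool :=
  (0 <= p.1.2 + k%:Z) &&
  `[< iter (absz (p.1.2 + k%:Z)) shift_map p.1.1 = iter k shift_map p.2 >].

Definition groupoid_set : Type :=
  {p : full_shift N2 * int * full_shift N2 | `[< exists k, tail_at p k >]}.
HB.instance Definition _ := Choice.on groupoid_set.

Definition rng (g : groupoid_set) : full_shift N2 := (val g).1.1.
Definition src (g : groupoid_set) : full_shift N2 := (val g).2.
Definition cocycle (g : groupoid_set) : int := (val g).1.2.
Definition kappa (g : groupoid_set) : nat := ex_minn (asboolW (valP g)).

Lemma groupoid_unit (x : full_shift N2) : `[< exists k, tail_at (x, 0, x) k >].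
Proof. by apply/asboolP; exists 0%N; apply/andP; split=> //; apply/asboolP. Qed.

HB.instance Definition _ := isPointed.Build groupoid_set
  (exist _ (point, 0, point) (groupoid_unit point)).

Definition groupoid : Type :=
  initial_topology (fun g : groupoid_set =>
    (src g, rng g, kappa g, cocycle g : discrete_topology int)).
HB.instance Definition _ := Pointed.on groupoid.
HB.instance Definition _ := Topological.on groupoid.

Definition ell_r (g : groupoid) : word := mkseq (rng g) (absz (cocycle g + (kappa g)%:Z)).
Definition ell_s (g : groupoid) : word := mkseq (src g) (kappa g).+1.
Definition ell (g : groupoid) : word * word := (ell_r g, ell_s g).

(* the index set I_N; for gamma = alpha.beta, r(gamma) is gamma.1 and
   s(gamma) is gamma.2 *)
Definition index_set : set (word * word) := range ell.
Definition word_size (gamma : word * word) : nat := (size gamma.1 + size gamma.2)%N.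
Definition piece (gamma : word * word) : set groupoid := [set g | ell g = gamma].

Definition Cc_infty (R : realType) : set (groupoid -> R[i]) :=
  [set f | (forall g : groupoid, \forall g' \near g, f g' = f g) /\
           compact (closure [set g : groupoid | f g != 0])].

End full_shift.

Notation borel_shift N2 := (g_sigma_algebraType (@open (full_shift N2))).
Notation borel_groupoid N2 := (g_sigma_algebraType (@open (groupoid N2))).

Section dirac_operator.
Variables (R : realType) (N : nat) (N2 : (2 <= N)%N) (lambda : R).
Local Notation G := (borel_groupoid N2).
Variable muG : {measure set G -> \bar R}.

Definition log_base (b x : R) : R := ln x / ln b.

(* first index at which x and y differ, counted from 0 *)
Definition shift_dist (x y : full_shift N2) : R :=
  if pselect (exists k, x k != y k) is left h then lambda ^- ex_minn h else 0.

Definition delta : R := log_base lambda N%:R.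
Definition delta' : R := (1 - N%:R^-1) * log_base lambda (expR 1).

Definition piece_dist (g1 g2 : groupoid N2) : R := shift_dist (src g1) (src g2).

Definition groupoid_dist (g1 g2 : groupoid N2) : \bar R :=
  if ell g1 == ell g2 then (piece_dist g1 g2)%:E else +oo%E.

(* x^(- delta), with the convention (+oo)^(- delta) = 0 *)
Definition pow_mdelta (x : \bar R) : R :=
  if x is r%:E then r `^ (- delta) else 0.

Definition laplace_core : operator G R :=
  [set fg | Cc_infty fg.1 /\
     fg.2 = fun g1 => cintegral muG setT
       (fun g2 => (fg.1 g1 - fg.1 g2) * (pow_mdelta (groupoid_dist g1 g2))%:C)].

Definition laplace : operator G R := op_closure muG laplace_core.

Definition length_op : operator G R :=
  op_mult muG (fun g => (word_size (ell g))%:R).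

Definition proj_P : operator G R :=
  ortho_proj muG (closed_span muG
    [set cindic R (piece gamma : set G) | gamma in
       [set gamma | index_set gamma /\ size gamma.2 = 1%N]]).

Definition dirac : operator G R :=
  op_comp (op_add muG (op_scale muG 2 proj_P) (op_scale muG (-1) (op_id muG)))
          (op_add muG laplace length_op).

Definition abs_dirac : operator G R := fun_calc muG (fun x => `|x|) dirac.

Definition heat (t : R) : operator G R :=
  fun_calc muG (fun x => expR (- t * x)) abs_dirac.

Definition heat_h (gamma : word N2 * word N2) (t : R) : R :=
  N%:R ^+ size gamma.2 *
  (1 - ((N%:R - 1) * expR (- t)) / (N%:R * expR (- t * (1 - N%:R^-1)) - 1)).

Definition heat_H (gamma : word N2 * word N2) (t : R) : R :=
  (N%:R - N%:R * expR (- t * (1 - N%:R^-1))) /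
  (N%:R * expR (- t * (1 - N%:R^-1)) - 1) *
  expR (- t * (1 - (1 - N%:R^-1) * (size gamma.2)%:R)).

Definition heat_kernel (t : R) (g1 g2 : groupoid N2) : R :=
  let gamma := ell g1 in
  if ell g2 == gamma then
    expR (- t * (word_size gamma)%:R) *
    (heat_h gamma t +
     heat_H gamma t * piece_dist g1 g2 `^ (- delta + delta' * t))
  else 0.

(* the projection onto the constant functions on G_gamma, seen on the functions
   on the whole groupoid *)
Definition const_proj (gamma : word N2 * word N2) : operator G R :=
  ortho_proj muG (closed_span muG [set cindic R (piece gamma : set G)]).

Definition riesz (gamma : word N2 * word N2) (s : R) : operator G R :=
  [set fg | [/\ L2 muG fg.1, L2 muG fg.2,
     vanish_off muG (piece gamma : set G) fg.1,
     vanish_off muG (piece gamma : set G) fg.2 &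
     {ae muG, forall g1, piece gamma g1 ->
       let Rf g2 := (piece_dist g1 g2 `^ (- delta + s))%:C * fg.1 g2 in
       cintegrable muG (piece gamma : set G) Rf /\
       fg.2 g1 = cintegral muG (piece gamma : set G) Rf}]].

End dirac_operator.

(* Main.v *)
Require Import Defs.
From mathcomp Require Import all_boot all_order all_algebra.
From mathcomp Require Import complex.
From mathcomp Require Import all_classical all_reals all_analysis.
From mathcomp Require Import measurable_realfun.
From mathcomp Require Import ring lra zify.

(** All the operators in the theorem are diagonal in one orthogonal system, and
    the proof computes their eigenvalues.

    A piece [G_gamma] is a copy of the cylinder of [s(gamma)].  Besides the
    indicator of the piece, consider for every word [v] and every letter [j] the
    wavelet that is 1 on the children [s(gamma) v l] with [l < j], [- j] on the
    child [l = j], and 0 elsewhere.  These functions are pairwise orthogonal, and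
    their finite combinations contain the indicators of all cylinders; hence they
    form a total system of [L^2] ([haar_total]).

    A kernel whose value at [(x, y)] depends only on the distance of [x] and [y]
    in their piece has all these functions as eigenvectors, because a cylinder
    that does not contain [x] lies in a single annulus around [x], and a wavelet
    has mean zero ([radial_wfun]).  For the Laplacian the eigenvalue is 0 on the
    indicators and [1 + |v| (1 - 1/N)] on the wavelets at [v] ([laplace_wfun]).
    By compactness, a locally constant function with compact support is a finite
    combination of the system, so the closure of the Laplacian is the diagonal
    operator of these eigenvalues ([laplace_diag]).  The multiplication by the
    length and the projection [P] are diagonal as well ([length_diag],
    [indicator_proj_diag]).

    A function [phi] of a diagonal operator is the diagonal operator of the values
    of [phi] at the eigenvalues ([fun_calc_diag]).  The point masses at the
    eigenvalues provide a spectral resolution; conversely, every spectral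
    resolution is concentrated, on an eigenvector, at its eigenvalue, so that the
    result does not depend on the resolution.  The sign [2 P - 1] disappears in
    the absolute value, and the heat operator has eigenvalue [exp (- t |gamma|)]
    on the indicator of the piece of [gamma] and
    [exp (- t (|gamma| + 1 + |v| (1 - 1/N)))] on its wavelets at [v]
    ([heat_diag]).

    The integral operator of the stated kernel has the same eigenvalues.  The
    kernel is radial, and only its integrals over balls matter.  They satisfy a
    recurrence of order one in the radius, and the solution is singled out by its
    decay: the condition on [t] says that [N exp (- t (1 - 1/N)) < 1], so the
    powers of the distance that occur are bounded and the integrals over small
    balls tend to zero ([heat_ball_integral], [heat_wfun]).  The same inequality
    makes the kernel continuous at the diagonal ([heat_kernel_continuous]).  The
    kernel is integrable because its integral over the pieces with words of
    lengths [n] and [k] is bounded by a geometric term in [n] and [k]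
    ([heat_section_integral_le], [geometric_integral]).

    On one piece, the kernel is a combination of a constant and of the kernel of
    the Riesz potential.  The constant [N^|s(gamma)|] is the kernel of the
    projection onto the constant functions ([const_proj_int_op]), which gives the
    last formula ([heat_restr]). *)

Set Implicit Arguments.
Unset Strict Implicit.
Unset Printing Implicit Defensive.

Import Order.TTheory GRing.Theory Num.Theory.
Import numFieldNormedType.Exports.

Local Open Scope classical_set_scope.
Local Open Scope complex_scope.
Local Open Scope ring_scope.

(** * Complex numbers through their coordinates *)

Section complex_coordinates.
Variable R : realType.
Implicit Types (x y : R[i]) (r : R).

Lemma Re_add x y : complex.Re (x + y) = complex.Re x + complex.Re y.
Proof. by case: x y => [? ?] []. Qed.

Lemma Im_add x y : complex.Im (x + y) = complex.Im x + complex.Im y.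
Proof. by case: x y => [? ?] []. Qed.

Lemma Re_opp x : complex.Re (- x) = - complex.Re x.
Proof. by case: x. Qed.

Lemma Im_opp x : complex.Im (- x) = - complex.Im x.
Proof. by case: x. Qed.

Lemma Re_mul x y : complex.Re (x * y) =
  complex.Re x * complex.Re y - complex.Im x * complex.Im y.
Proof. by case: x y => [? ?] []. Qed.

Lemma Im_mul x y : complex.Im (x * y) =
  complex.Re x * complex.Im y + complex.Im x * complex.Re y.
Proof. by case: x y => [? ?] []. Qed.

Lemma Re_conj x : complex.Re (conjc x) = complex.Re x.
Proof. by case: x. Qed.

Lemma Im_conj x : complex.Im (conjc x) = - complex.Im x.
Proof. by case: x. Qed.

Definition ReImE := (Re_add, Im_add, Re_opp, Im_opp, Re_mul, Im_mul, Re_conj, Im_conj).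

Lemma complex_eqP x y :
  complex.Re x = complex.Re y -> complex.Im x = complex.Im y -> x = y.
Proof. by case: x y => [? ?] [? ?] /= -> ->. Qed.

Lemma conjcK : involutive (@conjc R).
Proof. by move=> x; apply: complex_eqP; rewrite !ReImE ?opprK. Qed.

Lemma conjcD x y : conjc (x + y) = conjc x + conjc y.
Proof. by apply: complex_eqP; rewrite !ReImE ?opprD. Qed.

Lemma conjcN x : conjc (- x) = - conjc x.
Proof. by apply: complex_eqP; rewrite !ReImE. Qed.

Lemma conjcM x y : conjc (x * y) = conjc x * conjc y.
Proof. by apply: complex_eqP; rewrite !ReImE; ring. Qed.

Lemma conjc_real r : conjc r%:C = r%:C.
Proof. by rewrite /= oppr0. Qed.

Lemma conjc_0 : conjc (0 : R[i]) = 0.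
Proof. by apply: complex_eqP; rewrite !ReImE /= ?oppr0. Qed.

Lemma sqmod_ge0 x : 0 <= sqmod x.
Proof. by rewrite addr_ge0 // sqr_ge0. Qed.

Lemma sqmod_eq0 x : sqmod x = 0 -> x = 0.
Proof.
move/eqP; rewrite paddr_eq0 ?sqr_ge0 // !sqrf_eq0 => /andP[/eqP a /eqP b].
exact: complex_eqP.
Qed.

Lemma sqmod0 : sqmod (0 : R[i]) = 0.
Proof. by rewrite /sqmod /= expr0n addr0. Qed.

Lemma sqmodN x : sqmod (- x) = sqmod x.
Proof. by rewrite /sqmod !ReImE !sqrrN. Qed.

Lemma sqmodM x y : sqmod (x * y) = sqmod x * sqmod y.
Proof. by rewrite /sqmod !ReImE; ring. Qed.

Lemma sqmod_real r : sqmod r%:C = r ^+ 2.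
Proof. by rewrite /sqmod /= expr0n addr0. Qed.

Lemma mulcJ x : x * conjc x = (sqmod x)%:C.
Proof. by apply: complex_eqP; rewrite !ReImE /= /sqmod; ring. Qed.

(** The difference of the two sides is [sqmod (x - y)]. *)
Lemma sqmodD_le x y : sqmod (x + y) <= 2 * sqmod x + 2 * sqmod y.
Proof.
rewrite -subr_ge0 (_ : _ - _ = sqmod (x - y)) ?sqmod_ge0 //.
by rewrite /sqmod !ReImE; ring.
Qed.

Lemma sqmodB_le x y : sqmod (x - y) <= 2 * sqmod x + 2 * sqmod y.
Proof. by rewrite -(sqmodN y) sqmodD_le. Qed.

(** The integrability of an inner product follows from this bound. *)
Lemma Re_mulcJ_le x y : `|complex.Re (x * conjc y)| <= sqmod x + sqmod y.
Proof.
rewrite /sqmod !ReImE.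
set a := complex.Re x; set b := complex.Im x.
set c := complex.Re y; set d := complex.Im y.
rewrite ler_norml; apply/andP; split.
  rewrite -subr_ge0 (_ : _ - _ =
    ((a + c) ^+ 2 + (b + d) ^+ 2 + a ^+ 2 + b ^+ 2 + c ^+ 2 + d ^+ 2) / 2).
    by rewrite divr_ge0 // !addr_ge0 // sqr_ge0.
  by field.
rewrite -subr_ge0 (_ : _ - _ =
    ((a - c) ^+ 2 + (b - d) ^+ 2 + a ^+ 2 + b ^+ 2 + c ^+ 2 + d ^+ 2) / 2).
  by rewrite divr_ge0 // !addr_ge0 // sqr_ge0.
by field.
Qed.

(** The imaginary part becomes a real part when [y] is multiplied by a square
    root of [-1]. *)
Lemma Im_mulcJ_le x y : `|complex.Im (x * conjc y)| <= sqmod x + sqmod y.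
Proof.
have := Re_mulcJ_le x (y * (0 +i* 1)).
rewrite sqmodM {3}/sqmod /= expr0n expr1n add0r mulr1.
suff -> : complex.Im (x * conjc y) = complex.Re (x * conjc (y * (0 +i* 1))) by [].
by rewrite !ReImE /=; ring.
Qed.

End complex_coordinates.
(** * The space of square-integrable functions *)

Section L2_space.
Context d (T : measurableType d) (R : realType).
Variable mu : {measure set T -> \bar R}.
Local Notation cfun := (cfun T R).
Implicit Types (f g h u v : cfun) (c : R[i]).
Local Notation cint := (cintegral mu setT).
Local Notation cintble := (cintegrable mu setT).
Local Notation L2 := (L2 mu).
Local Notation ae_eq2 := (ae_eq2 mu).
Local Notation dot := (dot mu).
Local Notation sqdist := (sqdist mu).

Lemma cmeasurable_cst c : cmeasurable ((fun=> c) : cfun).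
Proof. by split; exact: measurable_cst. Qed.

Lemma cmeasurable_real (r : T -> R) : measurable_fun setT r ->
  cmeasurable (fun x => (r x)%:C).
Proof. by move=> mr; split => //=; exact: measurable_cst. Qed.

Lemma cmeasurableD f g : cmeasurable f -> cmeasurable g ->
  cmeasurable (fun x => f x + g x).
Proof.
move=> [rf mf] [rg mg]; split.
  by under eq_fun do rewrite Re_add; exact: measurable_funD.
by under eq_fun do rewrite Im_add; exact: measurable_funD.
Qed.

Lemma cmeasurableM f g : cmeasurable f -> cmeasurable g ->
  cmeasurable (fun x => f x * g x).
Proof.
move=> [rf mf] [rg mg]; split.
  by under eq_fun do rewrite Re_mul; apply: measurable_funB; apply: measurable_funM.
by under eq_fun do rewrite Im_mul; apply: measurable_funD; apply: measurable_funM.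
Qed.

Lemma cmeasurableZ c f : cmeasurable f -> cmeasurable (fun x => c * f x).
Proof. by move=> mf; apply: cmeasurableM => //; exact: cmeasurable_cst. Qed.

Lemma cmeasurableN f : cmeasurable f -> cmeasurable (fun x => - f x).
Proof.
move=> mf; rewrite (_ : (fun x => - f x) = (fun x => -1 * f x)).
  exact: cmeasurableZ.
by apply/funext => x; rewrite mulN1r.
Qed.

Lemma cmeasurableB f g : cmeasurable f -> cmeasurable g ->
  cmeasurable (fun x => f x - g x).
Proof. by move=> mf mg; apply: cmeasurableD => //; apply: cmeasurableN. Qed.

Lemma cmeasurableJ f : cmeasurable f -> cmeasurable (fun x => conjc (f x)).
Proof.
move=> [rf mf]; split.
  by under eq_fun do rewrite Re_conj.
by under eq_fun do rewrite Im_conj; exact: measurableT_comp.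
Qed.

Lemma measurable_sqmod f : cmeasurable f ->
  measurable_fun setT (fun x => sqmod (f x)).
Proof. by move=> [rf mf]; apply: measurable_funD; exact: measurable_funX. Qed.

Lemma integrable_scale r (u : T -> R) :
  mu.-integrable setT (fun x => (u x)%:E) ->
  mu.-integrable setT (fun x => (r * u x)%:E).
Proof. by move=> iu; under eq_fun do rewrite EFinM; exact: integrableZl. Qed.

Lemma cintbleD f g : cintble f -> cintble g -> cintble (fun x => f x + g x).
Proof.
move=> [rf mf] [rg mg]; split.
  by under eq_fun do rewrite Re_add EFinD; exact: integrableD.
by under eq_fun do rewrite Im_add EFinD; exact: integrableD.
Qed.

Lemma cintbleZ c f : cintble f -> cintble (fun x => c * f x).
Proof.
move=> [rf mf]; split.
  under eq_fun do rewrite Re_mul EFinB !EFinM.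
  by apply: integrableB => //; exact: integrableZl.
under eq_fun do rewrite Im_mul EFinD !EFinM.
by apply: integrableD => //; exact: integrableZl.
Qed.

Lemma cintD f g : cintble f -> cintble g ->
  cint (fun x => f x + g x) = cint f + cint g.
Proof.
move=> [rf mf] [rg mg]; apply: complex_eqP; rewrite !ReImE /=.
  by under eq_Rintegral do rewrite Re_add; rewrite RintegralD.
by under eq_Rintegral do rewrite Im_add; rewrite RintegralD.
Qed.

Lemma cintZ c f : cintble f -> cint (fun x => c * f x) = c * cint f.
Proof.
move=> [rf mf]; apply: complex_eqP; rewrite !ReImE /=.
  under eq_Rintegral do rewrite Re_mul.
  by rewrite RintegralB ?RintegralZl //; exact: integrable_scale.
under eq_Rintegral do rewrite Im_mul.
by rewrite RintegralD ?RintegralZl //; exact: integrable_scale.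
Qed.

Lemma cintJ f : cintble f -> cint (fun x => conjc (f x)) = conjc (cint f).
Proof.
move=> [rf mf]; apply: complex_eqP; rewrite !ReImE /=.
  by under eq_Rintegral do rewrite Re_conj.
under eq_Rintegral do rewrite Im_conj -mulN1r.
by rewrite RintegralZl // mulN1r.
Qed.

Lemma cint0 : cint (fun=> 0) = 0.
Proof. by apply: complex_eqP; rewrite /= Rintegral_cst // mul0r. Qed.

Lemma ae_eq2_refl f : ae_eq2 f f.
Proof. exact: aeW. Qed.

Lemma ae_eq2_trans f g h : ae_eq2 f g -> ae_eq2 g h -> ae_eq2 f h.
Proof. by apply: filterS2 => x -> ->. Qed.

Lemma ae_eq2D f f' g g' : ae_eq2 f f' -> ae_eq2 g g' ->
  ae_eq2 (fun x => f x + g x) (fun x => f' x + g' x).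
Proof. by apply: filterS2 => x -> ->. Qed.

Lemma ae_eq2M f f' g g' : ae_eq2 f f' -> ae_eq2 g g' ->
  ae_eq2 (fun x => f x * g x) (fun x => f' x * g' x).
Proof. by apply: filterS2 => x -> ->. Qed.

Lemma ae_eq2Z c f f' : ae_eq2 f f' ->
  ae_eq2 (fun x => c * f x) (fun x => c * f' x).
Proof. by apply: filterS => x ->. Qed.

Lemma ae_eq2J f f' : ae_eq2 f f' ->
  ae_eq2 (fun x => conjc (f x)) (fun x => conjc (f' x)).
Proof. by apply: filterS => x ->. Qed.

Lemma ae_eq2B0 f g : ae_eq2 (fun x => f x - g x) (fun=> 0) -> ae_eq2 f g.
Proof. by apply: filterS => x /eqP; rewrite subr_eq0 => /eqP. Qed.

Lemma cint_ae f g : cmeasurable f -> cmeasurable g -> ae_eq2 f g ->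
  cint f = cint g.
Proof.
move=> [rf mf] [rg mg] fg; apply: complex_eqP => /=; congr fine;
  apply: ae_eq_integral => //; try exact/measurable_EFinP;
  by apply: filterS fg => x /= ->.
Qed.

Lemma L2_0 : L2 (fun=> 0).
Proof.
split; first exact: cmeasurable_cst.
by under eq_integral do rewrite sqmod0; rewrite integral0.
Qed.

Lemma L2Z c f : L2 f -> L2 (fun x => c * f x).
Proof.
move=> [mf f2]; split; first exact: cmeasurableZ.
under eq_integral do rewrite sqmodM EFinM.
rewrite ge0_integralZl_EFin ?sqmod_ge0 //; last 2 first.
- by move=> x _; rewrite lee_fin sqmod_ge0.
- by apply/measurable_EFinP; exact: measurable_sqmod.
by rewrite lte_mul_pinfty // lee_fin sqmod_ge0.
Qed.

Lemma L2D f g : L2 f -> L2 g -> L2 (fun x => f x + g x).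
Proof.
move=> [mf f2] [mg g2]; split; first exact: cmeasurableD.
have m0 : measurable_fun setT (fun x => (2 * sqmod (f x))%:E).
  by apply/measurable_EFinP; apply: measurable_funM => //; exact: measurable_sqmod.
have m1 : measurable_fun setT (fun x => (2 * sqmod (g x))%:E).
  by apply/measurable_EFinP; apply: measurable_funM => //; exact: measurable_sqmod.
have p0 (u : cfun) x : [set: T] x -> (0 <= (2 * sqmod (u x))%:E)%E.
  by move=> _; rewrite lee_fin mulr_ge0 ?sqmod_ge0.
apply: (@le_lt_trans _ _
  (\int[mu]_x ((2 * sqmod (f x))%:E + (2 * sqmod (g x))%:E))%E).
  apply: ge0_le_integral => //.
  - by move=> x _; rewrite lee_fin sqmod_ge0.
  - by apply/measurable_EFinP; apply: measurable_sqmod; exact: cmeasurableD.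
  - by apply: emeasurable_funD.
  - by move=> x _; rewrite -EFinD lee_fin sqmodD_le.
rewrite ge0_integralD //; try exact: p0.
under eq_integral do rewrite EFinM.
under [X in (_ + X)%E]eq_integral do rewrite EFinM.
have ms (u : cfun) : cmeasurable u -> measurable_fun setT (fun x => (sqmod (u x))%:E).
  by move=> mu'; apply/measurable_EFinP; exact: measurable_sqmod.
rewrite !ge0_integralZl_EFin //; try (by apply: ms); try (by move=> x _; rewrite lee_fin sqmod_ge0).
by rewrite lte_add_pinfty // lte_mul_pinfty // lee_fin.
Qed.

Lemma L2N f : L2 f -> L2 (fun x => - f x).
Proof.
by move=> f2; under eq_fun do rewrite -mulN1r; exact: L2Z.
Qed.

Lemma L2B f g : L2 f -> L2 g -> L2 (fun x => f x - g x).
Proof. by move=> f2 g2; apply: L2D => //; exact: L2N. Qed.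

Lemma L2_sum I (r : seq I) (F : I -> cfun) :
  (forall i, L2 (F i)) -> L2 (fun x => \sum_(i <- r) F i x).
Proof.
move=> F2; elim: r => [|i r IH].
  by under eq_fun do rewrite big_nil; exact: L2_0.
by under eq_fun do rewrite big_cons; exact: L2D.
Qed.

Lemma L2_integrable_sqmod f : L2 f ->
  mu.-integrable setT (fun x => (sqmod (f x))%:E).
Proof.
move=> [mf f2]; apply/integrableP; split.
  by apply/measurable_EFinP; exact: measurable_sqmod.
by under eq_integral do rewrite /= ger0_norm ?sqmod_ge0 //.
Qed.

Lemma L2_cintble f g : L2 f -> L2 g -> cintble (fun x => f x * conjc (g x)).
Proof.
move=> f2 g2.
have [mf1 mf2] : cmeasurable (fun x => f x * conjc (g x)).
  by case: f2 g2 => ? _ [? _]; apply: cmeasurableM => //; exact: cmeasurableJ.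
have ifg : mu.-integrable setT (fun x => (sqmod (f x) + sqmod (g x))%:E).
  under eq_fun do rewrite EFinD.
  by apply: integrableD => //; exact: L2_integrable_sqmod.
split; apply: le_integrable ifg => //; try exact/measurable_EFinP.
- move=> x _; rewrite /= lee_fin [leRHS]ger0_norm; last by apply: addr_ge0; exact: sqmod_ge0.
  exact: Re_mulcJ_le.
- move=> x _; rewrite /= lee_fin [leRHS]ger0_norm; last by apply: addr_ge0; exact: sqmod_ge0.
  exact: Im_mulcJ_le.
Qed.

Lemma dotDl f g h : L2 f -> L2 g -> L2 h ->
  dot (fun x => f x + g x) h = dot f h + dot g h.
Proof.
move=> *; rewrite /Defs.dot -cintD; try exact: L2_cintble.
by under eq_fun do rewrite mulrDl.
Qed.

Lemma dotZl c f h : L2 f -> L2 h -> dot (fun x => c * f x) h = c * dot f h.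
Proof.
move=> *; rewrite /Defs.dot -cintZ; last exact: L2_cintble.
by under eq_fun do rewrite -mulrA.
Qed.

Lemma dotC f g : L2 f -> L2 g -> dot g f = conjc (dot f g).
Proof.
move=> *; rewrite /Defs.dot -cintJ; last exact: L2_cintble.
by congr (cintegral _ _ _); apply/funext => x; rewrite conjcM conjcK mulrC.
Qed.

Lemma dotDr f g h : L2 f -> L2 g -> L2 h ->
  dot h (fun x => f x + g x) = dot h f + dot h g.
Proof.
move=> f2 g2 h2; rewrite (dotC _ h2); last exact: L2D.
by rewrite dotDl // conjcD -!dotC.
Qed.

Lemma dotZr c f h : L2 f -> L2 h -> dot h (fun x => c * f x) = conjc c * dot h f.
Proof.
move=> f2 h2; rewrite (dotC _ h2); last exact: L2Z.
by rewrite dotZl // conjcM -dotC.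
Qed.

Lemma dotNl f h : L2 f -> L2 h -> dot (fun x => - f x) h = - dot f h.
Proof.
by move=> *; under eq_fun do rewrite -mulN1r; rewrite dotZl // mulN1r.
Qed.

Lemma dotBl f g h : L2 f -> L2 g -> L2 h ->
  dot (fun x => f x - g x) h = dot f h - dot g h.
Proof. by move=> f2 g2 h2; rewrite dotDl ?dotNl //; exact: L2N. Qed.

Lemma dot0l h : dot (fun=> 0) h = 0.
Proof. by rewrite /Defs.dot; under eq_fun do rewrite mul0r; exact: cint0. Qed.

Lemma dot_suml I (r : seq I) (F : I -> cfun) h : (forall i, L2 (F i)) -> L2 h ->
  dot (fun x => \sum_(i <- r) F i x) h = \sum_(i <- r) dot (F i) h.
Proof.
move=> F2 h2; elim: r => [|i r IH].
  by under eq_fun do rewrite big_nil; rewrite big_nil dot0l.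
under eq_fun do rewrite big_cons.
by rewrite dotDl ?big_cons ?IH //; exact: L2_sum.
Qed.

Lemma dot_ae f f' g g' : L2 f -> L2 f' -> L2 g -> L2 g' ->
  ae_eq2 f f' -> ae_eq2 g g' -> dot f g = dot f' g'.
Proof.
move=> [mf _] [mf' _] [mg _] [mg' _] ff' gg'; apply: cint_ae.
- by apply: cmeasurableM => //; exact: cmeasurableJ.
- by apply: cmeasurableM => //; exact: cmeasurableJ.
- by apply: ae_eq2M => //; exact: ae_eq2J.
Qed.

Definition nsq f : R := complex.Re (dot f f).

Lemma nsqE f : L2 f -> (\int[mu]_x (sqmod (f x))%:E)%E = (nsq f)%:E.
Proof.
move=> f2; rewrite /nsq /=.
under [in RHS]eq_Rintegral do rewrite mulcJ /=.
rewrite fineK //; apply: integrable_fin_num => //.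
exact: L2_integrable_sqmod.
Qed.

Lemma dotff f : dot f f = (nsq f)%:C.
Proof.
apply: complex_eqP => //=; under eq_Rintegral do rewrite mulcJ /=.
by rewrite Rintegral_cst // mul0r.
Qed.

Lemma sqdistE f g : L2 f -> L2 g -> sqdist f g = (nsq (fun x => f x - g x))%:E.
Proof. by move=> f2 g2; rewrite -nsqE //; exact: L2B. Qed.

Lemma nsq_ge0 f : 0 <= nsq f.
Proof.
rewrite /nsq /=; apply: Rintegral_ge0 => x _.
by rewrite mulcJ /= sqmod_ge0.
Qed.

Lemma nsqZ c f : L2 f -> nsq (fun x => c * f x) = sqmod c * nsq f.
Proof.
move=> f2; rewrite /nsq dotZl ?dotZr //; try exact: L2Z.
by rewrite mulrA mulcJ dotff -rmorphM.
Qed.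

Lemma nsqD f g : L2 f -> L2 g ->
  nsq (fun x => f x + g x) = nsq f + nsq g + 2 * complex.Re (dot f g).
Proof.
move=> f2 g2; have fg2 := L2D f2 g2.
rewrite /nsq dotDl // !dotDr // (dotC f2 g2) !ReImE.
by ring.
Qed.

Lemma nsq0 : nsq (fun=> 0) = 0.
Proof. by rewrite /nsq dot0l. Qed.

Lemma nsq_ae f g : L2 f -> L2 g -> ae_eq2 f g -> nsq f = nsq g.
Proof. by move=> f2 g2 fg; rewrite /nsq (dot_ae f2 g2 f2 g2). Qed.

Lemma nsq_eq0 f : L2 f -> nsq f = 0 -> ae_eq2 f (fun=> 0).
Proof.
move=> f2 f0; have mf : cmeasurable f by case: f2.
have i0 : (\int[mu]_x `|(sqmod (f x))%:E| = 0)%E.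
  by under eq_integral do rewrite /= ger0_norm ?sqmod_ge0 //; rewrite nsqE // f0.
have ms : measurable_fun setT (fun x => (sqmod (f x))%:E).
  by apply/measurable_EFinP; exact: measurable_sqmod.
have := (ae_eq_integral_abs mu measurableT ms).1 i0.
by apply: filterS => x /(_ I) [] /sqmod_eq0.
Qed.

Lemma dot_eq0l f g : L2 f -> L2 g -> nsq f = 0 -> dot f g = 0.
Proof.
move=> f2 g2 /(nsq_eq0 f2) f0; rewrite -(dot0l g).
by apply: dot_ae => //; [exact: L2_0 | exact: ae_eq2_refl].
Qed.

Lemma cauchy_schwarz f g : L2 f -> L2 g -> sqmod (dot f g) <= nsq f * nsq g.
Proof.
move=> f2 g2; have [g0|g0] := eqVneq (nsq g) 0.
  by rewrite (dotC g2 f2) dot_eq0l // conjc_0 sqmod0 g0 mulr0.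
have gp : 0 < nsq g by rewrite lt_neqAle eq_sym g0 nsq_ge0.
(* f + c * g is orthogonal to g *)
pose c : R[i] := - (dot f g * (nsq g)^-1%:C).
have := nsq_ge0 (fun x => f x + c * g x).
rewrite nsqD ?nsqZ ?dotZr //; try exact: L2Z.
have -> : complex.Re (conjc c * dot f g) = - (sqmod (dot f g) / nsq g).
  rewrite /c conjcN conjcM conjc_real mulNr Re_opp mulrAC [conjc _ * _]mulrC mulcJ.
  by rewrite -rmorphM.
rewrite /c sqmodN sqmodM sqmod_real.
move: (nsq f) (sqmod _) => a b h.
have : 0 <= (a + b * (nsq g)^-1 ^+ 2 * nsq g + 2 * - (b / nsq g)) * nsq g.
  by rewrite mulr_ge0 // ltW.
rewrite (_ : _ * _ = a * nsq g - b) ?subr_ge0 //.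
by field.
Qed.

End L2_space.
(** * Completeness *)

Section completeness.
Context d (T : measurableType d) (R : realType).
Variable mu : {measure set T -> \bar R}.
Local Notation cfun := (cfun T R).
Implicit Types (f g h v : cfun) (w : nat -> cfun).
Local Notation L2 := (L2 mu).
Local Notation ae_eq2 := (ae_eq2 mu).
Local Notation dot := (dot mu).
Local Notation nsq := (nsq mu).

Definition cvg2 w v := (fun n => nsq (fun x => w n x - v x)) @ \oo --> (0 : R).

(** Convergence is expressed on the coordinates, where the limit theorems for
    real sequences apply. *)
Definition ptcvg w v := forall x,
  ((fun k => complex.Re (w k x)) @ \oo --> complex.Re (v x)) /\
  ((fun k => complex.Im (w k x)) @ \oo --> complex.Im (v x)).

Lemma ptcvg_measurable w v : (forall k, cmeasurable (w k)) -> ptcvg w v ->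
  cmeasurable v.
Proof.
move=> mw wv; split.
  apply: (@measurable_fun_cvg _ _ _ _ (fun k x => complex.Re (w k x))).
    by move=> k; case: (mw k).
  by move=> x _; case: (wv x).
apply: (@measurable_fun_cvg _ _ _ _ (fun k x => complex.Im (w k x))).
  by move=> k; case: (mw k).
by move=> x _; case: (wv x).
Qed.

Lemma ptcvg_sqmod f w v x : ptcvg w v ->
  (fun k => sqmod (f x - w k x)) @ \oo --> sqmod (f x - v x).
Proof.
move=> /(_ x) [rv iv]; rewrite /sqmod.
under eq_fun do rewrite !ReImE.
rewrite !ReImE !expr2.
by apply: cvgD; apply: cvgM; apply: cvgB => //; exact: cvg_cst.
Qed.

(** Fatou's lemma turns a bound on the distances to the functions of a
    sequence into one on the distance to its pointwise limit. *)
Lemma fatou_sqmod f w v (e : R) (K : nat) : L2 f -> (forall k, L2 (w k)) ->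
  ptcvg w v -> (forall k, (K <= k)%N -> nsq (fun x => f x - w k x) <= e) ->
  (\int[mu]_x (sqmod (f x - v x))%:E <= e%:E)%E.
Proof.
move=> f2 w2 wv we.
have mw k : cmeasurable (w k) by case: (w2 k).
have mf : cmeasurable f by case: f2.
have msw k : measurable_fun setT (fun x => (sqmod (f x - w k x))%:E).
  by apply/measurable_EFinP/measurable_sqmod; exact: cmeasurableB.
have -> : (\int[mu]_x (sqmod (f x - v x))%:E =
    \int[mu]_x limn_einf (fun k => (sqmod (f x - w k x))%:E))%E.
  apply: eq_integral => x _.
  have : (fun k => (sqmod (f x - w k x))%:E) @ \oo --> (sqmod (f x - v x))%:E.
    by apply: cvg_EFin; [near=> k | exact: (@ptcvg_sqmod f w v x wv)].
  by move/cvg_limn_einf_sup => [->].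
apply: (le_trans (fatou mu measurableT msw _)).
  by move=> k x _; rewrite lee_fin sqmod_ge0.
rewrite limn_einf_lim; apply: lime_le; first exact: is_cvg_einfs.
near=> n; apply: ereal_inf_le.
exists (nsq (fun x => f x - w (maxn n K) x))%:E; last first.
  by rewrite lee_fin we // leq_maxr.
by exists (maxn n K); [rewrite /= leq_maxl | rewrite nsqE //; exact: L2B].
Unshelve. all: end_near. Qed.

Definition cauchy2 w := forall e : R, 0 < e -> exists K, forall m n,
  (K <= m)%N -> (K <= n)%N -> nsq (fun x => w m x - w n x) < e.

(** The increments stay summable when multiplied by [2 ^ k], as
    [cvgn_increments] requires. *)
Lemma fast_subseq w : cauchy2 w -> exists s : nat -> nat,
  (forall k, (k <= s k)%N) /\
  forall k, nsq (fun x => w (s k.+1) x - w (s k) x) <= 4^-1 ^+ k.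
Proof.
move=> cw.
have /choice[N HN] k : exists K, forall m n, (K <= m)%N -> (K <= n)%N ->
    nsq (fun x => w m x - w n x) < 4^-1 ^+ k.
  by apply: cw; rewrite exprn_gt0 // invr_gt0.
pose s k := (k + \sum_(j < k.+1) N j)%N.
have Ns k : (N k <= s k)%N by rewrite /s big_ord_recr /= addnA leq_addl.
exists s; split=> k; first by rewrite leq_addr.
apply/ltW/HN => //; apply: (leq_trans (Ns k)).
by rewrite /s [in leqRHS]big_ord_recr /=; lia.
Qed.

Lemma sum_half_le2 n : \sum_(k < n) (2^-1 : R) ^+ k <= 2.
Proof.
suff -> : \sum_(k < n) (2^-1 : R) ^+ k = 2 - 2 * 2^-1 ^+ n.
  by rewrite gerBl mulr_ge0 // exprn_ge0 // invr_ge0.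
elim: n => [|n IH]; first by rewrite big_ord0 expr0 mulr1 subrr.
by rewrite big_ord_recr /= IH exprS; field.
Qed.

(** Square-summable increments converge at almost every point, because
    [a <= 2^-k + 2^k a^2] bounds them by an absolutely convergent series. *)
Lemma cvgn_increments (a : nat -> R) (M : R) :
  (forall n, \sum_(k < n) 2 ^+ k * (a k.+1 - a k) ^+ 2 <= M) -> cvgn a.
Proof.
move=> aM.
have -> : a = (fun n => a 0%N + series (fun k => a k.+1 - a k) n).
  apply/funext => n; rewrite /series /= telescope_sumr //.
  by rewrite addrC subrK.
apply: is_cvgD; first exact: is_cvg_cst.
apply: normed_cvg.
apply: nondecreasing_is_cvgn.
  by apply: nondecreasing_series => n _ _; rewrite normr_ge0.
exists (2 + M) => _ [n _ <-] /=.
apply: (@le_trans _ _ (\sum_(0 <= k < n) (2^-1 ^+ k +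
    2 ^+ k * (a k.+1 - a k) ^+ 2))).
  apply: ler_sum => k _; set t := (a k.+1 - a k).
  have p : 0 < (2 : R) ^+ k by rewrite exprn_gt0.
  rewrite exprVn -(@ler_pM2l _ (2 ^+ k)) // mulrDr mulfV ?gt_eqF //.
  rewrite -(real_normK (num_real t)) -subr_ge0.
  have := normr_ge0 t; move: p; move: (2 ^+ k) `|t| => u v u0 v0.
  rewrite (_ : _ - _ = (1 - u * v) ^+ 2 + u * v); last by ring.
  by rewrite addr_ge0 ?sqr_ge0 // mulr_ge0 // ltW.
rewrite big_split /= big_mkord; apply: lerD; last by rewrite big_mkord.
exact: sum_half_le2.
Qed.

Lemma nneseries_partial_le (a : nat -> R) (M : R) : (forall k, 0 <= a k) ->
  (\sum_(0 <= k <oo) (a k)%:E = M%:E)%E -> forall n, \sum_(k < n) a k <= M.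
Proof.
move=> a0 aM n; rewrite -lee_fin -aM -(big_mkord xpredT a) -sumEFin.
by apply: nneseries_lim_ge => k _; rewrite lee_fin.
Qed.

(** Riesz-Fischer: a rapidly Cauchy subsequence converges almost everywhere,
    and its pointwise limit is the limit in the mean by Fatou's lemma. *)
Lemma riesz_fischer w : (forall k, L2 (w k)) -> cauchy2 w ->
  exists v, L2 v /\ cvg2 w v.
Proof.
move=> w2 cw; have [s [ks sw]] := fast_subseq cw.
pose D k x := 2 ^+ k * sqmod (w (s k.+1) x - w (s k) x).
have D0 k x : 0 <= D k x by rewrite mulr_ge0 ?exprn_ge0 ?sqmod_ge0.
have B2 k := L2B (w2 (s k.+1)) (w2 (s k)).
have mD k : measurable_fun setT (fun x => (D k x)%:E).
  apply/measurable_EFinP/measurable_funM => //.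
  by apply: measurable_sqmod; case: (B2 k).
pose S x := (\sum_(0 <= k <oo) (D k x)%:E)%E.
have mS : measurable_fun setT S.
  by apply: ge0_emeasurable_sum => // k x _ _; rewrite lee_fin.
have S0 x : (0 <= S x)%E by apply: nneseries_ge0 => k _ _; rewrite lee_fin.
have iS : mu.-integrable setT S.
  apply/integrableP; split => //.
  under eq_integral do rewrite gee0_abs //.
  rewrite integral_nneseries //; last by move=> k x _; rewrite lee_fin.
  apply: (@le_lt_trans _ _ 2%:E); last exact: ltry.
  apply: lime_le.
    by apply: is_cvg_nneseries => k _ _; apply: integral_ge0 => x _; rewrite lee_fin.
  near=> n.
  apply: (@le_trans _ _ (\sum_(0 <= k < n) (2^-1 ^+ k)%:E)%E).
    apply: lee_sum => k _; rewrite /D.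
    under eq_integral do rewrite EFinM.
    rewrite ge0_integralZl_EFin ?exprn_ge0 //; last 2 first.
    - by move=> x _; rewrite lee_fin sqmod_ge0.
    - by apply/measurable_EFinP/measurable_sqmod; case: (B2 k).
    rewrite nsqE // -EFinM lee_fin (_ : 2^-1 = 2 * 4^-1); last by field.
    by rewrite exprMn ler_pM2l ?exprn_gt0.
  rewrite sumEFin lee_fin big_mkord.
  exact: sum_half_le2.
pose G := [set x | S x \is a fin_num].
have mG : measurable G.
  by rewrite -[G]setTI; exact: emeasurable_fin_num.
have aeG : {ae mu, forall x, G x}.
  by have := integrable_ae measurableT iS; apply: filterS => x; apply.
have mI : cmeasurable (fun x => (\1_G x : R)%:C).
  exact/cmeasurable_real/measurable_indic.
pose w' k x := (\1_G x : R)%:C * w (s k) x.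
have w'w k : ae_eq2 (w' k) (w (s k)).
  by apply: filterS aeG => x Gx; rewrite /w' indicE mem_set // mul1r.
have Sx x : G x -> forall n, \sum_(k < n) D k x <= fine (S x).
  by move=> Gx; apply: (@nneseries_partial_le (fun k => D k x)) => //; rewrite fineK.
have cvgw' x : cvgn (fun k => complex.Re (w' k x)) /\
               cvgn (fun k => complex.Im (w' k x)).
  have [Gx|nGx] := pselect (G x); last first.
    rewrite /w' indicE memNset //.
    by under eq_fun do rewrite mul0r; under [X in _ /\ cvg (X @ _)]eq_fun do
      rewrite mul0r; split; exact: is_cvg_cst.
  rewrite /w' indicE mem_set //.
  under eq_fun do rewrite mul1r.
  under [X in _ /\ cvg (X @ _)]eq_fun do rewrite mul1r.
  split; apply: (@cvgn_increments _ (fine (S x))) => n;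
    apply: le_trans (Sx x Gx n); apply: ler_sum => k _; rewrite ler_pM2l ?exprn_gt0 //;
    rewrite /sqmod !ReImE.
  - by rewrite lerDl sqr_ge0.
  - by rewrite lerDr sqr_ge0.
pose v x := (limn (fun k => complex.Re (w' k x))) +i* (limn (fun k => complex.Im (w' k x))).
have w'v : ptcvg w' v by move=> x; have [] := cvgw' x.
have mw' k : cmeasurable (w' k) by apply: cmeasurableM => //; case: (w2 (s k)).
have mv := ptcvg_measurable mw' w'v.
have w'2 k : L2 (w' k).
  split => //; rewrite (@ae_eq_integral _ _ _ mu _ (fun x => (sqmod (w (s k) x))%:E)) //.
  - by case: (w2 (s k)).
  - by apply/measurable_EFinP/measurable_sqmod.
  - by apply/measurable_EFinP/measurable_sqmod; case: (w2 (s k)).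
  - by apply: filterS (w'w k) => x ->.
have bnd (e : R) : 0 < e -> exists N, forall n, (N <= n)%N ->
    (\int[mu]_x (sqmod (w n x - v x))%:E <= e%:E)%E.
  move=> /cw[N HN]; exists N => n Nn.
  apply: (@fatou_sqmod _ w' v e N) => // k Nk.
  rewrite (@nsq_ae _ _ _ mu _ (fun x => w n x - w (s k) x)) //.
  - by apply/ltW/HN => //; apply: leq_trans Nk (ks k).
  - exact: L2B.
  - exact: L2B.
  - by apply: filterS (w'w k) => x ->.
have v2 : L2 v.
  have [N /(_ N (leqnn N)) vN] := bnd 1 ltr01.
  have -> : v = (fun x => w N x - (w N x - v x)).
    by apply/funext => x; rewrite opprB addrC subrK.
  apply: L2B => //; split; first by apply: cmeasurableB => //; case: (w2 N).
  exact: le_lt_trans vN (ltry _).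
exists v; split => //.
apply/cvgrPdist_lt => e e0.
have [N HN] := bnd (e / 2) ltac:(by rewrite divr_gt0).
near=> n; rewrite sub0r normrN ger0_norm ?nsq_ge0 //.
apply: (@le_lt_trans _ _ (e / 2)); last by rewrite ltr_pdivrMr // ltr_pMr // ltr1n.
by rewrite -lee_fin -nsqE; [apply: HN; near: n; exists N | exact: L2B].
Unshelve. all: end_near. Qed.

(** By the Cauchy-Schwarz inequality for [w k - v] and [g]. *)
Lemma cvg2_dot w v g : (forall k, L2 (w k)) -> L2 v -> L2 g -> cvg2 w v ->
  (fun k => complex.Re (dot (w k) g)) @ \oo --> complex.Re (dot v g) /\
  (fun k => complex.Im (dot (w k) g)) @ \oo --> complex.Im (dot v g).
Proof.
move=> w2 v2 g2 wv.
have cs k : sqmod (dot (w k) g - dot v g) <=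
    nsq (fun x => w k x - v x) * nsq g.
  by rewrite -dotBl //; apply: cauchy_schwarz => //; exact: L2B.
have lim0 : (fun k => nsq (fun x => w k x - v x) * nsq g) @ \oo --> (0 : R).
  by rewrite -(mul0r (nsq g)); apply: cvgMr_tmp.
have sq (a : nat -> R) (l : R) : (forall k, (a k - l) ^+ 2 <=
    nsq (fun x => w k x - v x) * nsq g) -> a @ \oo --> l.
  move=> al; apply/cvgrPdist_lt => e e0.
  have e20 : 0 < e ^+ 2 by rewrite exprn_gt0.
  move/cvgrPdist_lt : lim0 => /(_ _ e20).
  apply: filterS => k /=; rewrite sub0r normrN => /(le_lt_trans (ler_norm _)) nk.
  rewrite distrC -(ltr_pXn2r (ltn0Sn 1)) ?nnegrE ?normr_ge0 ?ltW //.
  by rewrite real_normK ?num_real //; exact: le_lt_trans (al k) nk.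
by split; apply: sq => k; apply: le_trans (cs k); rewrite /sqmod !ReImE;
  rewrite ?lerDl ?lerDr sqr_ge0.
Qed.

End completeness.
(** * Expansions in an orthogonal system *)

Lemma cvg_eq (R : realType) (a b : nat -> R) (k l : R) :
  a @ \oo --> k -> b @ \oo --> l -> a =1 b -> k = l.
Proof.
move=> ak + /funext ab; rewrite -ab => al.
exact: (cvg_unique _ ak al).
Qed.

Lemma cvg_eventually (R : realType) (a : nat -> R) (k l : R) :
  a @ \oo --> l -> (\forall n \near \oo, a n = k) -> l = k.
Proof. by move=> al ak; exact: (cvg_unique _ al (cvg_near_cst _ ak)). Qed.

Section orthogonal_system.
Context d (T : measurableType d) (R : realType).
Variable mu : {measure set T -> \bar R}.
Local Notation cfun := (cfun T R).
Implicit Types (f g h u v : cfun).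
Local Notation L2 := (L2 mu).
Local Notation ae_eq2 := (ae_eq2 mu).
Local Notation dot := (dot mu).
Local Notation nsq := (nsq mu).
Local Notation cvg2 := (cvg2 mu).

(** Allowing null vectors makes it possible to index by all natural numbers a
    system whose natural index set is only countable. *)
Record total_system (e : nat -> cfun) : Prop := TotalSystem {
  system_L2 : forall i, L2 (e i);
  system_orth : forall i j, i != j -> dot (e i) (e j) = 0;
  system_norm : forall i, nsq (e i) = 0 \/ nsq (e i) = 1;
  system_total : forall f, L2 f -> (forall i, dot f (e i) = 0) ->
    ae_eq2 f (fun=> 0) }.

Variable e : nat -> cfun.
Hypothesis es : total_system e.
Let e2 := system_L2 es.

Definition coef f i : R[i] := dot f (e i).
Definition psum (c : nat -> R[i]) n : cfun := fun x => \sum_(i < n) c i * e i x.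

Lemma psum_L2 c n : L2 (psum c n).
Proof. by apply: (@L2_sum _ _ _ _ _ _ (fun i x => c (val i) * e (val i) x)) => i; exact: L2Z. Qed.

Lemma psumS c n : psum c n.+1 = (fun x => psum c n x + c n * e n x).
Proof. by apply/funext => x; rewrite /psum big_ord_recr. Qed.

Lemma dot_psum c n g : L2 g -> dot (psum c n) g = \sum_(i < n) c i * dot (e i) g.
Proof.
move=> g2; rewrite (dot_suml _ (F := fun i x => c (val i) * e (val i) x)) //.
  by apply: eq_bigr => i _; rewrite dotZl.
by move=> i; exact: L2Z.
Qed.

Lemma coef_psum c n j :
  coef (psum c n) j = if (j < n)%N then c j * (nsq (e j))%:C else 0.
Proof.
rewrite /coef dot_psum //; case: ltnP => jn.
  rewrite (bigD1 (Ordinal jn)) //= dotff big1 ?addr0 // => i ij.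
  by rewrite system_orth ?mulr0.
rewrite big1 // => i _; rewrite system_orth ?mulr0 //.
by rewrite neq_ltn (leq_trans (ltn_ord i) jn).
Qed.

Lemma nsq_psum c n : nsq (psum c n) = \sum_(i < n) sqmod (c i) * nsq (e i).
Proof.
elim: n => [|n IH].
  by rewrite big_ord0 -(nsq0 mu); congr nsq; apply/funext => x; rewrite /psum big_ord0.
rewrite psumS nsqD ?nsqZ ?IH ?big_ord_recr //; last 2 first.
- exact: psum_L2.
- exact: L2Z.
rewrite dotZr //; last exact: psum_L2.
by rewrite -/(coef (psum c n) n) coef_psum ltnn mulr0 /= mulr0 addr0.
Qed.

Lemma psumB c m n : (m <= n)%N ->
  (fun x => psum c n x - psum c m x) = psum (fun i => if (i < m)%N then 0 else c i) n.
Proof.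
move=> mn; apply/funext => x; rewrite /psum.
rewrite -!(big_mkord xpredT (fun i => c i * e i x)).
rewrite -(big_mkord xpredT (fun i => (if (i < m)%N then 0 else c i) * e i x)).
rewrite (big_cat_nat (leq0n m) mn) [X in _ = X](big_cat_nat (leq0n m) mn) /= addrAC subrr add0r.
rewrite [X in _ = X + _]big_nat [X in _ = X + _]big1 ?add0r => [|i im].
  by rewrite !big_nat; apply: eq_bigr => i /andP[mi _]; rewrite ltnNge mi.
by case/andP: im => _ ->; rewrite mul0r.
Qed.

Lemma nsq_psumB c m n : (m <= n)%N -> nsq (fun x => psum c n x - psum c m x) =
  \sum_(i < n) sqmod (c i) * nsq (e i) - \sum_(i < m) sqmod (c i) * nsq (e i).
Proof.
move=> mn; rewrite psumB // nsq_psum.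
rewrite -!(big_mkord xpredT (fun i => sqmod (c i) * nsq (e i))).
rewrite -(big_mkord xpredT (fun i => sqmod (if (i < m)%N then 0 else c i) * nsq (e i))).
rewrite [X in _ = X - _](big_cat_nat (leq0n m) mn) /= addrAC subrr add0r.
rewrite (big_cat_nat (leq0n m) mn) /= [X in X + _]big_nat [X in X + _]big1 ?add0r => [|i im].
  by rewrite !big_nat; apply: eq_bigr => i /andP[mi _]; rewrite ltnNge mi.
by case/andP: im => _ ->; rewrite sqmod0 mul0r.
Qed.

(** The distances of the partial sums are the increments of a bounded monotone
    sequence, so they form a Cauchy sequence. *)
Lemma synthesis (c : nat -> R[i]) (M : R) :
  (forall n, \sum_(i < n) sqmod (c i) * nsq (e i) <= M) ->
  exists u, [/\ L2 u, cvg2 (psum c) u & forall i, coef u i = c i * (nsq (e i))%:C].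
Proof.
move=> cM.
pose s n := \sum_(i < n) sqmod (c i) * nsq (e i).
have s_nd : nondecreasing_seq s.
  apply/nondecreasing_seqP => n; rewrite /s big_ord_recr lerDl mulr_ge0 ?sqmod_ge0 ?nsq_ge0 //.
have cs : cvgn s.
  by apply: nondecreasing_is_cvgn => //; exists M => _ [n _ <-]; exact: cM.
have [u [u2 cu]] : exists u, L2 u /\ cvg2 (psum c) u.
  apply: riesz_fischer; first exact: psum_L2.
  move=> r r0.
  have /cauchy_cvgP/cauchy_ballP/(_ _ r0) := cs.
  case=> -[A B] /= [[KA _ HA] [KB _ HB]] AB.
  have Hlt m n : (KA <= m)%N -> (KB <= n)%N -> `|s m - s n| < r.
    by move=> /HA mA /HB nB; have := AB (s m, s n) (conj mA nB); rewrite /ball /=.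
  exists (maxn KA KB) => m n; rewrite !geq_max => /andP[Am Bm] /andP[An Bn].
  have [mn|/ltnW nm] := leqP n m.
    by rewrite nsq_psumB // (le_lt_trans (ler_norm _)) // Hlt.
  rewrite (_ : nsq _ = nsq (fun x => psum c n x - psum c m x)).
    by rewrite nsq_psumB // (le_lt_trans (ler_norm _)) // Hlt.
  rewrite (_ : (fun x => psum c m x - _) = (fun x => -1 * (psum c n x - psum c m x))).
    rewrite nsqZ; last by apply: L2B; exact: psum_L2.
    by rewrite sqmodN /sqmod /= expr0n expr1n addr0 mul1r.
  by apply/funext => x; rewrite mulN1r opprB.
exists u; split => // i.
have [ru iu] := cvg2_dot (psum_L2 c) u2 (e2 i) cu.
have near_eq : \forall n \near \oo, dot (psum c n) (e i) = c i * (nsq (e i))%:C.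
  by exists i.+1 => // n /= ni; rewrite -/(coef _ _) coef_psum ni.
apply: complex_eqP.
  by apply: (cvg_eventually ru); apply: filterS near_eq => n ->.
by apply: (cvg_eventually iu); apply: filterS near_eq => n ->.
Qed.

Lemma coef_null f i : L2 f -> nsq (e i) = 0 -> coef f i = 0.
Proof.
by move=> f2 i0; rewrite /coef (dotC (e2 i) f2) dot_eq0l // conjc_0.
Qed.

Lemma coefK f i : L2 f -> coef f i * (nsq (e i))%:C = coef f i.
Proof.
move=> f2; have [i0|->] := system_norm es i; last by rewrite mulr1.
by rewrite coef_null // mul0r.
Qed.

Lemma sqmod_coefK f i : L2 f -> sqmod (coef f i) * nsq (e i) = sqmod (coef f i).
Proof.
move=> f2; have [i0|->] := system_norm es i; last by rewrite mulr1.
by rewrite coef_null // sqmod0 mul0r.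
Qed.

Lemma coef_e i j : coef (e i) j = if i == j then (nsq (e i))%:C else 0.
Proof.
by case: eqVneq => [->|ij]; rewrite /coef ?dotff // system_orth.
Qed.

Lemma coef_unique f g : L2 f -> L2 g -> (forall i, coef f i = coef g i) ->
  ae_eq2 f g.
Proof.
move=> f2 g2 fg; apply/ae_eq2B0/(system_total es); first exact: L2B.
by move=> i; rewrite dotBl // -!/(coef _ i) fg subrr.
Qed.

Lemma coef_ae f g i : L2 f -> L2 g -> ae_eq2 f g -> coef f i = coef g i.
Proof. by move=> f2 g2 fg; apply: dot_ae => //; exact: ae_eq2_refl. Qed.

Lemma coefD f g i : L2 f -> L2 g -> coef (fun x => f x + g x) i = coef f i + coef g i.
Proof. by move=> *; exact: dotDl. Qed.

Lemma coefZ c f i : L2 f -> coef (fun x => c * f x) i = c * coef f i.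
Proof. by move=> *; exact: dotZl. Qed.

Lemma coefB f g i : L2 f -> L2 g -> coef (fun x => f x - g x) i = coef f i - coef g i.
Proof. by move=> *; exact: dotBl. Qed.

(** The squared norm of [f - psum (coef f) n] is nonnegative. *)
Lemma bessel f n : L2 f -> \sum_(i < n) sqmod (coef f i) <= nsq f.
Proof.
move=> f2; have p2 := psum_L2 (coef f) n.
have := nsq_ge0 mu (fun x => f x + -1 * psum (coef f) n x).
rewrite nsqD ?nsqZ ?dotZr ?(dotC p2) //; try exact: L2Z.
rewrite nsq_psum dot_psum //.
rewrite (eq_bigr (fun i : 'I_n => sqmod (coef f i))); last first.
  by move=> i _; rewrite sqmod_coefK.
rewrite (eq_bigr (fun i : 'I_n => (sqmod (coef f i))%:C)); last first.
  by move=> i _; rewrite (dotC f2) // -/(coef _ _) mulcJ.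
rewrite -rmorph_sum sqmodN /sqmod !ReImE /= -/(sqmod _).
move: (\sum_(i < n) _) => s; move: (nsq f) => N.
by rewrite (_ : _ + _ = N - s) ?subr_ge0 //; ring.
Qed.

(** The sum of the Fourier series has the coefficients of [f], hence equals
    [f] because the system is total. *)
Lemma fourier f : L2 f -> cvg2 (psum (coef f)) f.
Proof.
move=> f2; have [n|u [u2 cu ue]] := @synthesis (coef f) (nsq f).
  by under eq_bigr do rewrite sqmod_coefK //; exact: bessel.
have uf : ae_eq2 u f.
  by apply: coef_unique => // i; rewrite ue coefK.
apply: cvg_trans cu; apply: near_eq_cvg; apply: nearW => n.
apply: nsq_ae; try by (apply: L2B => //; exact: psum_L2).
by apply: filterS uf => x ->.
Qed.

Lemma parseval f g : L2 f -> L2 g ->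
  (fun n => \sum_(i < n) complex.Re (coef f i * conjc (coef g i))) @ \oo -->
  complex.Re (dot f g).
Proof.
move=> f2 g2; have [+ _] := cvg2_dot (psum_L2 (coef f)) f2 g2 (fourier f2).
apply: cvg_trans; apply: near_eq_cvg; apply: nearW => n; rewrite dot_psum //.
elim: n => [|n IH]; first by rewrite !big_ord0.
by rewrite !big_ord_recr Re_add IH (dotC g2 (e2 _)).
Qed.

Lemma parseval_im f g : L2 f -> L2 g ->
  (fun n => \sum_(i < n) complex.Im (coef f i * conjc (coef g i))) @ \oo -->
  complex.Im (dot f g).
Proof.
move=> f2 g2; have [_] := cvg2_dot (psum_L2 (coef f)) f2 g2 (fourier f2).
apply: cvg_trans; apply: near_eq_cvg; apply: nearW => n; rewrite dot_psum //.
elim: n => [|n IH]; first by rewrite !big_ord0.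
by rewrite !big_ord_recr Im_add IH (dotC g2 (e2 _)).
Qed.

Lemma dot_coef_eq f g f' g' : L2 f -> L2 g -> L2 f' -> L2 g' ->
  (forall i, coef f i * conjc (coef g i) = coef f' i * conjc (coef g' i)) ->
  dot f g = dot f' g'.
Proof.
move=> f2 g2 f'2 g'2 E; apply: complex_eqP.
  apply: (cvg_eq (parseval f2 g2) (parseval f'2 g'2)) => n.
  by apply: eq_bigr => i _; rewrite E.
apply: (cvg_eq (parseval_im f2 g2) (parseval_im f'2 g'2)) => n.
by apply: eq_bigr => i _; rewrite E.
Qed.

(** Bounded factors preserve square-summability, so [synthesis] applies. *)
Lemma multiplier (c : nat -> R[i]) (M : R) f : (forall i, sqmod (c i) <= M) ->
  L2 f -> exists u, L2 u /\ forall i, coef u i = c i * coef f i.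
Proof.
move=> cM f2.
have [n|u [u2 _ ue]] := @synthesis (fun i => c i * coef f i) (M * nsq f).
  apply: (@le_trans _ _ (\sum_(i < n) M * sqmod (coef f i))).
    apply: ler_sum => i _; rewrite sqmodM -mulrA sqmod_coefK //.
    by rewrite ler_wpM2r // sqmod_ge0.
  rewrite -mulr_sumr ler_wpM2l ?bessel //.
  exact: le_trans (sqmod_ge0 _) (cM 0%N).
by exists u; split => // i; rewrite ue -mulrA coefK.
Qed.

End orthogonal_system.
(** * Diagonal operators *)

Section diagonal_operators.
Context d (T : measurableType d) (R : realType).
Variable mu : {measure set T -> \bar R}.
Local Notation cfun := (cfun T R).
Local Notation operator := (operator T R).
Implicit Types (f g h u v : cfun) (a b l : nat -> R).
Local Notation L2 := (L2 mu).
Local Notation ae_eq2 := (ae_eq2 mu).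
Local Notation dot := (dot mu).
Local Notation nsq := (nsq mu).
Local Notation sqdist := (sqdist mu).
Variable e : nat -> cfun.
Hypothesis es : total_system mu e.
Let e2 := system_L2 es.
Local Notation coef := (coef mu e).
Local Notation psum := (psum e).

(** The self-adjoint operator with eigenvectors [e i] and eigenvalues [l i],
    on its maximal domain. *)
Definition diag l : operator := [set fg | [/\ L2 fg.1, L2 fg.2 &
  forall i, coef fg.2 i = (l i)%:C * coef fg.1 i]].

(** All coefficients on a null vector vanish. *)
Lemma eq_diag a b : (forall i, nsq (e i) <> 0 -> a i = b i) -> diag a = diag b.
Proof.
have sub a' b' : (forall i, nsq (e i) <> 0 -> a' i = b' i) ->
    diag a' `<=` diag b'.
  move=> ab [f g] /= [f2 g2 fg]; split => // i; rewrite fg.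
  have [i0|i1] := system_norm es i; first by rewrite !(coef_null es f2 i0) !mulr0.
  by rewrite ab // i1; exact/eqP/oner_neq0.
by move=> ab; apply/seteqP; split; apply: sub => // i /ab.
Qed.

Lemma sqmod_small (z : R[i]) (M : R) :
  (forall r : R, 0 < r -> sqmod z <= M * r) -> z = 0.
Proof.
move=> zM; apply: sqmod_eq0; apply/eqP; rewrite eq_le sqmod_ge0 andbT.
have [M0|M0] := leP M 0.
  by apply: (le_trans (zM 1 ltr01)); rewrite mulr1.
rewrite leNgt; apply/negP => z0.
have := zM (sqmod z / M / 2); rewrite !divr_gt0 // => /(_ isT).
rewrite (_ : M * _ = sqmod z / 2); last by field; rewrite gt_eqF.
by rewrite ler_pdivlMr // ger_pMr // lern1.
Qed.

Lemma diag_eigenvector l i : diag l (e i, fun x => (l i)%:C * e i x).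
Proof.
split => /=; [exact: e2 | exact: L2Z | move=> j].
by rewrite coefZ // !(coef_e es); case: eqVneq => [->//|_]; rewrite !mulr0.
Qed.

Lemma op_id_diag : op_id mu = diag (fun=> 1).
Proof.
apply/seteqP; split => -[f g] /= [f2 g2 fg]; split => //.
  by move=> i; rewrite mul1r; exact: (coef_ae es).
apply: (coef_unique es) => // i; by rewrite fg mul1r.
Qed.

Lemma op_scale_diag (c : R) l : c != 0 ->
  op_scale mu c%:C (diag l) = diag (fun i => c * l i).
Proof.
move=> c0; apply/seteqP; split => -[f g] /=.
  move=> [u /= [f2 u2 fu] [g2 gu]]; split => // i.
  rewrite (coef_ae es _ g2 (L2Z c%:C u2) gu) coefZ // fu rmorphM /= mulrA //.
move=> [f2 g2 fg]; exists (fun x => c^-1%:C * g x) => /=.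
  split => //; first exact: L2Z.
  by move=> i; rewrite coefZ // fg mulrA -rmorphM mulrA mulVf // mul1r.
split => //; apply: aeW => x.
by rewrite mulrA -rmorphM mulfV // rmorph1 mul1r.
Qed.

(** The domain of a sum is the intersection of the domains; the bound says
    that the sum dominates its first summand, hence both. *)
Lemma op_add_diag (M : R) a b : (forall i, a i ^+ 2 <= M * (a i + b i) ^+ 2) ->
  op_add mu (diag a) (diag b) = diag (fun i => a i + b i).
Proof.
move=> aM; apply/seteqP; split => -[f g] /=.
  move=> [u [v [/= [f2 u2 fu] [_ v2 fv] g2 guv]]]; split => // i.
  rewrite (coef_ae es _ g2 (L2D u2 v2) guv) coefD // fu fv.
  by rewrite -mulrDl -rmorphD.
move=> [f2 g2 fg].
have cM i : sqmod (a i / (a i + b i))%:C <= Num.max M 0.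
  rewrite sqmod_real exprMn exprVn.
  have [->|ab] := eqVneq (a i + b i) 0.
    by rewrite expr0n invr0 mulr0 le_max lexx orbT.
  rewrite ler_pdivrMr ?exprn_even_gt0 //.
  apply: le_trans (aM i) _; rewrite ler_wpM2r ?sqr_ge0 //.
  by rewrite le_max lexx.
have [u [u2 ug]] := multiplier es cM g2.
have ai i : a i / (a i + b i) * (a i + b i) = a i.
  have [ab|ab] := eqVneq (a i + b i) 0; last by rewrite divfK.
  have := aM i; rewrite ab expr0n mulr0 => /= a0.
  by apply/esym/eqP; rewrite mulr0 -sqrf_eq0 eq_le a0 sqr_ge0.
have uf i : coef u i = (a i)%:C * coef f i.
  by rewrite ug fg mulrA -rmorphM ai.
exists u, (fun x => g x - u x); split => //=.
- split => //=; first exact: L2B.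
  move=> i; rewrite coefB // fg uf -mulrBl -rmorphB.
  by rewrite addrAC subrr add0r.
- by apply: aeW => x; rewrite addrC subrK.
Qed.

(** Multiplying the coefficients by signs is an involution of the whole space,
    so the composite has the domain of [diag b]. *)
Lemma op_comp_diag a b : (forall i, a i ^+ 2 = 1) ->
  op_comp (diag a) (diag b) = diag (fun i => a i * b i).
Proof.
move=> a1; apply/seteqP; split => -[f g] /=.
  move=> [u /= [f2 u2 fu] [_ g2 ug]]; split => // i.
  by rewrite ug fu mulrA -rmorphM.
move=> [f2 g2 fg].
have [i|u [u2 ug]] := @multiplier _ _ _ mu e es (fun i => (a i)%:C) 1 g _ g2.
  by rewrite sqmod_real a1.
exists u => /=.
  split => // i; rewrite ug fg mulrA -rmorphM mulrA -expr2 a1 mul1r //.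
by split => // i; rewrite ug mulrA -rmorphM -expr2 a1 mul1r.
Qed.

Lemma L2_dominated (M : R) f h : cmeasurable h -> L2 f ->
  (forall x, sqmod (h x) <= M * sqmod (f x)) -> L2 h.
Proof.
move=> mh f2 hM; split => //.
have M0 : 0 <= Num.max M 0 by rewrite le_max lexx orbT.
have mf : measurable_fun setT (fun x => sqmod (f x)).
  by apply: measurable_sqmod; case: f2.
apply: (@le_lt_trans _ _ (\int[mu]_x ((Num.max M 0)%:E * (sqmod (f x))%:E))%E).
  apply: ge0_le_integral => //.
  - by move=> x _; rewrite lee_fin sqmod_ge0.
  - by apply/measurable_EFinP; exact: measurable_sqmod.
  - by under eq_fun do rewrite -EFinM; apply/measurable_EFinP/measurable_funM.
  - move=> x _; rewrite -EFinM lee_fin (le_trans (hM x)) //.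
    by rewrite ler_wpM2r ?sqmod_ge0 // le_max lexx.
rewrite ge0_integralZl_EFin //; last 2 first.
- by move=> x _; rewrite lee_fin sqmod_ge0.
- exact/measurable_EFinP.
by rewrite lte_mul_pinfty // ?lee_fin //; case: f2.
Qed.

(** If [g] has the coefficients [l i * coef f i], then [(f + g) / (1 + m)] has
    those of [f], since [1 / (1 + m)] is bounded and multiplies [e i] by [1 /
    (1 + l i)]. Hence [f + g = (1 + m) f] almost everywhere, that is [g = m
    f]. *)
Lemma op_mult_diag (m : T -> R) l : measurable_fun setT m ->
  (forall x, 0 <= m x) -> (forall i, 0 <= l i) ->
  (forall i x, (m x)%:C * e i x = (l i)%:C * e i x) -> op_mult mu m = diag l.
Proof.
move=> mm m0 l0 me; have mC := cmeasurable_real mm.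
apply/seteqP; split => -[f g] /= [f2 g2 fg]; split => //.
  move=> i; rewrite -[RHS](_ : dot f (fun x => (l i)%:C * e i x) = _); last first.
    by rewrite dotZr // conjc_real.
  apply: cint_ae.
  - by apply: cmeasurableM; [case: g2 | apply: cmeasurableJ; case: (e2 i)].
  - apply: cmeasurableM; first by case: f2.
    by apply: cmeasurableJ; apply: cmeasurableZ; case: (e2 i).
  - apply: filterS fg => x ->; rewrite -me conjcM conjc_real.
    by rewrite mulrA [f x * _]mulrC.
pose r x := (1 + m x)^-1.
have r0 x : 1 + m x != 0 by rewrite gt_eqF // ltr_wpDr.
have mr : measurable_fun setT r.
  have -> : r = (fun x => expR (- ln (1 + m x))).
    by apply/funext => x; rewrite expRN lnK // posrE ltr_wpDr.
  apply: measurableT_comp => //; apply: measurableT_comp => //.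
  apply: measurableT_comp; first exact: measurable_ln.
  exact: measurable_funD.
pose w x := (r x)%:C * (f x + g x).
have mw : cmeasurable w.
  apply: cmeasurableM; first exact: cmeasurable_real.
  by have := L2D f2 g2; case.
have w2 : L2 w.
  apply: (@L2_dominated 1 _ _ mw (L2D f2 g2)) => x; rewrite sqmodM.
  rewrite ler_wpM2r ?sqmod_ge0 // sqmod_real expr_le1 //.
    by rewrite invr_le1 ?unitfE // ?lerDl // ltr_wpDr.
  by rewrite invr_ge0 addr_ge0.
have : ae_eq2 w f.
  apply: (coef_unique es) => // i.
  have re x : (r x)%:C * e i x = (1 + l i)^-1%:C * e i x.
    have l1 : 1 + l i != 0 by rewrite gt_eqF // ltr_wpDr.
    have q : (1 + m x)%:C * e i x = (1 + l i)%:C * e i x.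
      by rewrite !rmorphD /= !mulrDl me.
    have : ((1 + l i)^-1 * r x)%:C * ((1 + m x)%:C * e i x) =
      ((1 + l i)^-1 * r x)%:C * ((1 + l i)%:C * e i x) by rewrite q.
    rewrite !mulrA -!rmorphM -mulrA mulVf // mulr1 mulrAC mulVf // mul1r.
    by move/esym.
  have -> : coef w i = dot (fun x => f x + g x) (fun x => (1 + l i)^-1%:C * e i x).
    rewrite /@coef /Defs.dot.
    congr cintegral; apply/funext => x; rewrite -re conjcM conjc_real /w.
    by rewrite mulrA; congr (_ * _); rewrite mulrC.
  rewrite dotZr //; last exact: L2D.
  rewrite dotDl // -!/(coef _ i) fg -[X in _ * (X + _)]mul1r -mulrDl mulrA conjc_real.
  have -> : 1 + (l i)%:C = (1 + l i)%:C by rewrite rmorphD rmorph1.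
  rewrite -rmorphM mulVf ?mul1r //.
  by rewrite gt_eqF // ltr_wpDr.
apply: filterS => x wx /=.
have : f x + g x = (1 + m x)%:C * f x.
  by rewrite -[in RHS]wx /w mulrA -rmorphM mulfV // mul1r.
by rewrite rmorphD mulrDl mul1r => /addrI.
Qed.

Lemma lin_span0 (S : set cfun) : lin_span S (fun=> 0).
Proof.
exists 0%N, (fun=> 0), (fun=> fun=> 0); split; first by case.
by apply/funext => x; rewrite big_ord0.
Qed.

Lemma lin_spanZ (S : set cfun) (c : R[i]) f :
  lin_span S f -> lin_span S (fun x => c * f x).
Proof.
move=> [n [k [u [Su ->]]]]; exists n, (fun i => c * k i), u; split => //.
by apply/funext => x; rewrite mulr_sumr; under [LHS]eq_bigr do rewrite mulrA.
Qed.

Lemma lin_spanD (S : set cfun) f g :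
  lin_span S f -> lin_span S g -> lin_span S (fun x => f x + g x).
Proof.
move=> [n [k [u [Su ->]]]] [n' [k' [u' [Su' ->]]]].
exists (n + n')%N, (fun i => match fintype.split i with inl j => k j | inr j => k' j end),
  (fun i => match fintype.split i with inl j => u j | inr j => u' j end); split.
  by move=> i; case: (fintype.split i).
apply/funext => x; rewrite big_split_ord /=; congr (_ + _); apply: eq_bigr => i _.
  by case: splitP => j /= ij; [congr (k _ * u _ x); exact: val_inj | have := ltn_ord i; lia].
case: splitP => j /= ij; [have := ltn_ord j; lia | ].
by move/addnI/val_inj : ij => ->.
Qed.

Lemma lin_span_sum (S : set cfun) I (s : seq I) (F : I -> cfun) :
  (forall i, lin_span S (F i)) -> lin_span S (fun x => \sum_(i <- s) F i x).
Proof.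
move=> SF; elim: s => [|i s IH].
  by under eq_fun do rewrite big_nil; exact: lin_span0.
by under eq_fun do rewrite big_cons; exact: lin_spanD.
Qed.

Lemma lin_span_sub (S : set cfun) f : S f -> lin_span S f.
Proof.
move=> Sf; exists 1%N, (fun=> 1), (fun=> f); split => //.
by apply/funext => x; rewrite big_ord_recl big_ord0 mul1r addr0.
Qed.

Lemma lin_span_L2 (S : set cfun) f : S `<=` L2 -> lin_span S f -> L2 f.
Proof.
move=> SL [n [k [u [Su ->]]]].
by apply: (@L2_sum _ _ _ _ _ _ (fun i x => k i * u i x)) => i; apply/L2Z/SL.
Qed.

Section projections.
Variables (S : set cfun) (p : nat -> bool).
Hypothesis SL : S `<=` L2.
Hypothesis Sp : forall s i, S s -> ~~ p i -> coef s i = 0.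
Hypothesis pS : forall i, p i -> lin_span S (e i).

(** The space [S] spans the [e i] with [p i] and is orthogonal to the others,
    so membership can be read off the coefficients. *)
Lemma closed_spanP g :
  closed_span mu S g <-> L2 g /\ forall i, ~~ p i -> coef g i = 0.
Proof.
split=> -[g2 gS]; split => //.
  move=> i pi; apply: (@sqmod_small _ 1) => r r0.
  have [u Su] := gS r r0; have u2 := lin_span_L2 SL Su.
  rewrite sqdistE // lte_fin mul1r => gu.
  have ui : coef u i = 0.
    case: Su => [n [k [w [Sw ->]]]].
    rewrite /@coef (@dot_suml _ _ _ _ _ _ (fun i x => k i * w i x)) //.
      rewrite big1 // => j _; rewrite dotZl //; last exact: SL.
      by rewrite -/(coef _ _) Sp ?mulr0.
    by move=> j; apply/L2Z/SL.
  rewrite -(subr0 (coef g i)) -ui -coefB // /@coef.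
  apply: le_trans (cauchy_schwarz (L2B g2 u2) (e2 i)) _.
  by case: (system_norm es i) => ->; rewrite ?mulr0 ?mulr1 ltW.
move=> r r0; have /cvgrPdist_lt/(_ _ r0) [n _ /(_ n (leqnn n))] := fourier es g2.
rewrite sub0r normrN => /(le_lt_trans (ler_norm _)) gn.
have Sn : lin_span S (psum (coef g) n).
  apply: (@lin_span_sum S _ _ (fun (i : 'I_n) x => coef g i * e i x)) => i.
  have [/pS|/gS ->] := boolP (p i); first exact: lin_spanZ.
  by under eq_fun do rewrite mul0r; exact: lin_span0.
exists (psum (coef g) n) => //; rewrite sqdistE //; last exact: psum_L2.
rewrite lte_fin (_ : nsq _ = nsq (fun x => -1 * (psum (coef g) n x - g x))).
  by rewrite nsqZ ?sqmodN ?(sqmod_real 1) ?expr1n ?mul1r //; apply: L2B => //; exact: psum_L2.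
by congr nsq; apply/funext => x; rewrite mulN1r opprB.
Qed.

Lemma ortho_proj_diag :
  ortho_proj mu (closed_span mu S) = diag (fun i => (p i)%:R).
Proof.
apply/seteqP; split => -[f g] /=.
  move=> [f2 /closed_spanP[g2 gS] fg]; split => // i.
  have [pi|pi] := boolP (p i); last by rewrite gS // mul0r.
  rewrite mul1r; apply/eqP; rewrite eq_sym -subr_eq0 -coefB //; apply/eqP.
  apply: fg; apply/closed_spanP; split => // j pj.
  by rewrite coef_e //; case: eqVneq => // ij; rewrite -ij pi in pj.
move=> [f2 g2 fg]; split => //.
  by apply/closed_spanP; split => // i /negPf pi; rewrite fg pi mul0r.
move=> v /closed_spanP[v2 vS]; rewrite -(dot0l mu v).
apply: (dot_coef_eq es) => //; [exact: L2B | exact: L2_0 | move=> i].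
rewrite coefB // fg.
have [pi|/vS ->] := boolP (p i); first by rewrite mul1r subrr /@coef dot0l !mul0r.
by rewrite conjc_0 !mulr0.
Qed.

End projections.

(** A diagonal operator is closed, which gives one inclusion. For the other
    one, the Fourier partial sums of a vector of the domain and of its image
    form elements of [A] that converge to the given pair. *)
Lemma op_closure_diag (A : operator) l : A `<=` diag l ->
  (forall c n, A (psum c n, psum (fun i => (l i)%:C * c i) n)) ->
  op_closure mu A = diag l.
Proof.
move=> Al lA; apply/seteqP; split => -[f g] /=.
  move=> [f2 g2 fg]; split => // i; apply/eqP; rewrite -subr_eq0; apply/eqP.
  apply: (@sqmod_small _ (2 + 2 * l i ^+ 2)) => r r0.
  have [[u v] /= /Al/= [u2 v2 uv]] := fg r r0.
  rewrite !sqdistE // !lte_fin => -[fu gv].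
  have -> : coef g i - (l i)%:C * coef f i =
    coef (fun x => g x - v x) i - (l i)%:C * coef (fun x => f x - u x) i.
    by rewrite !coefB // uv mulrBr opprB addrA subrK.
  apply: le_trans (sqmodB_le _ _) _; rewrite sqmodM sqmod_real.
  have bnd h : L2 h -> nsq h < r -> sqmod (coef h i) <= r.
    move=> h2 hr; apply: le_trans (cauchy_schwarz h2 (e2 i)) _.
    by case: (system_norm es i) => ->; rewrite ?mulr0 ?mulr1 ltW.
  rewrite [leRHS]mulrDl; apply: lerD; first by rewrite ler_wpM2l ?bnd //; exact: L2B.
  rewrite -[leRHS]mulrA; apply: ler_wpM2l => //; apply: ler_wpM2l; first exact: sqr_ge0.
  by apply: bnd => //; exact: L2B.
move=> [f2 g2 fg]; split => // r r0.
have /cvgrPdist_lt/(_ _ r0) [n _ Hn] := fourier es f2.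
have /cvgrPdist_lt/(_ _ r0) [k _ Hk] := fourier es g2.
pose N := maxn n k.
exists (psum (coef f) N, psum (coef g) N).
  rewrite (_ : psum (coef g) N = psum (fun i => (l i)%:C * coef f i) N) //.
  by congr @psum; apply/funext.
have sym (u v : cfun) : L2 u -> L2 v ->
    nsq (fun x => v x - u x) = nsq (fun x => u x - v x).
  move=> u2 v2; rewrite -[LHS]mul1r -(expr1n R 2) -sqmod_real -sqmodN -nsqZ; last exact: L2B.
  by congr nsq; apply/funext => x; rewrite mulN1r opprB.
have p2 := psum_L2 es; split; rewrite /= sqdistE // lte_fin sym //.
  have := Hn N (leq_maxl _ _); rewrite /= sub0r normrN.
  exact: le_lt_trans (ler_norm _).
have := Hk N (leq_maxr _ _); rewrite /= sub0r normrN.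
exact: le_lt_trans (ler_norm _).
Qed.

(** The value of the integral operator at a point is an inner product with a
    section of the kernel, so Parseval's formula expands it pointwise. By
    Fatou's lemma, the pointwise limit of the expansion is also its limit in
    the mean, which has the required coefficients. *)
Lemma int_op_diag (K : T -> T -> R) l (M : R) :
  (forall x, L2 (fun y => (K x y)%:C)) ->
  (forall x i, cintegral mu setT (fun y => (K x y)%:C * e i y) =
               (l i)%:C * e i x) ->
  (forall i, l i ^+ 2 <= M) -> int_op mu K = diag l.
Proof.
move=> K2 Ke lM.
pose Kf f x := cintegral mu setT (fun y => (K x y)%:C * f y).
have KfE f x : Kf f x = dot f (fun y => (K x y)%:C).
  by rewrite /Kf /Defs.dot; congr cintegral; apply/funext => y; rewrite conjc_real mulrC.
have Kint f x : L2 f -> cintegrable mu setT (fun y => (K x y)%:C * f y).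
  move=> f2; have := L2_cintble f2 (K2 x).
  by under eq_fun do rewrite conjc_real mulrC.
have main f : L2 f -> exists u, [/\ L2 u, ae_eq2 u (Kf f) &
    forall i, coef u i = (l i)%:C * coef f i].
  move=> f2; have [i|u [u2 uf]] := multiplier es (M := M) (c := fun i => (l i)%:C) _ f2.
    by rewrite sqmod_real.
  have p2 := psum_L2 es (coef u).
  have pt : ptcvg (psum (coef u)) (Kf f).
    have ck x i : coef f i * conjc (coef (fun y => (K x y)%:C) i) = coef u i * e i x.
      rewrite /@coef -dotC // -KfE /Kf Ke -!/(coef _ _) uf.
      by rewrite mulrA; congr (_ * _); rewrite mulrC.
    move=> x; split.
      rewrite KfE; apply: cvg_trans (parseval es f2 (K2 x)).
      apply: near_eq_cvg; apply: nearW => n; rewrite /@psum.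
      elim: n => [|n IH]; first by rewrite !big_ord0.
      by rewrite !big_ord_recr Re_add -IH ck.
    rewrite KfE; apply: cvg_trans (parseval_im es f2 (K2 x)).
    apply: near_eq_cvg; apply: nearW => n; rewrite /@psum.
    elim: n => [|n IH]; first by rewrite !big_ord0.
    by rewrite !big_ord_recr Im_add -IH ck.
  exists u; split => //.
  have mK : cmeasurable (Kf f).
    by apply: (ptcvg_measurable _ pt) => n; case: (p2 n).
  have small (r : R) : 0 < r -> (\int[mu]_x (sqmod (u x - Kf f x))%:E <= r%:E)%E.
    move=> r0; have /cvgrPdist_lt/(_ _ r0) [N _ HN] := fourier es u2.
    apply: (fatou_sqmod u2 p2 pt (K := N)) => n Nn.
    have := HN n Nn; rewrite /= sub0r normrN => /(le_lt_trans (ler_norm _)) /ltW.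
    rewrite (_ : nsq _ = nsq (fun x => -1 * (u x - psum (coef u) n x))).
      by rewrite nsqZ ?sqmodN ?(sqmod_real 1) ?expr1n ?mul1r //; exact: L2B.
    by congr nsq; apply/funext => x; rewrite mulN1r opprB.
  have d2 : L2 (fun x => u x - Kf f x).
    split; first by apply: cmeasurableB => //; case: u2.
    exact: le_lt_trans (small 1 ltr01) (ltry _).
  apply/ae_eq2B0/nsq_eq0 => //; apply/eqP; rewrite eq_le nsq_ge0 andbT.
  rewrite leNgt; apply/negP => n0.
  have := small (nsq (fun x => u x - Kf f x) / 2); rewrite divr_gt0 // => /(_ isT).
  rewrite nsqE // lee_fin ler_pdivlMr // ger_pMr //.
  by rewrite lern1.
apply/seteqP; split => -[f g] /=.
  move=> [f2 g2 fg]; split => // i; have [u [u2 uK uf]] := main f f2.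
  rewrite -uf; apply: (coef_ae es) => //.
  by apply: filterS2 fg uK => x [_ ->] ->.
move=> [f2 g2 fg]; split => //; have [u [u2 uK uf]] := main f f2.
have gu : ae_eq2 g u by apply: (coef_unique es) => // i; rewrite fg uf.
by apply: filterS2 gu uK => x gx ux; split; [exact: Kint | rewrite /= gx ux].
Qed.

End diagonal_operators.
(** * Functional calculus of a diagonal operator *)

Section functional_calculus.
Context d (T : measurableType d) (R : realType).
Variable mu : {measure set T -> \bar R}.
Local Notation cfun := (cfun T R).
Local Notation operator := (operator T R).
Implicit Types (f g h u v F G H : cfun) (l phi psi : R -> R).
Local Notation L2 := (L2 mu).
Local Notation ae_eq2 := (ae_eq2 mu).
Local Notation dot := (dot mu).
Local Notation nsq := (nsq mu).
Variable e : nat -> cfun.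
Hypothesis es : total_system mu e.
Let e2 := system_L2 es.
Local Notation coef := (coef mu e).
Local Notation diag := (diag mu e).
Variable l : nat -> R.

Lemma Rintegral_mscale d' (S : measurableType d') (m : {measure set S -> \bar R})
    (k : {nonneg R}) (D : set S) (f : S -> R) : measurable D ->
  m.-integrable D (EFin \o f) ->
  Rintegral (mscale k m) D f = k%:num * Rintegral m D f.
Proof.
move=> mD fi; have mf := measurable_int _ fi.
have [fp fn] : (\int[m]_(x in D) ((EFin \o f)^\+ x) \is a fin_num)%E /\
    (\int[m]_(x in D) ((EFin \o f)^\- x) \is a fin_num)%E.
  by split; [exact: integrable_pos_fin_num | exact: integrable_neg_fin_num].
rewrite /Rintegral integralE [in RHS]integralE.
rewrite !ge0_integral_mscale //; last 2 first.
- exact: measurable_funeneg.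
- exact: measurable_funepos.
by rewrite fineB ?fin_numM // fineB // !fineM // mulrBr.
Qed.

(** The spectral measure of a vector is the sum of the point masses that its
    coefficients put at the eigenvalues. *)
Definition point_measure f : {measure set R -> \bar R} :=
  mseries (fun i => mscale (NngNum (sqmod_ge0 (coef f i))) (dirac (l i))) 0.

Lemma point_measure_integral f psi : measurable_fun setT psi ->
  (forall x, 0 <= psi x) ->
  (\int[point_measure f]_x (psi x)%:E =
   \sum_(0 <= i <oo) (psi (l i) * sqmod (coef f i))%:E)%E.
Proof.
move=> mpsi psi0; rewrite ge0_integral_measure_series //; last 2 first.
- by move=> x _; rewrite lee_fin.
- exact/measurable_EFinP.
apply: eq_eseriesr => i _; rewrite ge0_integral_mscale //; last 2 first.
- exact/measurable_EFinP.
- by move=> x _; rewrite lee_fin.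
rewrite integral_dirac //; last exact/measurable_EFinP.
by rewrite diracT mul1e -EFinM mulrC.
Qed.

Lemma nneseries_EFin_cvg (a : nat -> R) (s : R) :
  (fun n => \sum_(i < n) a i) @ \oo --> s -> (\sum_(0 <= i <oo) (a i)%:E = s%:E)%E.
Proof.
move=> as_; apply: cvg_lim => //.
rewrite (_ : (fun n => _) = EFin \o (fun n => \sum_(i < n) a i)).
  by apply: cvg_EFin; [exact: nearW | exact: as_].
by apply/funext => n /=; rewrite sumEFin big_mkord.
Qed.

(** The masses that a spectral resolution of [diag l] assigns to Borel sets;
    [pvm_spectral_mass] shows that no others are possible. *)
Definition spectral_mass (m : cfun -> {measure set R -> \bar R}) :=
  forall f U, L2 f -> measurable U -> m f U = point_measure f U.

Section masses.
Variable m : cfun -> {measure set R -> \bar R}.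
Hypothesis mE : spectral_mass m.

Lemma spectral_integral f psi : L2 f -> measurable_fun setT psi ->
  (forall x, 0 <= psi x) -> (\int[m f]_x (psi x)%:E =
   \sum_(0 <= i <oo) (psi (l i) * sqmod (coef f i))%:E)%E.
Proof.
move=> f2 mpsi psi0; rewrite -point_measure_integral //.
by apply: eq_measure_integral => U mU _; exact: mE.
Qed.

(** Both sides are the sum of the squared moduli of the coefficients, weighted
    by [psi (l i)]. *)
Lemma spectral_integral_ge0 f G psi : measurable_fun setT psi ->
  (forall x, 0 <= psi x) -> diag (psi \o l) (f, G) ->
  (\int[m f]_x (psi x)%:E = (complex.Re (dot G f))%:E)%E.
Proof.
move=> mpsi psi0 [/= f2 G2 Gf]; rewrite spectral_integral //.
apply: nneseries_EFin_cvg; apply: cvg_trans (parseval es G2 f2).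
apply: near_eq_cvg; apply: nearW => n; apply: eq_bigr => i _.
by rewrite Gf -mulrA mulcJ -rmorphM.
Qed.

(** The projection onto the eigenvectors with [0 < phi (l i)] splits [G] into
    the parts that correspond to the positive and the negative part of [phi].
    *)
Lemma spectral_Rintegral f G phi : measurable_fun setT phi ->
  diag (phi \o l) (f, G) -> Rintegral (m f) setT phi = complex.Re (dot G f).
Proof.
move=> mphi [/= f2 G2 Gf].
have [i|P [P2 PG]] := multiplier es (M := 1)
    (c := fun i => (0 < phi (l i))%R%:R%:C) _ G2.
  by rewrite sqmod_real; case: (0 < _); rewrite ?expr1n ?expr0n.
have N2 := L2B P2 G2.
rewrite /Rintegral integralE.
have -> : (EFin \o phi)^\+%E = (EFin \o (fun x => Num.max (phi x) 0)).
  by apply/funext => x; rewrite /= funeposE /= EFin_max.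
have -> : (EFin \o phi)^\-%E = (EFin \o (fun x => Num.max (- phi x) 0)).
  by apply/funext => x; rewrite /= funenegE /= EFin_max.
rewrite (@spectral_integral_ge0 f P (fun x => Num.max (phi x) 0)); first last.
- split => //= i; rewrite PG Gf mulrA -rmorphM /=.
  by case: ltP => p0; rewrite ?mul1r ?mul0r // max_r.
- by move=> x; rewrite le_max lexx orbT.
- exact: measurable_maxr.
rewrite (@spectral_integral_ge0 f (fun x => P x - G x) (fun x => Num.max (- phi x) 0)); first last.
- split => //= i; rewrite coefB // PG Gf mulrA -rmorphM -mulrBl -rmorphB /=.
  case: ltP => p0; first by rewrite mul1r subrr max_r // oppr_le0 ltW.
  by rewrite mul0r sub0r max_l // oppr_ge0.
- by move=> x; rewrite le_max lexx orbT.
- by apply: measurable_maxr => //; exact: measurableT_comp.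
by rewrite dotBl // Re_add Re_opp /= opprB addrC subrK.
Qed.

(** Finiteness of the integral of [phi ^ 2] is the square-summability of the
    coefficients that the image must have. *)
Lemma spectral_domP f phi : measurable_fun setT phi ->
  spectral_dom mu m phi f <-> exists G, diag (phi \o l) (f, G).
Proof.
move=> mphi; split=> [[f2 ff]|[G [/= f2 G2 Gf]]].
  have mphi2 : measurable_fun setT (fun x => phi x ^+ 2) by exact: measurable_funX.
  have := ff; rewrite spectral_integral //; last by move=> x; exact: sqr_ge0.
  set s := (\sum_(0 <= i <oo) _)%E => sy.
  have s_fin : s \is a fin_num.
    rewrite ge0_fin_numE // nneseries_ge0 // => i _ _.
    by rewrite lee_fin mulr_ge0 ?sqr_ge0 ?sqmod_ge0.
  have [n|G [G2 _ Gf]] := @synthesis _ _ _ mu e es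
      (fun i => (phi (l i))%:C * coef f i) (fine s).
    rewrite (eq_bigr (fun i : 'I_n => phi (l i) ^+ 2 * sqmod (coef f i))).
      apply: (@nneseries_partial_le _ (fun i => phi (l i) ^+ 2 * sqmod (coef f i))).
        by move=> i; rewrite mulr_ge0 ?sqr_ge0 ?sqmod_ge0.
      by rewrite fineK.
    by move=> i _; rewrite sqmodM sqmod_real -mulrA sqmod_coefK.
  by exists G; split => //= i; rewrite Gf -mulrA coefK.
split => //.
rewrite (@spectral_integral f (fun x => phi x ^+ 2)) //.
- apply: (@le_lt_trans _ _ (nsq G)%:E); last exact: ltry.
  apply: lime_le.
    by apply: is_cvg_nneseries => i _ _; rewrite lee_fin mulr_ge0 ?sqr_ge0 ?sqmod_ge0.
  apply: nearW => n; rewrite sumEFin lee_fin big_mkord.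
  rewrite (eq_bigr (fun i : 'I_n => sqmod (coef G i))); first exact: (bessel es).
  by move=> i _; rewrite Gf sqmodM sqmod_real.
- exact: measurable_funX.
- by move=> x; exact: sqr_ge0.
Qed.

Lemma imagCM : 'i * 'i = -1 :> R[i].
Proof. by rewrite -expr2 sqrCi. Qed.

(** The chosen square root of [-1] is one of the two that are purely
    imaginary. *)
Lemma conj_imagC : conjc ('i : R[i]) = - 'i.
Proof.
have [j jj jc] : exists2 j : R[i], j * j = -1 & conjc j = - j.
  exists (0 +i* 1); first by apply: complex_eqP; rewrite !ReImE /=; ring.
  by apply: complex_eqP; rewrite /= ?oppr0.
have : ('i - j) * ('i + j) = 0.
  rewrite (_ : _ * _ = 'i * 'i - j * j); last by ring.
  by rewrite imagCM jj subrr.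
move/eqP; rewrite mulf_eq0 subr_eq0 addr_eq0 => /orP[] /eqP -> //.
by rewrite conjcN jc.
Qed.

Lemma Re_imagC : complex.Re ('i : R[i]) = 0.
Proof.
have : complex.Re (conjc ('i : R[i])) = complex.Re (- 'i : R[i]) by rewrite conj_imagC.
by rewrite Re_conj Re_opp => /eqP; rewrite -subr_eq0 opprK -mulr2n mulrn_eq0 /= => /eqP.
Qed.

Lemma sqmod_imagC : sqmod ('i : R[i]) = 1.
Proof.
by apply: complexI; rewrite -mulcJ conj_imagC mulrN imagCM opprK.
Qed.

(** Polarisation: in the sum of the four expanded quadratic forms, only the
    multiples of [dot F h] do not cancel. *)
Lemma spectral_formE f h F H phi : measurable_fun setT phi ->
  diag (phi \o l) (f, F) -> diag (phi \o l) (h, H) ->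
  spectral_form m phi f h = dot F h.
Proof.
move=> mphi /[dup] fF [/= f2 F2 Ff] /[dup] hH [/= h2 H2 Hh].
have key (c : R[i]) : (Rintegral (m (fun x => f x + c * h x)) setT phi)%:C =
    dot F f + conjc c * dot F h + c * dot H f + (sqmod c)%:C * dot H h.
  rewrite (@spectral_Rintegral _ (fun x => F x + c * H x)) //; last first.
    split => /=; [by apply: L2D => //; exact: L2Z|by apply: L2D => //; exact: L2Z|].
    move=> i; rewrite !coefD ?coefZ //; try exact: L2Z.
    by rewrite Ff Hh mulrDr mulrCA.
  have real_part (u v : cfun) : diag (phi \o l) (u, v) -> complex.Im (dot v u) = 0.
    move=> [/= u2 v2 vu]; apply/esym.
    apply: (cvg_eq _ (parseval_im es v2 u2) (a := fun=> 0)); first exact: cvg_cst.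
    move=> n; rewrite big1 // => i _.
    by rewrite vu -mulrA mulcJ -rmorphM.
  have -> : (complex.Re (dot (fun x => F x + c * H x) (fun x => f x + c * h x)))%:C =
      dot (fun x => F x + c * H x) (fun x => f x + c * h x).
    apply: complex_eqP => //; apply/esym/real_part.
    split => /=; [by apply: L2D => //; exact: L2Z|by apply: L2D => //; exact: L2Z|].
    move=> i; rewrite !coefD ?coefZ //; try exact: L2Z.
    by rewrite Ff Hh mulrDr mulrCA.
  have c2 u : L2 u -> L2 (fun x => c * u x) by exact: L2Z.
  rewrite dotDl ?dotDr ?dotZl ?dotZr //; try exact: c2;
    try (by apply: L2D => //; exact: c2).
  by rewrite -mulcJ; ring.
rewrite /spectral_form !big_ord_recl big_ord0 /= /bump /= !key.
rewrite !(expr0, expr1) (exprS _ 2) sqrCi mulrN1 !conjcN conj_imagC !sqmodN.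
rewrite sqmod_imagC (_ : sqmod 1 = 1) ?(sqmod_real 1) ?expr1n //.
rewrite (_ : conjc 1 = 1) ?(conjc_real 1) // rmorph1.
set a := dot F f; set b := dot F h; set c := dot H f; set k := dot H h.
transitivity (4^-1 * (2 * b + 2 * c - 2 * ('i * 'i) * b + 2 * ('i * 'i) * c)).
  by ring.
by rewrite imagCM; field.
Qed.

(** The coefficients of the image are determined by testing it against the
    eigenvectors. *)
Lemma spectral_int_diag phi : measurable_fun setT phi ->
  spectral_int mu m phi = diag (phi \o l).
Proof.
move=> mphi; apply/seteqP; split => -[f g] /=.
  move=> [/(spectral_domP _ mphi)[F fF] g2 gE]; split => //=.
    by case: fF.
  have [/= f2 F2 Ff] := fF.
  move=> i; rewrite -Ff.
  have eE := diag_eigenvector es (phi \o l) i.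
  rewrite [LHS]gE; first exact: (spectral_formE _ fF eE).
  by apply/spectral_domP => //; exists (fun x => (phi (l i))%:C * e i x).
move=> fg; have [/= f2 g2 _] := fg; split => //.
  by apply/spectral_domP => //; exists g.
by move=> h /(spectral_domP _ mphi)[H hH]; apply/esym; exact: (spectral_formE _ fg hH).
Qed.

End masses.

Lemma point_measureE f U : measurable U -> point_measure f U =
  (\sum_(0 <= i <oo) (\1_U (l i) * sqmod (coef f i))%:E)%E.
Proof.
move=> mU; rewrite /point_measure /= /mseries; apply: eq_eseriesr => i _.
by rewrite /mscale /= /dirac EFinM muleC.
Qed.

Lemma point_measure_dot f F U : measurable U -> L2 f -> L2 F ->
  (forall i, coef F i = (\1_U (l i))%:C * coef f i) ->
  point_measure f U = (complex.Re (dot F f))%:E.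
Proof.
move=> mU f2 F2 Ff; rewrite point_measureE //.
apply: nneseries_EFin_cvg; apply: cvg_trans (parseval es F2 f2).
apply: near_eq_cvg; apply: nearW => n; apply: eq_bigr => i _.
by rewrite Ff -mulrA mulcJ -rmorphM.
Qed.

(** The projection of a set keeps the coefficients at the eigenvalues in that
    set; a representative of the resulting class is chosen for every function.
    *)
Lemma diag_resolution : exists E, is_pvm mu E point_measure.
Proof.
have ex f (U : set R) : exists F, L2 f -> L2 F /\ forall i, coef F i = (\1_U (l i))%:C * coef f i.
  have [f2|nf2] := pselect (L2 f); last by exists f.
  have [i|F FE] := multiplier es (M := 1) (c := fun i => (\1_U (l i))%:C) _ f2.
    by rewrite sqmod_real indicE; case: (_ \in _); rewrite ?expr1n ?expr0n.
  by exists F.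
pose E U f := xget f [set F | L2 f -> L2 F /\ forall i, coef F i = (\1_U (l i))%:C * coef f i].
have EP U f : L2 f -> L2 (E U f) /\ forall i, coef (E U f) i = (\1_U (l i))%:C * coef f i.
  exact: (xgetPex f (ex f U)).
clearbody E; exists E => f f2; split.
- apply: (coef_unique es) => //; first by have [] := EP setT f f2.
  by move=> i; have [_ ->] := EP setT f f2; rewrite indicT mul1r.
- by move=> U _; have [] := EP U f f2.
- move=> U g _ g2; have [EUf2 EUf] := EP U f f2; have [EUg2 EUg] := EP U g g2.
  apply: (dot_coef_eq es) => // i; rewrite EUf EUg conjcM conjc_real.
  by rewrite mulrA [coef f i * _]mulrC.
- move=> U V _ _; have [EVf2 EVf] := EP V f f2.
  have [EUV2 EUV] := EP U _ EVf2; have [EI2 EI] := EP (U `&` V) f f2.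
  apply: (coef_unique es) => // i.
  by rewrite EUV EVf EI indicI mulrA -rmorphM.
- move=> U mU; have [EU2 EU] := EP U f f2.
  exact: point_measure_dot.
Qed.

Lemma spectral_mass_point : spectral_mass point_measure.
Proof. by []. Qed.

Section uniqueness.
Variables (E : set R -> cfun -> cfun) (m : cfun -> {measure set R -> \bar R}).
Hypothesis EP : is_pvm mu E m.
Hypothesis Em : diag l = spectral_int mu m idfun.

Lemma pvm_L2 U f : measurable U -> L2 f -> L2 (E U f).
Proof. by move=> mU /EP[_ + _ _ _]; apply. Qed.

Lemma pvm_sym U f g : measurable U -> L2 f -> L2 g ->
  dot (E U f) g = dot f (E U g).
Proof. by move=> mU /EP[_ _ + _ _]; apply. Qed.

Lemma pvm_dotI U V f g : measurable U -> measurable V -> L2 f -> L2 g ->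
  dot (E U f) (E V g) = dot f (E (U `&` V) g).
Proof.
move=> mU mV f2 g2; rewrite pvm_sym //; last exact: pvm_L2.
apply: dot_ae => //.
- by do 2!apply: pvm_L2 => //.
- by apply: pvm_L2 => //; exact: measurableI.
- exact: ae_eq2_refl.
- by have [_ _ _ + _] := EP g2; apply.
Qed.

Lemma pvm_mass U f : measurable U -> L2 f ->
  dot f (E U f) = (fine (m f U))%:C /\ m f U = (fine (m f U))%:E.
Proof.
move=> mU f2; have [_ _ _ _ /(_ U mU) mf] := EP f2; split; last by rewrite mf.
have r : dot f (E U f) = conjc (dot f (E U f)).
  by rewrite -{1}pvm_sym // -dotC //; exact: pvm_L2.
apply: complex_eqP; first by rewrite mf -pvm_sym.
suff : complex.Im (dot f (E U f)) = 0 by [].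
have : complex.Im (dot f (E U f)) = - complex.Im (dot f (E U f)).
  by rewrite {1}r Im_conj.
by move/eqP; rewrite -subr_eq0 opprK -mulr2n mulrn_eq0 => /eqP.
Qed.

Lemma pvm_massT f : L2 f -> m f setT = (nsq f)%:E.
Proof.
move=> f2; have [ET _ _ _ /(_ setT measurableT) ->] := EP f2.
by rewrite (dot_ae (pvm_L2 measurableT f2) f2 f2 f2 ET (ae_eq2_refl _ _)).
Qed.

Lemma fine_mass_inj U V f g : measurable U -> measurable V -> L2 f -> L2 g ->
  dot f (E U f) = dot g (E V g) -> m f U = m g V.
Proof.
move=> mU mV f2 g2 E0; have [a af] := pvm_mass mU f2.
have [b bg] := pvm_mass mV g2; rewrite af bg; congr EFin; apply: complexI.
by rewrite -a -b.
Qed.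

Lemma pvm_massI U W f : measurable U -> measurable W -> L2 f ->
  m (E U f) W = m f (W `&` U).
Proof.
move=> mU mW f2; have U2 := pvm_L2 mU f2.
apply: fine_mass_inj => //; first exact: measurableI.
rewrite -pvm_sym // pvm_dotI // pvm_dotI //; last exact: measurableI.
by rewrite setICA setIid.
Qed.

(** Spectrally, [f + c E(U) f] is [(1 + c) f] on [U] and [f] on the
    complement. *)
Lemma pvm_mass_add U W f (c : R[i]) : measurable U -> measurable W -> L2 f ->
  m (fun x => f x + c * E U f x) W =
  (fine (m f W) + (sqmod (1 + c) - 1) * fine (m f (W `&` U)))%:E.
Proof.
move=> mU mW f2; have h2 := pvm_L2 mU f2.
have F2 : L2 (fun x => f x + c * E U f x) by apply: L2D => //; exact: L2Z.
rewrite (pvm_mass mW F2).2; congr EFin; apply: complexI.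
rewrite -(pvm_mass mW F2).1 -pvm_sym // dotDr ?dotZr //; try exact: pvm_L2; last exact: L2Z.
rewrite !pvm_sym // !dotDl ?dotZl //; try exact: pvm_L2; try exact: L2Z.
have mI := measurableI _ _ mW mU.
have -> : dot (E U f) (E W (E U f)) = dot f (E (W `&` U) f).
  by rewrite -pvm_sym // pvm_dotI // pvm_dotI // setICA setIid.
rewrite pvm_dotI // -(pvm_sym mW f2 h2) pvm_dotI // [U `&` W]setIC.
rewrite (pvm_mass mW f2).1 (pvm_mass mI f2).1.
apply: complex_eqP; rewrite /sqmod !ReImE /=; ring.
Qed.

(** For a finite measure, square-integrable functions are integrable. *)
Lemma pvm_integrable f : spectral_dom mu m idfun f ->
  (m f).-integrable setT (EFin \o idfun).
Proof.
move=> [f2 fx]; have mx : measurable_fun setT (fun x : R => (x ^+ 2)%:E).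
  by apply/measurable_EFinP; exact: measurable_funX.
apply: (@le_integrable _ _ _ (m f) setT measurableT _ (fun x => (1 + x ^+ 2)%:E)).
- by apply/measurable_EFinP; exact: measurable_id.
- move=> x _; rewrite /= lee_fin [leRHS]ger0_norm ?addr_ge0 ?sqr_ge0 //.
  rewrite -(real_normK (num_real x)) -subr_ge0.
  rewrite (_ : _ - _ = (`|x| - 2^-1) ^+ 2 + 3 / 4); last by field.
  by rewrite addr_ge0 ?sqr_ge0 // divr_ge0.
- apply/integrableP; split.
    by under eq_fun do rewrite EFinD; exact: emeasurable_funD.
  under eq_integral do rewrite /= ger0_norm ?addr_ge0 ?sqr_ge0 // EFinD.
  rewrite ge0_integralD //; last by move=> x _; rewrite lee_fin sqr_ge0.
  rewrite integral_cst // mul1e pvm_massT // lte_add_pinfty // ltry //.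
Qed.

Lemma pvm_dom U f : measurable U -> spectral_dom mu m idfun f ->
  spectral_dom mu m idfun (E U f).
Proof.
move=> mU [f2 fx]; split; first exact: pvm_L2.
have mx : measurable_fun setT (fun x : R => (x ^+ 2)%:E).
  by apply/measurable_EFinP; exact: measurable_funX.
have mC := measurableC mU.
rewrite -(setvU U) ge0_integral_setU //; last 3 first.
- by rewrite setvU.
- by move=> x _; rewrite lee_fin sqr_ge0.
- by rewrite disj_set2E setICl.
rewrite (eq_measure_integral mzero); last first.
  by move=> A mA AU; rewrite pvm_massI // (_ : A `&` U = set0) ?measure0 //; apply/disjoints_subset.
rewrite integral_measure_zero add0e.
rewrite (eq_measure_integral (m f)); last first.
  by move=> A mA AU; rewrite pvm_massI // (setIidl AU).
apply: le_lt_trans fx; apply: ge0_subset_integral => //.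
by move=> x _; rewrite lee_fin sqr_ge0.
Qed.

Lemma pvm_Rintegral_add U f (c : R[i]) : measurable U ->
  spectral_dom mu m idfun f ->
  Rintegral (m (fun x => f x + c * E U f x)) setT idfun =
  Rintegral (m f) (~` U) idfun + sqmod (1 + c) * Rintegral (m f) U idfun.
Proof.
move=> mU /[dup] df [f2 _]; have mC := measurableC mU.
have fi := pvm_integrable df.
have fiU : (m f).-integrable U (EFin \o idfun) by exact: integrableS fi.
have fiC : (m f).-integrable (~` U) (EFin \o idfun) by exact: integrableS fi.
have sc := Rintegral_mscale (NngNum (sqmod_ge0 (1 + c))) mU fiU.
rewrite /= in sc; rewrite -sc /Rintegral.
rewrite -(setvU U) integral_setU //; last 2 first.
- by apply/measurable_EFinP; exact: measurable_id.
- by rewrite disj_set2E setICl.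
rewrite (eq_measure_integral (m f)); last first.
  move=> A mA AU; rewrite pvm_mass_add // (_ : A `&` U = set0); last exact/disjoints_subset.
  by rewrite measure0 mulr0 addr0 -(pvm_mass mA f2).2.
rewrite [X in (_ + X)%E](eq_measure_integral
    (mscale (NngNum (sqmod_ge0 (1 + c))) (m f))); last first.
  move=> A mA AU; rewrite pvm_mass_add // (setIidl AU) /= /mscale /=.
  rewrite [in RHS](pvm_mass mA f2).2 -EFinM; congr EFin; ring.
rewrite fineD //; first exact: integrable_fin_num.
apply: integrable_fin_num => //; apply/integrableP; split.
  by apply/measurable_EFinP; exact: measurable_id.
rewrite ge0_integral_mscale //.
  by rewrite lte_mul_pinfty // ?lee_fin ?sqmod_ge0 //; case/integrableP : fiU.
by apply: measurableT_comp => //; apply/measurable_EFinP; exact: measurable_id.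
Qed.

(** Test the eigenvalue equation of [e i] against [E(U) (e i)]; in the
    polarisation formula only the integral over [U] remains. *)
Lemma pvm_eigen_mean U i : measurable U ->
  Rintegral (m (e i)) U idfun = l i * fine (m (e i) U).
Proof.
move=> mU; have := diag_eigenvector es l i; rewrite Em => -[/= de le2 /(_ _ (pvm_dom mU de))].
rewrite dotZl //; last exact: pvm_L2.
rewrite (pvm_mass mU (e2 i)).1 -rmorphM => leE.
apply: complexI; rewrite leE /spectral_form !big_ord_recl big_ord0 /= /bump /=.
rewrite !(expr0, expr1) (exprS _ 2) sqrCi mulrN1 !pvm_Rintegral_add //.
have s1 c : sqmod (1 + c) = 1 + 2 * complex.Re c + sqmod (c : R[i]).
  by rewrite /sqmod !ReImE /=; ring.
rewrite !s1 !Re_opp Re_imagC !sqmodN sqmod_imagC (sqmod_real 1) /= !oppr0.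
move: (Rintegral _ _ _) (Rintegral _ _ _) => A B.
rewrite !rmorphD !rmorphM !rmorphD !rmorphM /= !rmorphN !rmorph1 !rmorph0.
by rewrite (rmorph_nat _ 2); field.
Qed.

(** By [pvm_eigen_mean], the difference to [l i] has integral zero over [U],
    although it does not change sign there. *)
Lemma pvm_eigen_null U i : measurable U ->
  (forall x, U x -> l i < x) \/ (forall x, U x -> x < l i) -> m (e i) U = 0%E.
Proof.
move=> mU sgn.
have de : spectral_dom mu m idfun (e i).
  by have := diag_eigenvector es l i; rewrite Em => -[].
have fi : (m (e i)).-integrable U (EFin \o idfun).
  by apply: integrableS (pvm_integrable de).
have mfin : (m (e i) U < +oo)%E by rewrite (pvm_mass mU (e2 i)).2 ltry.
have ci : (m (e i)).-integrable U (EFin \o cst (l i)).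
  apply/integrableP; split; first exact/measurable_EFinP.
  rewrite [ltLHS](_ : _ = \int[m (e i)]_(x in U) cst `|(l i)%:E| x)%E //.
  by rewrite integral_cst // lte_mul_pinfty // lee_fin.
have int0 : Rintegral (m (e i)) U (fun x => x - l i) = 0.
  rewrite (RintegralB _ fi ci) // (pvm_eigen_mean i mU).
  by rewrite Rintegral_cst // subrr.
have ii : (m (e i)).-integrable U (EFin \o (fun x => x - l i)).
  by have := integrableB mU fi ci; apply: eq_integrable => // x _.
have abs0 : (\int[m (e i)]_(x in U) `|(x - l i)%:E| = 0)%E.
  have fin := integrable_fin_num mU ii.
  have int0' : (\int[m (e i)]_(x in U) (x - l i)%:E = 0)%E.
    by rewrite -(fineK fin) [fine _]int0.
  case: sgn => sgn.
    rewrite -[RHS]int0'; apply: eq_integral => x /set_mem Ux.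
    by rewrite gee0_abs // lee_fin subr_ge0 ltW // sgn.
  transitivity (\int[m (e i)]_(x in U) (- (x - l i)%:E))%E.
    apply: eq_integral => x /set_mem Ux.
    by rewrite lee0_abs // lee_fin subr_le0 ltW // sgn.
  by rewrite integralN ?int0' ?oppe0 //; exact: integrable_add_def.
have mi : measurable_fun U (fun x => (x - l i)%:E) := measurable_int _ ii.
have [A [mA A0 UA]] := (ae_eq_integral_abs (m (e i)) mU mi).1 abs0.
apply: (subset_measure0 mU mA _ A0) => x Ux; apply: UA => /= /(_ Ux) [].
case: sgn => sgn /eqP; rewrite subr_eq0 => /eqP xl; have := sgn x Ux;
  by rewrite xl ltxx.
Qed.

(** The real line without [l i] consists of two half-lines, both null by
    [pvm_eigen_null]. So [E(U) (e i)] has either the norm of [e i] or norm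
    zero. *)
Lemma pvm_eigen U i : measurable U ->
  ae_eq2 (E U (e i)) (fun x => (\1_U (l i))%:C * e i x).
Proof.
move=> mU; have U2 := pvm_L2 mU (e2 i).
have null V : measurable V -> ~ V (l i) -> m (e i) V = 0%E.
  move=> mV Vl; pose P := V `&` `]l i, +oo[; pose Q := V `&` `]-oo, l i[.
  have mP : measurable P by apply: measurableI => //; exact: measurable_itv.
  have mQ : measurable Q by apply: measurableI => //; exact: measurable_itv.
  have P0 : m (e i) P = 0%E.
    by apply: pvm_eigen_null => //; left => x [_] /=; rewrite in_itv /= andbT.
  have Q0 : m (e i) Q = 0%E.
    by apply: pvm_eigen_null => //; right => x [_] /=; rewrite in_itv /=.
  apply: (@subset_measure0 _ _ _ _ V (P `|` Q)) => //.
  - exact: measurableU.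
  - move=> x Vx; case: (ltgtP (l i) x) => lx.
    + by left; split => //=; rewrite in_itv /= lx.
    + by right; split => //=; rewrite in_itv.
    + by case: Vl; rewrite lx.
  - exact: etrans (measureU0 mP mQ Q0) P0.
rewrite indicE; case: (boolP (l i \in U)) => Ul.
  have C0 : m (e i) (~` U) = 0%E by apply: null => [|/(_ (set_mem Ul))] //; exact: measurableC.
  have UT : m (e i) U = m (e i) setT.
    apply/esym; rewrite -(setvU U).
    apply: etrans (measureU (m (e i)) (measurableC mU) mU (setICl U)) _.
    exact: etrans (congr1 (fun z => z + m (e i) U)%E C0) (add0e _).
  apply/ae_eq2B0/nsq_eq0; first by apply: L2B => //; exact: L2Z.
  have -> : (fun x => E U (e i) x - 1%:R%:C * e i x) = (fun x => E U (e i) x + -1 * e i x).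
    by apply/funext => x; rewrite mulN1r mul1r.
  rewrite nsqD ?nsqZ ?dotZr //; last exact: L2Z.
  have nU : nsq (E U (e i)) = nsq (e i).
    apply: EFin_inj; rewrite -!pvm_massT // pvm_massI // setTI UT //.
  have := pvm_massT (e2 i); rewrite -UT (pvm_mass mU (e2 i)).2 => -[mUe].
  rewrite nU pvm_sym // (pvm_mass mU (e2 i)).1 mUe sqmodN (sqmod_real 1) conjcN.
  by rewrite !ReImE /=; ring.
have U0 : m (e i) U = 0%E by apply: null => // /mem_set; exact/negP.
apply: (@ae_eq2_trans _ _ _ _ _ (fun=> 0)); last first.
  by apply: aeW => x; rewrite mul0r.
apply: nsq_eq0 => //; apply: EFin_inj.
by rewrite -pvm_massT // pvm_massI // setTI.
Qed.

(** The symmetry of the projections transfers [pvm_eigen] to the coefficients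
    of [E(U) f]. *)
Lemma pvm_spectral_mass : spectral_mass m.
Proof.
move=> f U f2 mU; have U2 := pvm_L2 mU f2.
rewrite (point_measure_dot mU f2 U2); first by have [_ _ _ _ ->] := EP f2.
move=> i; rewrite /@coef pvm_sym //.
rewrite (dot_ae f2 f2 (pvm_L2 mU (e2 i)) (L2Z (\1_U (l i))%:C (e2 i)) (ae_eq2_refl _ _) (pvm_eigen i mU)).
by rewrite dotZr // conjc_real.
Qed.

End uniqueness.

(** The point masses give one spectral resolution of a diagonal operator, and
    every other one has the same masses, hence the same integrals. *)
Theorem fun_calc_diag phi : measurable_fun setT phi ->
  fun_calc mu phi (diag l) = diag (phi \o l).
Proof.
move=> mphi; apply/seteqP; split => fg.
  by move=> [E [m [EP Em]]]; rewrite (spectral_int_diag (pvm_spectral_mass EP Em)).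
have [E EP] := diag_resolution.
have [I J] := (spectral_int_diag spectral_mass_point (@measurable_id _ _ setT),
               spectral_int_diag spectral_mass_point mphi).
by rewrite -J => fgJ; exists E, point_measure; split => //; rewrite I.
Qed.

End functional_calculus.
(** * Cylinders of the groupoid *)

Section groupoid_cylinders.
Variables (N : nat) (N2 : (2 <= N)%N).
Local Notation letter := (letter N2).
Local Notation shift := (full_shift N2).
Local Notation word := (word N2).
Local Notation G := (groupoid N2).
Implicit Types (x y : shift) (g : G) (gamma : word * word) (v w : word).

Lemma iter_shiftE n x k : iter n (@shift_map N N2) x k = x (n + k)%N.
Proof. by elim: n x k => [//|n IH] x k; rewrite iterS /shift_map IH addnS. Qed.

Lemma kappa_tail g : tail_at (val g) (kappa g).
Proof. by rewrite /kappa; case: ex_minnP. Qed.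

Lemma kappa_min g k : tail_at (val g) k -> (kappa g <= k)%N.
Proof. by rewrite /kappa; case: ex_minnP => n _ mn /mn. Qed.

Lemma cocycle_kappa_ge0 g : 0 <= cocycle g + (kappa g)%:Z.
Proof. by have /andP[] := kappa_tail g. Qed.

Lemma rng_tail g k :
  rng g (absz (cocycle g + (kappa g)%:Z)%R + k)%N = src g (kappa g + k)%N.
Proof.
have /andP[_ /asboolP E] := kappa_tail g.
by rewrite -!iter_shiftE [in LHS]E.
Qed.

Lemma size_ell_s g : size (ell g).2 = (kappa g).+1.
Proof. by rewrite size_mkseq. Qed.

Lemma size_ell_r g : size (ell g).1 = absz (cocycle g + (kappa g)%:Z).
Proof. by rewrite size_mkseq. Qed.

Lemma ell_eq g g' : ell g' = ell g ->
  [/\ kappa g' = kappa g, cocycle g' = cocycle g &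
   forall k, rng g' k = if (k < size (ell g).1)%N then rng g k
     else src g' (kappa g + (k - size (ell g).1))%N].
Proof.
move=> E; have kk : kappa g' = kappa g by apply: succn_inj; rewrite -!size_ell_s E.
have cc : cocycle g' = cocycle g.
  have := congr1 (fun z => (size z.1)%:Z) E; rewrite !size_ell_r.
  by rewrite !gez0_abs ?cocycle_kappa_ge0 // kk => /addIr.
split => // k; case: ltnP => [kr|rk]; last first.
  by rewrite -[in LHS](subnKC rk) size_ell_r -kk -cc rng_tail.
have := congr1 (fun z => nth (src g 0%N) z.1 k) E.
rewrite !nth_mkseq //; first by rewrite -size_ell_r.
by rewrite -size_ell_r E.
Qed.

Lemma mkseqD (A : Type) (f : nat -> A) m n :
  mkseq f (m + n) = mkseq f m ++ mkseq (fun k => f (m + k)%N) n.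
Proof.
by rewrite /mkseq iotaD map_cat add0n -[X in iota X n]addn0 iotaDl -map_comp.
Qed.

Lemma eq_mkseq_lt (A : Type) (f f' : nat -> A) n :
  (forall k, (k < n)%N -> f k = f' k) -> mkseq f n = mkseq f' n.
Proof.
elim: n => [//|n IH] E; rewrite !mkseqS IH ?E // => k kn; apply: E; exact: ltnW.
Qed.

Definition prefix_of x n : word := mkseq x n.

Lemma prefix_ofP x y n :
  prefix_of x n = prefix_of y n <-> forall k, (k < n)%N -> x k = y k.
Proof.
split=> [E k kn|]; last exact: eq_mkseq_lt.
by have := congr1 (fun s => nth (x 0%N) s k) E; rewrite !nth_mkseq.
Qed.

(** The word [v] is counted from the end of [gamma.2], so that the subdivision
    of every piece starts at the empty word. *)
Definition cyl gamma v : set G :=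
  [set g | ell g = gamma /\ prefix_of (src g) (size (gamma.2 ++ v)) = gamma.2 ++ v].

Lemma cyl_nil gamma : cyl gamma [::] = piece gamma.
Proof.
apply/seteqP; split => g /=; first by case.
by move=> <-; split => //; rewrite cats0 size_ell_s.
Qed.

Lemma cyl_ell gamma v g : cyl gamma v g -> ell g = gamma.
Proof. by case. Qed.

Lemma cyl_piece gamma v : cyl gamma v `<=` piece gamma.
Proof. by move=> g []. Qed.

Definition tail_letter g k : letter := src g (size (ell g).2 + k)%N.

Lemma cylP gamma v g : cyl gamma v g <->
  ell g = gamma /\ mkseq (tail_letter g) (size v) = v.
Proof.
have cat_eq : ell g = gamma -> prefix_of (src g) (size (gamma.2 ++ v)) =
    gamma.2 ++ mkseq (tail_letter g) (size v).
  by move=> <-; rewrite size_cat {1}size_ell_s /prefix_of mkseqD -{2}size_ell_s.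
split=> -[E]; rewrite /= => vE; split => //; last by rewrite cat_eq // vE.
by move: vE; rewrite cat_eq // => /eqP; rewrite eqseq_cat // eqxx => /eqP.
Qed.

Lemma cyl_rcons gamma v a g :
  cyl gamma (rcons v a) g <-> cyl gamma v g /\ tail_letter g (size v) = a.
Proof.
rewrite !cylP size_rcons mkseqS; split.
  by move=> [E /eqP]; rewrite eqseq_rcons => /andP[/eqP -> /eqP ->].
by move=> [[E ->] ->].
Qed.

Lemma cyl_rcons_sub gamma v a : cyl gamma (rcons v a) `<=` cyl gamma v.
Proof. by move=> g /cyl_rcons[]. Qed.

Lemma cyl_letter gamma v g k : cyl gamma v g -> (k < size v)%N ->
  tail_letter g k = nth (tail_letter g 0) v k.
Proof. by move=> /cylP[_ E] kv; rewrite -[in RHS]E nth_mkseq. Qed.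

Lemma cyl_eq gamma v w g : cyl gamma v g -> cyl gamma w g ->
  size v = size w -> v = w.
Proof. by move=> /cylP[_ <-] /cylP[_ <-]; rewrite !size_mkseq => ->. Qed.

Definition ball_at g n : set G := cyl (ell g) (mkseq (tail_letter g) n).

Lemma ball_at_self g n : ball_at g n g.
Proof. by apply/cylP; rewrite size_mkseq. Qed.

Lemma cyl_ball gamma v g : cyl gamma v g -> cyl gamma v = ball_at g (size v).
Proof. by move=> /cylP[E vE]; rewrite /ball_at E vE. Qed.

Lemma ball_atP g n g' : ball_at g n g' <->
  ell g' = ell g /\ forall k, (k < n)%N -> tail_letter g' k = tail_letter g k.
Proof.
rewrite /ball_at cylP size_mkseq; split=> -[E F]; split => //.
  exact/prefix_ofP.
by apply/prefix_ofP.
Qed.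

Lemma ball_at_src g g' k n : ball_at g n g' -> (k < size (ell g).2 + n)%N ->
  src g' k = src g k.
Proof.
move=> /ball_atP[E F] kn; have [ks|sk] := ltnP k (size (ell g).2).
  have := congr1 (fun z => nth (src g 0%N) z.2 k) E.
  by rewrite !nth_mkseq // -size_ell_s ?E.
by have := F (k - size (ell g).2)%N; rewrite /tail_letter E subnKC //; apply; lia.
Qed.

Lemma ball_at_mono g m n : (m <= n)%N -> ball_at g n `<=` ball_at g m.
Proof.
move=> mn h /ball_atP[E F]; apply/ball_atP; split => // k km.
by apply: F; apply: leq_trans km mn.
Qed.

(** ** Topology *)

Lemma shift_coordinate_nbhs x k : nbhs x [set y : shift | y k = x k].
Proof.
have c : continuous (fun y : prod_topology (fun _ : nat => letter) => y k).
  exact: (@proj_continuous _ (fun _ : nat => letter) k).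
have : nbhs (x k) [set x k] by apply/principal_filterP.
by move=> /(c x).
Qed.

Lemma shift_prefix_nbhs x n : nbhs x [set y : shift | prefix_of y n = prefix_of x n].
Proof.
elim: n => [|n IH]; first by apply: filterS filterT.
apply: filterS2 IH (shift_coordinate_nbhs x n) => y /= E F.
by rewrite /prefix_of !mkseqS -!/(prefix_of _ _) E F.
Qed.

Lemma shift_nbhs_prefix x (A : set shift) : nbhs x A ->
  exists n, [set y | prefix_of y n = prefix_of x n] `<=` A.
Proof.
pose F := filter_from setT (fun n => [set y : shift | prefix_of y n = prefix_of x n]).
have FF : Filter F.
  apply: filter_from_filter; first by exists 0%N.
  move=> i j _ _; exists (maxn i j) => // y /= /prefix_ofP E.
  by split; apply/prefix_ofP => k km; apply: E; rewrite leq_max km ?orbT.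
suff : F --> x by move=> /[apply] -[n _ nA]; exists n.
apply/cvg_sup => k B [_ [[C Cop <-] Cx CB]].
exists k.+1 => // y /= /prefix_ofP/(_ k (ltnSn k)) yx.
by apply: CB => /=; rewrite yx.
Qed.

Definition groupoid_map (g : G) :=
  (src g, rng g, kappa g, cocycle g : discrete_topology int).

Lemma groupoid_map_continuous : continuous groupoid_map.
Proof. exact: (@initial_continuous (groupoid_set N2) _ groupoid_map). Qed.

Lemma ball_at_nbhs g n : nbhs g (ball_at g n).
Proof.
have cF := @groupoid_map_continuous g.
have pr (A : set shift) (B : set shift) (C : set nat) (D : set (discrete_topology int)) :
    nbhs (src g) A -> nbhs (rng g) B -> C (kappa g) -> D (cocycle g) ->
    nbhs g [set g' | [/\ A (src g'), B (rng g'), C (kappa g') & D (cocycle g')]].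
  move=> nA nB nC nD; have : nbhs (groupoid_map g) (((A `*` B) `*` C) `*` D).
    exists ((A `*` B) `*` C, D) => //=; split; last exact/principal_filterP.
    exists (A `*` B, C) => //=; split; last exact/principal_filterP.
    by exists (A, B).
  move=> nn; have := cF _ nn; rewrite nbhs_simpl => nn'.
  by apply: (@filterS _ (nbhs g) _ _ _ _ nn') => g' /= [[[]]].
have cs (A : set shift) : nbhs (src g) A -> nbhs g [set g' | A (src g')].
  by move=> nA; apply: filterS (pr A setT setT setT nA filterT I I) => g' [].
have cr (A : set shift) : nbhs (rng g) A -> nbhs g [set g' | A (rng g')].
  by move=> nA; apply: filterS (pr setT A setT setT filterT nA I I) => g' [].
have ck : nbhs g [set g' | kappa g' = kappa g].
  by apply: filterS (pr setT setT [set kappa g] setT filterT filterT erefl I) => g' [].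
have cc : nbhs g [set g' | cocycle g' = cocycle g].
  by apply: filterS (pr setT setT setT [set cocycle g] filterT filterT I erefl) => g' [].
have := cs _ (shift_prefix_nbhs (src g) (size (ell g).2 + n)).
have := cr _ (shift_prefix_nbhs (rng g) (size (ell g).1)).
move=> nr ns; near=> g'.
have kk : kappa g' = kappa g by near: g'.
have c' : cocycle g' = cocycle g by near: g'.
have /prefix_ofP rr : prefix_of (rng g') (size (ell g).1) = prefix_of (rng g) (size (ell g).1).
  by near: g'.
have /prefix_ofP ss : prefix_of (src g') (size (ell g).2 + n) =
    prefix_of (src g) (size (ell g).2 + n) by near: g'.
have ee : ell g' = ell g.
  rewrite /ell /ell_r /ell_s kk c'; apply: congr2; apply: eq_mkseq_lt => k kn.
    by apply: rr; rewrite size_ell_r.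
  by apply: ss; rewrite size_ell_s ltn_addr.
apply/ball_atP; split => // k kn.
by rewrite /tail_letter ee ss // ltn_add2l.
Unshelve. all: end_near. Qed.

(** The topology is initial for the source, the range, [kappa] and the
    cocycle. On a piece, the last two are constant and the range is a function
    of the source, so a neighbourhood constrains finitely many letters of the
    source. *)
Lemma nbhs_ball_at g (A : set G) : nbhs g A -> exists n, ball_at g n `<=` A.
Proof.
pose F := filter_from setT (ball_at g).
have FF : Filter F.
  apply: filter_from_filter; first by exists 0%N.
  move=> i j _ _; exists (maxn i j) => // y yb.
  by split; apply: ball_at_mono yb; rewrite ?leq_maxl ?leq_maxr.
suff Fg : groupoid_map @ F --> groupoid_map g.
  move=> [_ [[B Bop <-] Bg BA]].
  have /Fg [n _ nB] : nbhs (groupoid_map g) B by rewrite nbhsE; exists B.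
  by exists n => g' /nB; exact: BA.
have Fs : (@src N N2 : G -> shift) @ F --> src g.
  move=> B /shift_nbhs_prefix[n nB]; exists n => // g' gg'; apply: nB => /=.
  by apply/prefix_ofP => k kn; apply: (ball_at_src gg'); rewrite ltn_addl.
have Fr : (@rng N N2 : G -> shift) @ F --> rng g.
  move=> B /shift_nbhs_prefix[n nB]; exists n => // g' gg'; apply: nB => /=.
  have [E _] := (ball_atP _ _ _).1 gg'.
  have [_ _ R'] := ell_eq E; have [_ _ R0] := ell_eq (erefl (ell g)).
  apply/prefix_ofP => k kn; rewrite R' R0; case: ifP => // ks.
  apply: (ball_at_src gg'); rewrite size_ell_s; move: ks kn; lia.
have Fk : (@kappa N N2 : G -> nat) @ F --> kappa g.
  move=> B /principal_filterP Bk; exists 0%N => // g' /ball_atP[E _] /=.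
  by have [-> _ _] := ell_eq E.
have Fc : (@cocycle N N2 : G -> discrete_topology int) @ F --> (cocycle g : discrete_topology int).
  move=> B /principal_filterP Bk; exists 0%N => // g' /ball_atP[E _] /=.
  by have [_ -> _] := ell_eq E.
move=> B [[P3 Pc] /= [[[P2 Pk] /= [[[Ps Pr] /= [ns nr] P2B] nk] P3B] nc] PB].
have F1 : F (@src N N2 @^-1` Ps) := Fs _ ns.
have F2 : F (@rng N N2 @^-1` Pr) := Fr _ nr.
have F3 : F (@kappa N N2 @^-1` Pk) := Fk _ nk.
have F4 : F (@cocycle N N2 @^-1` Pc) := Fc _ nc.
apply: (@filterS _ F _ _ _ _ (filterI (filterI F1 F2) (filterI F3 F4))).
move=> g' [[a b] [c e]]; apply: PB; split => //=; apply: P3B; split => //=.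
exact: P2B.
Qed.

Lemma cyl_open gamma v : open (cyl gamma v).
Proof.
rewrite openE => g vg; rewrite (cyl_ball vg); exact: ball_at_nbhs.
Qed.

Lemma cyl_closed gamma v : closed (cyl gamma v).
Proof.
move=> g cg.
have [h [vh /ball_atP[E F]]] := cg _ (ball_at_nbhs g (size v)).
rewrite (cyl_ball vh); apply/ball_atP; split => // k kv.
by rewrite F.
Qed.

(** ** Every source sequence is attained in a piece *)

(** The range must be [gamma.1] followed by the tail of [y]. It remains to
    exclude a shorter common tail, which a given element of the piece would
    inherit. *)
Lemma piece_surj gamma y : index_set gamma -> cylinder gamma.2 y ->
  exists g, ell g = gamma /\ src g = y.
Proof.
move=> [g0 _ <-] yb.
set p := absz (cocycle g0 + (kappa g0)%:Z).
pose x : shift := fun k => if (k < p)%N then rng g0 k else y (kappa g0 + (k - p))%N.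
have tailE : tail_at (x, cocycle g0, y) (kappa g0).
  rewrite /tail_at /= cocycle_kappa_ge0; apply/asboolP/funext => k.
  by rewrite !iter_shiftE /x -/p ltnNge leq_addr /= addKn.
have ok : `[< exists k, tail_at (x, cocycle g0, y) k >] by apply/asboolP; exists (kappa g0).
pose g : G := exist _ (x, cocycle g0, y) ok.
have ys k : (k <= kappa g0)%N -> y k = src g0 k.
  move: yb; rewrite /cylinder size_ell_s => /prefix_ofP yb kk.
  exact: yb.
have kg : kappa g = kappa g0.
  apply/eqP; rewrite eqn_leq kappa_min //= leqNgt; apply/negP => lt.
  (* a shorter common tail of x and y is one of the given element *)
  have /andP[ge0 /asboolP E] := kappa_tail g.
  rewrite /= in ge0 E; have : (kappa g0 <= kappa g)%N; last by rewrite leqNgt lt.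
  apply: kappa_min; rewrite /tail_at ge0 /=; apply/asboolP/funext => k.
  have := congr1 (fun z : shift => z k) E; rewrite !iter_shiftE /x.
  have pE : (absz (cocycle g0 + (kappa g)%:Z)%R + (kappa g0 - kappa g) = p)%N.
    by rewrite /p; move: ge0 (cocycle_kappa_ge0 g0) lt; lia.
  have [kk|kk] := ltnP k (kappa g0 - kappa g).
    rewrite ifT => [H|]; last by lia.
    by transitivity (y (kappa g + k)%N); [exact: H | apply: ys; lia].
  move=> _; have R := rng_tail g0 (k - (kappa g0 - kappa g))%N.
  have e1 : (absz (cocycle g0 + (kappa g)%:Z)%R + k = p + (k - (kappa g0 - kappa g)))%N.
    by lia.
  have e2 : (kappa g0 + (k - (kappa g0 - kappa g)) = kappa g + k)%N by lia.
  exact: etrans (congr1 (rng g0) e1) (etrans R (congr1 (src g0) e2)).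
exists g; split => //; rewrite /ell /ell_r /ell_s kg /cocycle /=.
apply: congr2; apply: eq_mkseq_lt => k kk; last exact: ys.
by rewrite -[LHS]/(x k) /x ifT.
Qed.

Lemma src_cyl gamma v : index_set gamma ->
  [set src g | g in cyl gamma v] = cylinder (gamma.2 ++ v).
Proof.
move=> ig; apply/seteqP; split => [_ [g [E gv] <-] //|y yv].
have [|g [E sE]] := piece_surj (y := y) ig.
  move: yv; rewrite /cylinder /= size_cat => /(congr1 (take (size gamma.2))).
  rewrite take_size_cat // => <-; rewrite -map_take take_iota.
  by rewrite size_map size_iota; congr (mkseq _ _); lia.
by exists g => //; split => //; rewrite sE.
Qed.

(** ** Compactness of the pieces *)

Lemma shift_compact : compact [set: shift].
Proof.
have fl : finite_set [set: letter].
  apply/finite_seqP; exists (enum (predT : {pred letter})).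
  by apply/seteqP; split => x //= _; rewrite mem_enum.
have -> : [set: shift] = [set f | forall i : nat, [set: letter] (f i)].
  by apply/seteqP.
exact: (@tychonoff nat (fun _ => letter) (fun _ => setT)
  (fun _ => finite_compact fl)).
Qed.

(** A cluster point of the sources lifts to the piece, where the balls are the
    preimages of the cylinders of the shift. *)
Lemma piece_compact gamma : compact (piece gamma).
Proof.
have [ig|nig] := pselect (index_set gamma); last first.
  rewrite (_ : piece gamma = set0); first exact: compact0.
  by apply/seteqP; split => // g E; apply: nig; exists g.
move=> F PF Fp; pose S : set_system shift := (@src N N2 : G -> shift) @ F.
have [y [_ Sy]] : [set: shift] `&` cluster S !=set0.
  by apply: shift_compact; exact: filterT.
have near_y n (A : set G) : F A -> exists g,
    [/\ A g, ell g = gamma & prefix_of (src g) n = prefix_of y n].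
  move=> FA; have SA : S [set src g | g in A `&` piece gamma].
    apply: (@filterS _ F _ _ _ _ (filterI FA Fp)) => g gA /=; by exists g.
  by have [_ [[g [Ag E] <-] yn]] := Sy _ _ SA (shift_prefix_nbhs y n); exists g.
have yb : cylinder gamma.2 y.
  have [g [_ E sg]] := near_y (size gamma.2) setT filterT.
  by rewrite /cylinder /= -/(prefix_of _ _) -sg -E {1}size_ell_s.
have [g [E sE]] := piece_surj ig yb.
exists g; split; first exact: E.
move=> A B FA /nbhs_ball_at[n nB].
have [h [Ah Eh hy]] := near_y (size gamma.2 + n)%N A FA.
exists h; split => //; apply: nB; apply/ball_atP; rewrite Eh E; split => // k kn.
by rewrite /tail_letter Eh E sE; apply: ((prefix_ofP _ _ _).1 hy); rewrite ltn_add2l.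
Qed.

End groupoid_cylinders.
(** * Integration over cylinders *)

Lemma measurable_fun_countable d (T : measurableType d) (R : realType)
    (C : countType) (code : T -> C) (phi : C -> R) :
  (forall c, measurable (code @^-1` [set c])) ->
  measurable_fun setT (fun x => phi (code x)).
Proof.
move=> mc _ Y mY; rewrite setTI.
rewrite (_ : _ @^-1` Y = \bigcup_n (if @pickle_inv C n is Some c then
   (if `[< Y (phi c) >] then code @^-1` [set c] else set0) else set0)).
  apply: bigcupT_measurable => n; case: (@pickle_inv C n) => [c|//].
  by case: ifP.
apply/seteqP; split => x /=.
  move=> Yx; exists (pickle (code x)) => //; rewrite pickleK_inv.
  by case: ifP => // /asboolP.
move=> [n _]; case: (@pickle_inv C n) => [c|//].
by case: ifP => // /asboolP Yc /= ->.
Qed.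

Lemma geometric_small (R : realType) (C r eps : R) : 0 <= r -> r < 1 -> 0 < eps ->
  exists n, C * r ^+ n < eps.
Proof.
move=> r0 r1 e0; have /(cvg_geometric C)/cvgrPdist_lt/(_ _ e0) : `|r| < 1 by rewrite ger0_norm.
move=> [n _ /(_ n (leqnn n))]; rewrite sub0r normrN => H; exists n.
exact: le_lt_trans (ler_norm _) H.
Qed.

Lemma geometric_nneseries (R : realType) (C z : R) : 0 <= z -> z < 1 ->
  (\sum_(0 <= k <oo) (C * z ^+ k)%:E = (C / (1 - z))%:E)%E.
Proof.
move=> z0 z1; apply: nneseries_EFin_cvg.
have := @cvg_geometric_series R C z; rewrite ger0_norm // => /(_ z1).
by rewrite seriesEord.
Qed.

Section groupoid_operators.
Variables (R : realType) (N : nat) (N2 : (2 <= N)%N).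
Local Notation letter := (letter N2).
Local Notation word := (word N2).
Local Notation G := (borel_groupoid N2).
Variable mu : {measure set (borel_shift N2) -> \bar R}.
Hypothesis mu_cylinder : forall a : word, mu (cylinder a) = (N%:R ^- size a)%:E.
Variable muG : {measure set G -> \bar R}.
Hypothesis muG_piece : forall (gamma : word * word) (A : set G),
  index_set gamma -> measurable A -> A `<=` piece gamma ->
  muG A = mu [set src g | g in A].
Implicit Types (gamma : word * word) (v w : word) (x y : G) (j l a : letter).
Local Notation Rint := (Rintegral muG setT).

Section real_functions.
Implicit Types f g : G -> R.

Lemma cyl_measurable gamma v : measurable (cyl gamma v : set G).
Proof. by apply: sub_gen_smallest; exact: cyl_open. Qed.

Lemma piece_measurable gamma : measurable (piece gamma : set G).
Proof. by rewrite -cyl_nil; exact: cyl_measurable. Qed.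

Lemma piece_index gamma : ~ index_set gamma -> piece gamma = set0.
Proof.
by move=> ng; apply/seteqP; split => // g E; apply: ng; exists g.
Qed.

(** The measure of the cylinders of level [k] in the piece of [gamma]; the
    piece is empty if [gamma] is not in the index set. *)
Definition cyl_mass gamma (k : nat) : R :=
  if `[< index_set gamma >] then N%:R ^- (size gamma.2 + k) else 0.

Lemma cyl_massE gamma v : muG (cyl gamma v) = (cyl_mass gamma (size v))%:E.
Proof.
rewrite /cyl_mass; case: asboolP => ig.
  rewrite (muG_piece ig (cyl_measurable _ _) (@cyl_piece _ _ _ _)).
  by rewrite src_cyl // mu_cylinder size_cat.
rewrite (_ : cyl gamma v = set0) ?measure0 //; apply/seteqP; split => // g.
by move=> /cyl_piece; rewrite piece_index.
Qed.

Lemma N_gt0 : (0 : R) < N%:R.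
Proof. by rewrite ltr0n; apply: leq_trans N2. Qed.

(** The class of functions that are integrated below. Its members are
    integrable and square-integrable because a piece has finite measure. *)
Definition piecewise_bounded gamma f := measurable_fun setT f /\
  exists M : R, forall x, `|f x| <= M * \1_(piece gamma) x.

Lemma cyl_indic_integrable gamma v (r : R) :
  muG.-integrable setT (fun x => (r * \1_(cyl gamma v) x)%:E).
Proof.
apply: integrable_scale; have mc := cyl_measurable gamma v.
apply/integrableP; split; first by apply/measurable_EFinP; exact: measurable_indic.
under eq_integral do rewrite /= ger0_norm //.
by rewrite integral_indic // setIT cyl_massE ltry.
Qed.

Lemma cyl_indic_measurable gamma v : measurable_fun setT (\1_(cyl gamma v) : G -> R).
Proof. by apply: measurable_indic; exact: cyl_measurable. Qed.

Lemma piecewise_bounded_integrable gamma f : piecewise_bounded gamma f ->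
  muG.-integrable setT (fun x => (f x)%:E).
Proof.
move=> [mf [M fM]].
apply: (le_integrable measurableT _ _ (cyl_indic_integrable gamma [::] M)).
  exact/measurable_EFinP.
move=> x _; rewrite cyl_nil /= lee_fin; apply: le_trans (fM x) (ler_norm _).
Qed.

Lemma piecewise_boundedM gamma f (g : G -> R) (M : R) : piecewise_bounded gamma f ->
  measurable_fun setT g -> (forall x, piece gamma x -> `|g x| <= M) ->
  piecewise_bounded gamma (fun x => g x * f x).
Proof.
move=> [mf [K fK]] mg gM; split; first exact: measurable_funM.
exists (Num.max M 0 * K) => x; rewrite normrM -mulrA.
have [px|px] := pselect (piece gamma x).
  by apply: ler_pM => //; rewrite le_max gM.
have := fK x; rewrite indicE memNset // !mulr0 => fx.
have -> : `|f x| = 0 by apply/eqP; rewrite eq_le fx normr_ge0.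
by rewrite mulr0.
Qed.

Lemma piecewise_bounded_mul gamma gamma' f g : piecewise_bounded gamma f ->
  piecewise_bounded gamma' g -> piecewise_bounded gamma (fun x => f x * g x).
Proof.
move=> bf [mg [M gM]]; under eq_fun do rewrite mulrC.
apply: (piecewise_boundedM (M := Num.max M 0) bf) => // x _.
apply: le_trans (gM x) _; rewrite indicE le_max.
by case: (_ \in _); rewrite ?mulr1 ?mulr0 lexx ?orbT.
Qed.

Lemma piecewise_bounded_cyl gamma v : piecewise_bounded gamma (\1_(cyl gamma v)).
Proof.
split; first exact: cyl_indic_measurable.
exists 1 => x; rewrite mul1r !indicE ger0_norm //.
case: (boolP (x \in cyl gamma v)) => // /set_mem/cyl_piece px.
by rewrite mem_set.
Qed.

Lemma piecewise_boundedD gamma f g : piecewise_bounded gamma f ->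
  piecewise_bounded gamma g -> piecewise_bounded gamma (fun x => f x + g x).
Proof.
move=> [mf [M fM]] [mg [K gK]]; split; first exact: measurable_funD.
exists (M + K) => x; rewrite mulrDl; apply: le_trans (ler_normD _ _) _.
exact: lerD.
Qed.

Lemma piecewise_boundedZ gamma (r : R) f : piecewise_bounded gamma f ->
  piecewise_bounded gamma (fun x => r * f x).
Proof.
move=> bf; apply: (@piecewise_boundedM gamma f (fun=> r) `|r|) => //.
Qed.

Lemma piecewise_bounded_sum gamma I (s : seq I) (F : I -> G -> R) :
  (forall i, piecewise_bounded gamma (F i)) ->
  piecewise_bounded gamma (fun x => \sum_(i <- s) F i x).
Proof.
move=> FB; elim: s => [|i s IH].
  under eq_fun do rewrite big_nil; split; first exact: measurable_cst.
  by exists 0 => x; rewrite normr0 mul0r.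
by under eq_fun do rewrite big_cons; exact: piecewise_boundedD.
Qed.

Lemma piecewise_bounded_L2 gamma f : piecewise_bounded gamma f ->
  L2 muG (fun x => (f x)%:C).
Proof.
move=> bf; have [mf [M fM]] := bf; split; first exact: cmeasurable_real.
have bff : piecewise_bounded gamma (fun x => f x * f x).
  apply: (piecewise_boundedM (M := Num.max M 0)) => // x px.
  by rewrite (le_trans (fM x)) // indicE mem_set // mulr1 le_max lexx.
have /integrableP[_] := piecewise_bounded_integrable bff.
rewrite [X in (X < _)%E -> _](_ : _ = \int[muG]_x (sqmod (f x)%:C)%:E)%E //.
apply: eq_integral => x _.
by rewrite sqmod_real gee0_abs ?lee_fin -expr2 ?sqr_ge0.
Qed.

Lemma Rint_sum gamma I (s : seq I) (F : I -> G -> R) :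
  (forall i, piecewise_bounded gamma (F i)) ->
  Rint (fun x => \sum_(i <- s) F i x) =
  \sum_(i <- s) Rint (F i).
Proof.
move=> FB; elim: s => [|i s IH].
  by under eq_Rintegral do rewrite big_nil; rewrite Rintegral_cst // mul0r big_nil.
under eq_Rintegral do rewrite big_cons.
rewrite big_cons RintegralD ?IH //; apply: piecewise_bounded_integrable => //.
exact: piecewise_bounded_sum.
Qed.

Lemma Rint_scale gamma (r : R) f : piecewise_bounded gamma f ->
  Rint (fun x => r * f x) = r * Rint f.
Proof. by move=> bf; rewrite RintegralZl //; exact: (piecewise_bounded_integrable bf). Qed.

Lemma Rint_cyl gamma v :
  Rint (\1_(cyl gamma v) : G -> R) = cyl_mass gamma (size v).
Proof.
rewrite /Rintegral integral_indic ?setIT //; last exact: cyl_measurable.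
by rewrite cyl_massE.
Qed.

Lemma cyl_indic_split gamma v (x : G) :
  (\1_(cyl gamma v) x : R) = \sum_(a : letter) \1_(cyl gamma (rcons v a)) x.
Proof.
have [vx|nvx] := pselect (cyl gamma v x); last first.
  rewrite indicE memNset // big1 // => a _; rewrite indicE memNset //.
  by move=> /cyl_rcons_sub.
rewrite indicE mem_set // (bigD1 (tail_letter x (size v))) //=.
rewrite indicE mem_set; last by apply/cyl_rcons.
rewrite big1 ?addr0 // => a ax; rewrite indicE memNset // => /cyl_rcons[_ xa].
by rewrite xa eqxx in ax.
Qed.

Lemma Rint_cyl_split gamma v f : piecewise_bounded gamma f ->
  Rint (fun x => f x * \1_(cyl gamma v) x) =
  \sum_(a : letter) Rint (fun x => f x * \1_(cyl gamma (rcons v a)) x).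
Proof.
move=> bf; under eq_Rintegral do rewrite cyl_indic_split mulr_sumr.
rewrite (Rint_sum (gamma := gamma)) // => a.
under eq_fun do rewrite mulrC.
apply: (piecewise_boundedM (M := 1)) => //; first exact: cyl_indic_measurable.
by move=> x _; rewrite indicE; case: (_ \in _); rewrite ?normr1 ?normr0.
Qed.

Lemma piecewise_bounded_indicM gamma v f : piecewise_bounded gamma f ->
  piecewise_bounded gamma (fun x => f x * \1_(cyl gamma v) x).
Proof.
move=> bf; under eq_fun do rewrite mulrC.
apply: (piecewise_boundedM (M := 1)) => //; first exact: cyl_indic_measurable.
by move=> x _; rewrite indicE; case: (_ \in _); rewrite ?normr1 ?normr0.
Qed.

Lemma Rint_const_on_cyl gamma v f (r : R) : (forall x, cyl gamma v x -> f x = r) ->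
  Rint (fun x => f x * \1_(cyl gamma v) x) = r * cyl_mass gamma (size v).
Proof.
move=> fr; rewrite -Rint_cyl -(Rint_scale (gamma := gamma)); last exact: piecewise_bounded_cyl.
apply: eq_Rintegral => x _; have [vx|nvx] := pselect (cyl gamma v x); first by rewrite fr.
by rewrite indicE memNset // !mulr0.
Qed.

Lemma Rint_cyl_le gamma v f (M : R) : piecewise_bounded gamma f ->
  (forall x, cyl gamma v x -> `|f x| <= M) ->
  `|Rint (fun x => f x * \1_(cyl gamma v) x)| <=
    M * cyl_mass gamma (size v).
Proof.
move=> bf fM.
have bfv := piecewise_bounded_indicM v bf.
apply: le_trans (le_normr_Rintegral measurableT (piecewise_bounded_integrable bfv)) _.
rewrite -Rint_cyl -(Rint_scale (gamma := gamma)); last exact: piecewise_bounded_cyl.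
apply: le_Rintegral => //.
- by apply: integrable_norm; exact: piecewise_bounded_integrable bfv.
- by apply: (piecewise_bounded_integrable (gamma := gamma)); apply: piecewise_boundedZ; exact: piecewise_bounded_cyl.
- move=> x _; have [vx|nvx] := pselect (cyl gamma v x).
    by rewrite indicE mem_set // !mulr1 fM.
  by rewrite indicE memNset // !mulr0 normr0.
Qed.

Lemma Rint_piece gamma f : piecewise_bounded gamma f ->
  Rint f = Rint (fun x => f x * \1_(cyl gamma [::]) x).
Proof.
move=> [_ [M fM]]; apply: eq_Rintegral => x _.
have [px|px] := pselect (piece gamma x); first by rewrite cyl_nil indicE mem_set ?mulr1.
rewrite cyl_nil indicE memNset // mulr0; apply/eqP; rewrite -normr_le0.
by rewrite (le_trans (fM x)) // indicE memNset // mulr0.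
Qed.

Lemma dot_real f g : dot muG (fun x => (f x)%:C) (fun x => (g x)%:C) =
  (Rint (fun x => f x * g x))%:C.
Proof.
apply: complex_eqP => /=.
  by apply: eq_Rintegral => x _; rewrite oppr0 mulr0 subr0.
rewrite (_ : Rintegral _ _ _ = Rint (cst 0)).
  by rewrite Rintegral_cst // mul0r.
by apply: eq_Rintegral => x _; rewrite oppr0 mulr0 mul0r addr0.
Qed.

Lemma cint_real f : cintegral muG setT (fun x => (f x)%:C) = (Rint f)%:C.
Proof. by apply: complex_eqP => //=; rewrite Rintegral_cst // mul0r. Qed.

(** ** Cylinders generate the Borel sets *)

(** The empty set makes the family stable under intersections. *)
Definition cylinder_family : set (set G) :=
  [set A | A = set0 \/ exists gamma v, A = cyl gamma v].

Lemma cylinder_family_setI : setI_closed cylinder_family.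
Proof.
move=> A B [->|[ga [v ->]]]; first by rewrite set0I; left.
move=> [->|[ga' [v' ->]]]; first by rewrite setI0; left.
have [[x [vx v'x]]|E] := pselect ((cyl ga v `&` cyl ga' v') !=set0); last first.
  by left; apply/eqP; apply: contra_notT E => /set0P.
right; exists ga; rewrite (cyl_ball vx) (cyl_ball v'x).
have [le|/ltnW le] := leqP (size v) (size v').
  by exists v'; rewrite setIidr; [rewrite -(cyl_ball v'x) -(cyl_ell vx) (cyl_ell v'x) | exact: ball_at_mono].
by exists v; rewrite setIidl; [rewrite -(cyl_ball vx) | exact: ball_at_mono].
Qed.

Lemma open_bigcup_cyl (A : set G) : open A ->
  exists F : nat -> set G, (forall n, cylinder_family (F n)) /\ A = \bigcup_n F n.
Proof.
move=> oA; pose C : countType := (word * word * word)%type.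
exists (fun n => if @pickle_inv C n is Some c then
  (if `[< cyl c.1 c.2 `<=` A >] then cyl c.1 c.2 else set0) else set0).
split=> [n|].
  case: (@pickle_inv C n) => [c|]; last by left.
  by case: ifP => _; [right; exists c.1, c.2 | left].
apply/seteqP; split => x.
  move=> Ax; have /nbhs_ball_at[k kA] : nbhs x A by apply: open_nbhs_nbhs.
  pose c0 : C := (ell x, mkseq (tail_letter x) k).
  exists (pickle c0); first by [].
  rewrite pickleK_inv ifT; first exact: ball_at_self.
  exact/asboolP.
move=> [n _]; case: (@pickle_inv C n) => [c|//].
by case: ifP => // /asboolP; apply.
Qed.

Lemma borel_cylinder : (measurable : set (set G)) = <<s cylinder_family >>.
Proof.
apply/seteqP; split; last first.
  apply: smallest_sub; first exact: sigma_algebra_measurable.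
  by move=> _ [->|[ga [v ->]]]; [exact: measurable0 | exact: cyl_measurable].
apply: smallest_sub; first exact: smallest_sigma_algebra.
move=> A /open_bigcup_cyl[F [FC ->]].
apply: sigma_algebra_bigcup => n; apply: sub_gen_smallest; exact: FC.
Qed.

(** * The Haar system of the groupoid *)

Definition letter_val a : nat := (a : 'I_N).

Lemma letter_val_inj : injective letter_val.
Proof. by move=> a b /val_inj. Qed.

Lemma letter_val_lt a : (letter_val a < N)%N.
Proof. exact: (ltn_ord (a : 'I_N)). Qed.

(** The vectors [(1, ..., 1, - j, 0, ..., 0)], pairwise orthogonal and orthogonal
    to the constants; the vector for [j = 0] is null. *)
Definition haar j l : R :=
  if (letter_val l < letter_val j)%N then 1
  else if l == j then - (letter_val j)%:R else 0.

Lemma sum_lt_nat (n j : nat) : (j <= n)%N -> \sum_(l < n) ((l < j)%N%:R : R) = j%:R.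
Proof.
elim: n => [|n IH]; first by rewrite leqn0 big_ord0 => /eqP ->.
rewrite leq_eqVlt => /orP[/eqP ->|jn]; rewrite big_ord_recr /=.
  rewrite ltnSn (eq_bigr (fun=> 1)) => [|i _]; last by rewrite ltnS ltnW.
  by rewrite big_const_ord iter_addr_0 -natr1.
by rewrite ltnNge -ltnS jn addr0 IH.
Qed.

Lemma haar_sum j : \sum_(l : letter) haar j l = 0.
Proof.
rewrite (eq_bigr (fun l => (letter_val l < letter_val j)%N%:R +
    (if l == j then - (letter_val j)%:R else 0))); last first.
  move=> l _; rewrite /haar; case: ltnP => lj; last by rewrite add0r.
  by case: eqVneq lj => [->|_]; rewrite ?ltnn ?addr0.
rewrite big_split /= -big_mkcond big_pred1_eq.
have := @sum_lt_nat N (letter_val j) (ltnW (letter_val_lt j)).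
rewrite -[X in X = _ -> _]/(\sum_(l : letter) ((letter_val l < letter_val j)%N%:R : R)).
by move=> ->; rewrite subrr.
Qed.

(** The vector with the larger index is constant on the support of the other
    one. *)
Lemma haar_orth j j' : j != j' -> \sum_(l : letter) haar j l * haar j' l = 0.
Proof.
wlog lt : j j' / (letter_val j < letter_val j')%N => [H|] jj.
  have [lt|lt|/letter_val_inj E] := ltngtP (letter_val j) (letter_val j').
  - exact: H.
  - by under eq_bigr do rewrite mulrC; apply: H; rewrite // eq_sym.
  - by rewrite E eqxx in jj.
rewrite -[RHS](haar_sum j); apply: eq_bigr => l _; rewrite /haar.
have [lj|lj] := ltnP; first by rewrite (ltn_trans lj lt) mulr1.
by case: eqVneq lj => [->|_] _; rewrite ?mul0r // lt mulr1.
Qed.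

Definition wavelet gamma v j : G -> R :=
  fun x => \sum_(a : letter) haar j a * \1_(cyl gamma (rcons v a)) x.

Lemma waveletE gamma v j x : cyl gamma v x ->
  wavelet gamma v j x = haar j (tail_letter x (size v)).
Proof.
move=> vx; rewrite /wavelet (bigD1 (tail_letter x (size v))) //=.
rewrite indicE mem_set; last by apply/cyl_rcons.
rewrite mulr1 big1 ?addr0 // => a ax; rewrite indicE memNset ?mulr0 //.
by move=> /cyl_rcons[_ xa]; rewrite xa eqxx in ax.
Qed.

Lemma wavelet_out gamma v j x : ~ cyl gamma v x -> wavelet gamma v j x = 0.
Proof.
move=> nvx; rewrite /wavelet big1 // => a _; rewrite indicE memNset ?mulr0 //.
by move=> /cyl_rcons_sub.
Qed.

Lemma wavelet_bounded gamma v j : piecewise_bounded gamma (wavelet gamma v j).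
Proof.
apply: (@piecewise_bounded_sum _ _ _ (fun a x => haar j a * \1_(cyl gamma (rcons v a)) x)) => a.
by apply: piecewise_boundedZ; exact: piecewise_bounded_cyl.
Qed.

Lemma wavelet_Rint gamma v j f : piecewise_bounded gamma f ->
  Rint (fun x => f x * wavelet gamma v j x) =
  \sum_(a : letter) haar j a * Rint (fun x => f x * \1_(cyl gamma (rcons v a)) x).
Proof.
move=> bf.
transitivity (Rint (fun x => \sum_(a : letter) haar j a * (f x * \1_(cyl gamma (rcons v a)) x))).
  by apply: eq_Rintegral => x _; rewrite /wavelet mulr_sumr; under eq_bigr do rewrite mulrCA.
rewrite (Rint_sum (gamma := gamma)) => [|a]; last first.
  by apply: piecewise_boundedZ; exact: piecewise_bounded_indicM.
apply: eq_bigr => a _.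
by rewrite (Rint_scale (gamma := gamma)) //; exact: piecewise_bounded_indicM.
Qed.

Lemma wavelet_pair gamma v j f (c : letter -> R) : piecewise_bounded gamma f ->
  (forall x, cyl gamma v x -> f x = c (tail_letter x (size v))) ->
  Rint (fun x => f x * wavelet gamma v j x) =
  (\sum_(a : letter) c a * haar j a) * cyl_mass gamma (size v).+1.
Proof.
move=> bf fc; rewrite wavelet_Rint // mulr_suml; apply: eq_bigr => a _.
rewrite (Rint_const_on_cyl (r := c a)).
  by rewrite size_rcons; ring.
by move=> x /cyl_rcons[vx <-]; exact: fc.
Qed.

(** Wavelets have mean zero. *)
Lemma wavelet_const gamma v j f (r : R) : (forall x, cyl gamma v x -> f x = r) ->
  Rint (fun x => f x * wavelet gamma v j x) = 0.
Proof.
move=> fr; transitivity (Rint (fun x => r * \1_(cyl gamma v) x * wavelet gamma v j x)).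
  apply: eq_Rintegral => x _; have [vx|nvx] := pselect (cyl gamma v x).
    by rewrite fr // indicE mem_set // mulr1.
  by rewrite wavelet_out // !mulr0.
rewrite (@wavelet_pair gamma v j _ (fun=> r)).
- by rewrite -mulr_sumr haar_sum mulr0 mul0r.
- by apply: piecewise_boundedZ; exact: piecewise_bounded_cyl.
- by move=> x vx; rewrite indicE mem_set // mulr1.
Qed.

(** The index [(gamma, None)] stands for the indicator of the piece of
    [gamma], and [(gamma, Some (v, j))] for a wavelet. *)
Definition windex : countType := ((word * word) * option (word * letter))%type.

Definition wfun (i : windex) : G -> R :=
  if i.2 is Some vj then wavelet i.1 vj.1 vj.2 else \1_(cyl i.1 [::]).

Lemma wfun_bounded i : piecewise_bounded i.1 (wfun i).
Proof.
by case: i => [ga [[v j]|]]; [exact: wavelet_bounded | exact: piecewise_bounded_cyl].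
Qed.

Lemma wfun_out i x : ~ piece i.1 x -> wfun i x = 0.
Proof.
case: i => [ga [[v j]|]] px; rewrite /wfun /=.
  by apply: wavelet_out => /cyl_piece.
by rewrite cyl_nil indicE memNset.
Qed.

(** Two wavelets at the same cylinder are orthogonal by [haar_orth].
    Otherwise, either their cylinders are disjoint, or the function on the
    larger cylinder is constant on the smaller one. *)
Lemma wfun_orth i i' : i != i' -> Rint (fun x => wfun i x * wfun i' x) = 0.
Proof.
have sym k k' : Rint (fun x => wfun k x * wfun k' x) = Rint (fun x => wfun k' x * wfun k x).
  by apply: eq_Rintegral => x _; rewrite mulrC.
move=> ii'; have [E|ga] := eqVneq i.1 i'.1; last first.
  rewrite -[RHS](_ : Rint (cst 0) = 0); last by rewrite Rintegral_cst // mul0r.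
  apply: eq_Rintegral => x _; have [px|px] := pselect (piece i.1 x); last by rewrite wfun_out ?mul0r.
  by rewrite (@wfun_out i') ?mulr0 // => px'; move: ga; rewrite -px -px' eqxx.
have const_wave ga o (v : word) (j : letter) : (ga, o) != (ga, Some (v, j)) :> windex ->
    (if o is Some vj then (size vj.1 <= size v)%N else true) ->
    Rint (fun x => wfun (ga, o) x * wavelet ga v j x) = 0.
  case: o => [[u k]|] /=; last first.
    move=> _ _; apply: (@wavelet_const ga v j _ 1) => x vx.
    by rewrite /wfun /= cyl_nil indicE mem_set //; exact: cyl_piece vx.
  have [-> kj _|uv _ le] := eqVneq u v.
    rewrite (@wavelet_pair ga v j _ (haar k)).
    - rewrite haar_orth ?mul0r //; apply: contra_neq kj => -> //.
    - exact: wavelet_bounded.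
    - by move=> x; exact: waveletE.
  have [E'|lt] := eqVneq (size u) (size v).
    apply: (@wavelet_const ga v j _ 0) => x vx; apply: wavelet_out => ux.
    by move/eqP: uv; apply; exact: cyl_eq ux vx E'.
  have {}lt : (size u < size v)%N by rewrite ltn_neqAle lt.
  have [ux|nux] := pselect (exists2 x, cyl ga v x & cyl ga u x); last first.
    apply: (@wavelet_const ga v j _ 0) => x vx; apply: wavelet_out => ux.
    by apply: nux; exists x.
  case: ux => x0 vx0 ux0.
  apply: (@wavelet_const ga v j _ (haar k (tail_letter x0 (size u)))) => x.
  rewrite (cyl_ball vx0) => /ball_atP[Ex Ux]; rewrite /wfun /= waveletE ?Ux //.
  rewrite (cyl_ball ux0); apply/ball_atP; split => // n nu; apply: Ux.
  exact: ltn_trans nu lt.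
case: i i' E ii' => [ga o] [ga' o'] /= <-.
case: o o' => [[v j]|] [[v' j']|] ii'.
- have [le|/ltnW le] := leqP (size v) (size v'); first exact: const_wave.
  by rewrite sym; apply: const_wave => //; rewrite eq_sym.
- by rewrite sym; apply: const_wave => //; rewrite eq_sym.
- exact: const_wave.
- by rewrite eqxx in ii'.
Qed.

Lemma mass_eq0 gamma k : cyl_mass gamma k = 0 -> ~ index_set gamma.
Proof.
rewrite /cyl_mass; case: asboolP => // _ /eqP.
by rewrite invr_eq0 gt_eqF // exprn_gt0 // N_gt0.
Qed.

Lemma wfun_sq_eq0 i : Rint (fun x => wfun i x * wfun i x) = 0 -> forall x, wfun i x = 0.
Proof.
have emp (ga : word * word) : ~ index_set ga -> forall x : G, ~ piece ga x.
  by move=> /piece_index -> x.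
case: i => [ga [[v j]|]] /=; last first.
  move=> i0 x; apply: wfun_out; apply: emp => /=; apply: (@mass_eq0 _ 0).
  rewrite -(Rint_cyl ga [::]) -i0; apply: eq_Rintegral => y _.
  by rewrite /wfun /= indicE; case: (_ \in _); rewrite ?mulr0 ?mulr1.
rewrite (@wavelet_pair ga v j _ (haar j)); last 2 first.
- exact: wavelet_bounded.
- by move=> x; exact: waveletE.
move/eqP; rewrite mulf_eq0 => /orP[|/eqP/mass_eq0/emp px x]; last exact: wfun_out.
rewrite psumr_eq0 => [/allP h x|a _]; last by rewrite -expr2 sqr_ge0.
have [vx|nvx] := pselect (cyl ga v x); last exact: wavelet_out.
rewrite /wfun /= waveletE //; apply/eqP.
by have := h (tail_letter x (size v)); rewrite mem_index_enum -expr2 sqrf_eq0 => /(_ isT).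
Qed.

Definition wave (n : nat) : G -> R :=
  if @pickle_inv windex n is Some i then wfun i else fun=> 0.

Definition wave_scale n : R := (Num.sqrt (Rint (fun x => wave n x * wave n x)))^-1.

(** The norm is 1, except at the numbers that encode no function and at the
    wavelets of the letter 0, where the function is null. *)
Definition haar_vector n : cfun G R := fun x => (wave_scale n * wave n x)%:C.

Definition wave_piece n : word * word :=
  if @pickle_inv windex n is Some i then i.1 else ([::], [::]).

Lemma wave_bounded n : piecewise_bounded (wave_piece n) (wave n).
Proof.
rewrite /wave_piece /wave; case: pickle_inv => [i|]; first exact: wfun_bounded.
by split; [exact: measurable_cst | exists 0 => x; rewrite normr0 mul0r].
Qed.

Lemma wave_orth m n : m != n -> Rint (fun x => wave m x * wave n x) = 0.
Proof.
have z f : Rint (fun x => 0 * f x) = 0.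
  under eq_Rintegral do rewrite mul0r.
  by rewrite Rintegral_cst // mul0r.
rewrite /wave; have := @pickle_invK windex m; have := @pickle_invK windex n.
case: (pickle_inv n) => [i /= <-|_]; last first.
  by case: (pickle_inv m) => [k|] _ _; under eq_Rintegral do rewrite mulrC; exact: z.
case: (pickle_inv m) => [k /= <-|_ _]; last exact: z.
by move=> ki; apply: wfun_orth; apply: contra_neq ki => ->.
Qed.

Lemma wave_sq_ge0 n : 0 <= Rint (fun x => wave n x * wave n x).
Proof. by apply: Rintegral_ge0 => x _; rewrite -expr2 sqr_ge0. Qed.

Lemma wave_sq_eq0 n : Rint (fun x => wave n x * wave n x) = 0 -> forall x, wave n x = 0.
Proof. by rewrite /wave; case: pickle_inv => [i|//]; exact: wfun_sq_eq0. Qed.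

Lemma haar_vector_L2 n : L2 muG (haar_vector n).
Proof.
apply: (piecewise_bounded_L2 (gamma := wave_piece n)).
exact/piecewise_boundedZ/wave_bounded.
Qed.

Lemma wave_span n : lin_span (range haar_vector) (fun x => (wave n x)%:C).
Proof.
have [s0|s0] := eqVneq (wave_scale n) 0.
  have w0 := wave_sq_eq0; move/eqP: s0; rewrite invr_eq0 sqrtr_eq0 => s0.
  have {}w0 : forall x, wave n x = 0.
    by apply: w0; apply/eqP; rewrite eq_le s0 wave_sq_ge0.
  rewrite (_ : (fun x => _) = fun=> 0); first exact: lin_span0.
  by apply/funext => x; rewrite w0.
have -> : (fun x => (wave n x)%:C) = (fun x => (wave_scale n)^-1%:C * haar_vector n x).
  by apply/funext => x; rewrite /haar_vector -rmorphM /= mulKf.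
by apply/lin_spanZ/lin_span_sub; exists n.
Qed.

Lemma wfun_span i : lin_span (range haar_vector) (fun x => (wfun i x)%:C).
Proof. by have := wave_span (pickle i); rewrite /wave pickleK_inv. Qed.

(** Downward summation recovers the indicators of the children from that of the
    parent and the wavelets at it. *)
Lemma cyl_span gamma v :
  lin_span (range haar_vector) (fun x => (\1_(cyl gamma v) x : R)%:C).
Proof.
elim/last_ind: v => [|v a IH]; first exact: (wfun_span (gamma, None)).
pose s (k : nat) (x : G) : R :=
  \sum_(c : letter) (letter_val c < k)%N%:R * \1_(cyl gamma (rcons v c)) x.
have sS (c : letter) x : s (letter_val c).+1 x = s (letter_val c) x + \1_(cyl gamma (rcons v c)) x.
  rewrite /s (bigD1 c) //= [X in _ = X + _](bigD1 c) //= ltnSn ltnn mul0r add0r mul1r addrC.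
  congr (_ + _); apply: eq_bigr => c' cc'; rewrite ltnS leq_eqVlt.
  by rewrite (inj_eq letter_val_inj) (negPf cc').
have ws (c : letter) x : wavelet gamma v c x =
    (letter_val c).+1%:R * s (letter_val c) x - (letter_val c)%:R * s (letter_val c).+1 x.
  have -> : wavelet gamma v c x =
      s (letter_val c) x - (letter_val c)%:R * \1_(cyl gamma (rcons v c)) x.
    rewrite /wavelet /s (bigD1 c) //= [in RHS](bigD1 c) //=.
    rewrite /haar ltnn eqxx mul0r add0r mulNr addrC; congr (_ - _).
    by apply: eq_bigr => c' /negPf cc'; rewrite cc'; case: ifP; rewrite ?mul1r ?mul0r.
  by rewrite sS -natr1; ring.
have span_s d : (d <= N)%N -> lin_span (range haar_vector) (fun x => (s (N - d)%N x)%:C).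
  elim: d => [_|d IHd dN].
    rewrite subn0 (_ : (fun x => _) = (fun x => (\1_(cyl gamma v) x : R)%:C)) //.
    apply/funext => x; congr (_%:C); rewrite (cyl_indic_split gamma v x).
    by apply: eq_bigr => c _; rewrite letter_val_lt mul1r.
  have lt : (N - d.+1 < N)%N by lia.
  pose c : letter := Ordinal lt.
  have cS : (letter_val c).+1 = (N - d)%N by rewrite /letter_val /=; lia.
  have -> : (fun x => (s (N - d.+1)%N x)%:C) = (fun x => (letter_val c).+1%:R^-1%:C *
      ((wavelet gamma v c x)%:C + (letter_val c)%:R%:C * (s (N - d)%N x)%:C)).
    apply/funext => x; rewrite -rmorphM -rmorphD -rmorphM; congr (_%:C).
    by rewrite ws -cS subrK mulKf.
  apply/lin_spanZ/lin_spanD; first exact: (wfun_span (gamma, Some (v, c))).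
  by apply/lin_spanZ/IHd; exact: ltnW.
have -> : (fun x => (\1_(cyl gamma (rcons v a)) x : R)%:C) =
    (fun x => (s (letter_val a).+1 x)%:C + -1 * (s (letter_val a) x)%:C).
  by apply/funext => x; rewrite sS mulN1r -rmorphB addrAC subrr add0r.
have la := letter_val_lt a; apply: lin_spanD.
  by rewrite -(subKn la); apply: span_s; exact: leq_subr.
by apply: lin_spanZ; rewrite -(subKn (ltnW la)); apply: span_s; exact: leq_subr.
Qed.

(** By the pi-lambda theorem, the integrals over all Borel subsets of a piece
    vanish, and countably many pieces cover the groupoid. *)
Lemma cyl_integrals_determine f : measurable_fun setT f ->
  (forall gamma v, muG.-integrable setT (fun x => (f x * \1_(cyl gamma v) x)%:E) /\
    Rint (fun x => f x * \1_(cyl gamma v) x) = 0) ->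
  {ae muG, forall x, f x = 0}.
Proof.
move=> mf f0; pose C : countType := (word * word)%type.
have on_piece gamma : {ae muG, forall x, piece gamma x -> f x = 0}.
  have [fi _] := f0 gamma [::]; rewrite cyl_nil in fi.
  have zT : (\int[muG]_x (f x * \1_(piece gamma) x)%:E = 0)%E.
    have [fj f1] := f0 gamma [::]; rewrite cyl_nil in fj f1.
    by rewrite -(fineK (integrable_fin_num measurableT fj)) [fine _]f1.
  have zero (A : set G) : measurable A ->
      (\int[muG]_(x in A) (f x * \1_(piece gamma) x)%:E = 0)%E.
    move=> mA; suff H : forall B : set G, <<s cylinder_family>> B ->
        (\int[muG]_(x in B) (f x * \1_(piece gamma) x)%:E = 0)%E.
      by apply: H; rewrite -borel_cylinder.
    apply: (dynkin_induction borel_cylinder) => //.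
    - exact: cylinder_family_setI.
    - move=> _ [->|[ga [v ->]]]; first by rewrite integral_set0.
      have mc := cyl_measurable ga v.
      rewrite integral_mkcond.
      have [->|ne] := eqVneq ga gamma.
        have [fj f1] := f0 gamma v.
        transitivity (\int[muG]_x (f x * \1_(cyl gamma v) x)%:E)%E.
          apply: eq_integral => x _; rewrite patchE !indicE.
          case: (boolP (x \in cyl gamma v)) => [|_]; last by rewrite mulr0.
          by move=> /set_mem/cyl_piece px; rewrite mem_set.
        by rewrite -(fineK (integrable_fin_num measurableT fj)) [fine _]f1.
      apply: integral0_eq => x _; rewrite patchE; case: (boolP (x \in _)) => // /set_mem vx.
      rewrite indicE memNset ?mulr0 // => px; move: ne.
      by rewrite -(cyl_ell vx) px eqxx.
    - move=> B mB B0.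
      have := @integral_setU _ _ _ muG B (~` B) (fun x => (f x * \1_(piece gamma) x)%:E) mB (measurableC mB).
      rewrite setUv B0 add0e zT => <- //; first exact: measurable_int fi.
      by apply/disj_set2P; rewrite setICr.
    - move=> F mF tF F0; rewrite integral_bigcup //.
        by apply: eseries0 => i _ _; exact: F0.
      by apply: integrableS fi => //; exact: bigcupT_measurable.
  have := integral_ae_eq measurableT fi (measurable_cst 0%E).
  move=> /(_ _)[|N0 [mN0 N00 sN]]; first by move=> E _ mE; rewrite zero // integral0.
  exists N0; split => // x /= nx; apply: sN => /= E; apply: nx => px.
  by have [] := E I; rewrite indicE mem_set // mulr1.
have : {ae muG, forall x, forall n, if @unpickle C n is Some ga then piece ga x -> f x = 0 else True}.
  apply: ae_foralln => n; case: unpickle => [ga|]; first exact: on_piece.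
  exact: aeW.
have FF : Filter (almost_everywhere muG) := ae_filter_ringOfSetsType muG.
by move=> H; apply: (filterS (F := almost_everywhere muG)) H => x /(_ (pickle (ell x : C))); rewrite pickleK; apply.
Qed.

(** A function orthogonal to the system is orthogonal to the indicators of
    cylinders, by [cyl_span]. *)
Theorem haar_total : total_system muG haar_vector.
Proof.
have e2 := haar_vector_L2.
have dotE m n : dot muG (haar_vector m) (haar_vector n) =
    (wave_scale m * wave_scale n * Rint (fun x => wave m x * wave n x))%:C.
  rewrite dot_real; congr (_%:C).
  rewrite -(Rint_scale _ (piecewise_bounded_mul (wave_bounded m) (wave_bounded n))).
  by apply: eq_Rintegral => x _; ring.
split => //.
- by move=> m n mn; rewrite dotE wave_orth // mulr0.
- move=> n; rewrite /nsq dotE /=; set q := Rint _.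
  have q0 : 0 <= q := wave_sq_ge0 n.
  rewrite /wave_scale -/q -expr2 exprVn sqr_sqrtr //.
  have [->|qn] := eqVneq q 0; first by left; rewrite mulr0.
  by right; rewrite mulVf.
move=> f f2 f0.
have mf : cmeasurable f by case: f2.
have key gamma v : cintegrable muG setT (fun x => f x * (\1_(cyl gamma v) x : R)%:C) /\
    cintegral muG setT (fun x => f x * (\1_(cyl gamma v) x : R)%:C) = 0.
  have c2 : L2 muG (fun x => (\1_(cyl gamma v) x : R)%:C).
    by apply: (piecewise_bounded_L2 (gamma := gamma)); exact: piecewise_bounded_cyl.
  have E : (fun x => f x * (\1_(cyl gamma v) x : R)%:C) =
      (fun x => f x * conjc (\1_(cyl gamma v) x : R)%:C).
    by apply/funext => x; rewrite conjc_real.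
  rewrite E; split; first exact: L2_cintble.
  rewrite -[LHS]/(dot muG f _) (dotC c2 f2).
  have [n [k [u [Su ->]]]] := cyl_span gamma v.
  have ue i : exists m, haar_vector m = u i by have [m _ <-] := Su i; exists m.
  have u2 i : L2 muG (u i) by have [m <-] := ue i.
  rewrite (@dot_suml _ _ _ _ _ _ (fun i x => k i * u i x)) //; last by move=> i; exact: L2Z.
  rewrite big1 ?conjc_0 // => i _; rewrite dotZl // (dotC f2) //.
  by have [m <-] := ue i; rewrite f0 conjc_0 mulr0.
have Re0 : {ae muG, forall x, complex.Re (f x) = 0}.
  apply: cyl_integrals_determine; first by case: mf.
  move=> ga v; have [[ri _] i0] := key ga v.
  have E : (fun x => complex.Re (f x) * \1_(cyl ga v) x) =
      (fun x => complex.Re (f x * (\1_(cyl ga v) x : R)%:C)).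
    by apply/funext => x; rewrite Re_mul /= mulr0 subr0.
  rewrite E; split.
    by move: ri; apply: eq_integrable => // x _; rewrite Re_mul /= mulr0 subr0.
  exact: (congr1 (@complex.Re R) i0).
have Im0 : {ae muG, forall x, complex.Im (f x) = 0}.
  apply: cyl_integrals_determine; first by case: mf.
  move=> ga v; have [[_ ri] i0] := key ga v.
  have E : (fun x => complex.Im (f x) * \1_(cyl ga v) x) =
      (fun x => complex.Im (f x * (\1_(cyl ga v) x : R)%:C)).
    by apply/funext => x; rewrite Im_mul /= mulr0 add0r.
  rewrite E; split.
    by move: ri; apply: eq_integrable => // x _; rewrite Im_mul /= mulr0 add0r.
  exact: (congr1 (@complex.Im R) i0).
by apply: filterS2 Re0 Im0 => x r i; exact: complex_eqP.
Qed.

(** The normalisation cancels, so the eigenvalue equation can be checked on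
    the functions [wave n]. *)
Lemma int_op_haar (k : G -> G -> R) (l : nat -> R) :
  (forall x, exists gamma, piecewise_bounded gamma (k x)) ->
  (forall x n, Rint (fun y => k x y * wave n y) = l n * wave n x) ->
  (forall n, l n ^+ 2 <= 1) -> int_op muG k = diag muG haar_vector l.
Proof.
move=> bk kl l1; apply: (int_op_diag haar_total _ _ l1) => [x|x n].
  by have [ga kx] := bk x; exact: piecewise_bounded_L2 kx.
have -> : (fun y => (k x y)%:C * haar_vector n y) =
    (fun y => (wave_scale n * (k x y * wave n y))%:C).
  by apply/funext => y; rewrite /haar_vector -rmorphM mulrCA.
have [ga kx] := bk x.
rewrite cint_real (Rint_scale _ (piecewise_bounded_mul kx (wave_bounded n))) kl.
by rewrite /haar_vector -rmorphM mulrCA.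
Qed.

End real_functions.

(** * Radial kernels *)

Implicit Types (F : G -> R) (rho : nat -> R).

(** The level [k] is the one on which the distance of [x] and [y] depends. *)
Lemma first_difference x y : ell y = ell x -> src y = src x \/
  exists k, ball_at x k y /\ tail_letter y k != tail_letter x k.
Proof.
move=> E; have [h|nh] := pselect (exists k, tail_letter y k != tail_letter x k).
  right; case: (ex_minnP h) => k dk mk; exists k; split => //.
  apply/ball_atP; split => // i ik; apply/eqP; apply: contraTT ik => /mk.
  by rewrite -leqNgt.
left; apply/funext => k; apply: (@ball_at_src _ _ x y k k.+1); last by lia.
apply/ball_atP; split => // i _; apply/eqP/negPn/negP => di.
by apply: nh; exists i.
Qed.

Lemma ball_at_difference x y k n : ball_at x k y -> tail_letter y k != tail_letter x k ->
  ball_at x n y <-> (n <= k)%N.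
Proof.
move=> bk dk; split=> [/ball_atP[_ H]|nk]; last exact: ball_at_mono bk.
by rewrite leqNgt; apply/negP => /H/eqP; rewrite (negPf dk).
Qed.

Lemma index_ell x : index_set (ell x).
Proof. by exists x. Qed.

Lemma mass_ell x k : cyl_mass (ell x) k = N%:R ^- (size (ell x).2 + k).
Proof. by rewrite /cyl_mass; case: asboolP => // /(_ (index_ell x)). Qed.

(** The value at [x] is left free: a single point has measure zero, and the
    kernel of the Laplacian is singular there. *)
Definition radial x rho F : Prop := (forall y, ell y <> ell x -> F y = 0) /\
  forall k y, ball_at x k y -> tail_letter y k != tail_letter x k -> F y = rho k.

Definition ball_integral x F k : R := Rint (fun y => F y * \1_(ball_at x k) y).

(** All the points of a cylinder that does not contain [x] first differ from
    [x] at the same level. *)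
Lemma radial_cyl x rho F v : radial x rho F -> ~ cyl (ell x) v x ->
  exists r, forall y, cyl (ell x) v y -> F y = r.
Proof.
move=> [_ Frho] nvx.
have h : exists k, (k < size v)%N && (tail_letter x k != nth point v k).
  apply: contrapT => nh; apply: nvx; apply/cylP; split => //.
  apply: (@eq_from_nth _ point); rewrite size_mkseq // => k kv; rewrite nth_mkseq //.
  by apply/eqP/negPn/negP => dk; apply: nh; exists k; rewrite kv.
case: (ex_minnP h) => k /andP[kv dk] mk; exists (rho k) => y vy.
have yv i : (i < size v)%N -> tail_letter y i = nth point v i.
  by move=> iv; rewrite (cyl_letter vy iv); exact: set_nth_default.
apply: Frho; last by rewrite yv // eq_sym.
apply/ball_atP; split => [|i ik]; first exact: cyl_ell vy.
rewrite yv; last exact: ltn_trans kv.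
apply/esym/eqP/negPn/negP => di; have := mk i; rewrite di andbT.
by move=> /(_ (ltn_trans ik kv)); rewrite leqNgt ik.
Qed.

Lemma sum_others (a : letter) (r : R) : \sum_(b | b != a) r = (N%:R - 1) * r.
Proof.
apply: (addrI r); rewrite -[X in X + _](big_pred1_eq +%R a (fun=> r)).
rewrite -[LHS](_ : \sum_(b : letter) r = _); last by rewrite (bigD1 a) //= big_pred1_eq.
rewrite big_const -[X in iter X _ _](_ : N = _) ?card_ord // iter_addr_0 -mulr_natl; ring.
Qed.

(** The ball of level [k] is the union of the ball of level [k.+1] and of [N -
    1] cylinders on which [F] is [rho k]. *)
Lemma ball_integralS x rho F k : radial x rho F -> piecewise_bounded (ell x) F ->
  ball_integral x F k = (N%:R - 1) * (rho k * cyl_mass (ell x) k.+1) + ball_integral x F k.+1.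
Proof.
move=> [_ Frho] bF; rewrite /ball_integral [in LHS]/ball_at.
rewrite (Rint_cyl_split) // (bigD1 (tail_letter x k)) //= addrC.
rewrite /ball_at mkseqS; congr (_ + _).
rewrite -(sum_others (tail_letter x k)); apply: eq_bigr => a ax.
rewrite (Rint_const_on_cyl (r := rho k)) ?size_rcons ?size_mkseq //.
move=> y /cyl_rcons[yk]; rewrite size_mkseq => ya.
by apply: Frho; rewrite ?ya.
Qed.

(** On the child that contains [x] the wavelet is constant, and on the other
    children the kernel is. The values of the wavelet on the latter add up to
    the opposite of its value on the former. *)
Lemma radial_wavelet x rho F v (j : letter) : radial x rho F -> piecewise_bounded (ell x) F ->
  Rint (fun y => F y * wavelet (ell x) v j y) = wavelet (ell x) v j x *
  (ball_integral x F (size v).+1 - rho (size v) * cyl_mass (ell x) (size v).+1).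
Proof.
move=> rF bF; have [vx|nvx] := pselect (cyl (ell x) v x); last first.
  rewrite (wavelet_out _ nvx) mul0r; have [r Fr] := radial_cyl rF nvx.
  exact: (wavelet_const _ Fr).
rewrite wavelet_Rint // waveletE //.
set a := tail_letter x (size v); rewrite (bigD1 a) //=.
have va : cyl (ell x) (rcons v a) x by apply/cyl_rcons.
rewrite (cyl_ball va) size_rcons -/(ball_integral _ _ _) mulrBr; congr (_ + _).
have -> : haar j a = - \sum_(b | b != a) haar j b.
  by apply/eqP; rewrite -addr_eq0 -[X in _ == X](haar_sum j) [X in _ == X](bigD1 a).
rewrite mulNr opprK mulr_suml; apply: eq_bigr => b ba; congr (_ * _).
rewrite (Rint_const_on_cyl (r := rho (size v))) ?size_rcons //.
move=> y /cyl_rcons[yv yb]; case: rF => _; apply; last by rewrite yb.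
by rewrite -(cyl_ball vx).
Qed.

(** The functions of the Haar system are eigenvectors of the radial kernels, since
    a wavelet integrates to zero on each annulus around a point outside its
    cylinder. *)
Lemma radial_wfun x rho F (i : windex) : radial x rho F -> piecewise_bounded (ell x) F ->
  Rint (fun y => F y * wfun i y) = wfun i x *
  (if i.2 is Some vj then
     ball_integral x F (size vj.1).+1 - rho (size vj.1) * cyl_mass (ell x) (size vj.1).+1
   else ball_integral x F 0).
Proof.
move=> rF bF; have [E|ne] := pselect (i.1 = ell x); last first.
  rewrite (@wfun_out i x) ?mul0r; last by move=> px; apply: ne; rewrite -px.
  rewrite -[RHS](_ : Rint (cst 0) = 0); last by rewrite Rintegral_cst // mul0r.
  apply: eq_Rintegral => y _; have [Ey|ney] := pselect (ell y = ell x).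
    by rewrite wfun_out ?mulr0 // => py; apply: ne; rewrite -py.
  by case: rF => -> //; rewrite mul0r.
case: i E => [ga [[v j]|]] /= ->; first exact: radial_wavelet.
rewrite /wfun /= /ball_integral /ball_at [X in _ = X * _]indicE mem_set ?mul1r //.
by rewrite cyl_nil.
Qed.

(** ** Distances *)

Variable lambda : R.
Hypothesis lambda_gt1 : 1 < lambda.

Let lambda_gt0 : 0 < lambda.
Proof. exact: lt_trans lambda_gt1. Qed.

Let ln_lambda : ln lambda != 0.
Proof. by rewrite gt_eqF // ln_gt0. Qed.

Lemma piece_dist_difference x y k (s : R) :
  ball_at x k y -> tail_letter y k != tail_letter x k ->
  piece_dist lambda x y `^ s = (lambda `^ (- s)) ^+ (size (ell x).2 + k).
Proof.
move=> bk dk; have E := cyl_ell bk.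
have -> : piece_dist lambda x y = lambda ^- (size (ell x).2 + k).
  rewrite /piece_dist /shift_dist; case: pselect => [h|[]]; last first.
    by exists (size (ell x).2 + k)%N; move: dk; rewrite /tail_letter E eq_sym.
  case: ex_minnP => n dn mn; congr (_ ^- _); apply/eqP; rewrite eqn_leq; apply/andP; split.
    by apply: mn; move: dk; rewrite /tail_letter E eq_sym.
  rewrite leqNgt; apply/negP => nk; move: dn.
  by rewrite (ball_at_src bk nk) eqxx.
rewrite -powR_mulrn ?(ltW lambda_gt0) // -powRN -powRrM mulNr mulrC -mulNr powRrM.
by rewrite powR_mulrn // powR_ge0.
Qed.

Lemma lambda_delta : lambda `^ delta N lambda = N%:R.
Proof.
rewrite /powR gt_eqF // /delta /log_base divfK // lnK // posrE; exact: N_gt0.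
Qed.

Lemma lambda_delta_delta' t : lambda `^ (- (- delta N lambda + delta' N lambda * t)) =
  N%:R * expR (- t * (1 - N%:R^-1)).
Proof.
rewrite opprD opprK /powR gt_eqF // mulrBl expRD /delta /delta' /log_base divfK //.
rewrite lnK ?posrE ?N_gt0 // expRK; congr (_ * expR _).
by set c := N%:R^-1; field.
Qed.

(** ** The Laplacian on the Haar system *)

Local Notation lkern x y := (pow_mdelta N lambda (groupoid_dist lambda x y)).

Lemma laplace_kernel_radial x :
  radial x (fun k => N%:R ^+ (size (ell x).2 + k)) (fun y => lkern x y).
Proof.
split=> [y /eqP ne|k y bk dk]; rewrite /groupoid_dist eq_sym.
  by rewrite (negPf ne).
by rewrite (cyl_ell bk) eqxx /= (piece_dist_difference _ bk dk) opprK lambda_delta.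
Qed.

(** The kernel of the Laplacian is not integrable near the diagonal. But if
    [f] is constant on the balls of level [n], then [f x - f y] vanishes near
    the diagonal, and the truncation of the kernel at that level suffices. *)
Definition truncated_kernel x n y : R := \sum_(k < n)
  N%:R ^+ (size (ell x).2 + k) * (\1_(ball_at x k) y - \1_(ball_at x k.+1) y).

Lemma truncated_bounded x n : piecewise_bounded (ell x) (truncated_kernel x n).
Proof.
apply: (@piecewise_bounded_sum _ _ _ (fun (k : 'I_n) y => N%:R ^+ (size (ell x).2 + k) *
  (\1_(ball_at x k) y - \1_(ball_at x k.+1) y))) => k.
apply/piecewise_boundedZ/piecewise_boundedD; first exact: piecewise_bounded_cyl.
under eq_fun do rewrite -mulN1r.
by apply: piecewise_boundedZ; exact: piecewise_bounded_cyl.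
Qed.

Lemma truncated_ball x n y : ball_at x n y -> truncated_kernel x n y = 0.
Proof.
move=> bn; rewrite /truncated_kernel big1 // => k _.
rewrite !indicE !mem_set ?subrr ?mulr0 //; apply: ball_at_mono bn => //; exact: ltnW.
Qed.

Lemma truncated_radial x n :
  radial x (fun k => if (k < n)%N then N%:R ^+ (size (ell x).2 + k) else 0)
    (truncated_kernel x n).
Proof.
split=> [y ne|k y bk dk].
  rewrite /truncated_kernel big1 // => k _.
  by rewrite !indicE !memNset ?subrr ?mulr0 // => /cyl_ell.
have dE i : \1_(ball_at x i) y - \1_(ball_at x i.+1) y = (i == k)%:R :> R.
  rewrite !indicE.
  have mE (j : nat) : (y \in ball_at x j) = (j <= k)%N.
    by apply/idP/idP => [/set_mem/(ball_at_difference _ bk dk)//|/(ball_at_difference _ bk dk) jk]; apply: mem_set.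
  by rewrite !mE; case: (ltngtP i k) => _; rewrite ?subrr ?subr0.
rewrite /truncated_kernel; under eq_bigr do rewrite dE.
case: ifP => kn.
  rewrite (bigD1 (Ordinal kn)) //= eqxx mulr1 big1 ?addr0 // => i ik.
  by rewrite (_ : _ == k = false) ?mulr0 //; apply/negP => /eqP E; case/eqP: ik; exact: val_inj.
rewrite big1 // => i _; rewrite (_ : _ == k = false) ?mulr0 //.
by apply/negP => /eqP E; move: (ltn_ord i); rewrite E kn.
Qed.

Definition wlevel (i : windex) : nat := if i.2 is Some vj then (size vj.1).+1 else 0.

Lemma wfun_ball i x y : ball_at x (wlevel i) y -> wfun i y = wfun i x.
Proof.
case: i => [ga [[v j]|]]; rewrite /wfun /wlevel /= => /ball_atP[E T].
  have [vx|nvx] := pselect (cyl ga v x).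
    rewrite !waveletE ?T //; move: vx => /cylP[Ex vE]; apply/cylP; rewrite E.
    by split => //; rewrite -[RHS]vE; apply: eq_mkseq_lt => k kv; rewrite T // ltnS ltnW.
  rewrite !wavelet_out // => /cylP[Ey vE]; apply: nvx; apply/cylP; rewrite -E; split => //.
  by rewrite -[RHS]vE; apply: eq_mkseq_lt => k kv; rewrite T // ltnS ltnW.
rewrite cyl_nil !indicE; have [px|px] := pselect (piece ga x).
  by rewrite !mem_set // /piece /= E.
by rewrite !memNset // /piece /= E.
Qed.

Lemma laplace_truncated i x y : (wfun i x - wfun i y) * lkern x y =
  (wfun i x - wfun i y) * truncated_kernel x (wlevel i) y.
Proof.
have [E|ne] := pselect (ell y = ell x); last first.
  by rewrite (proj1 (laplace_kernel_radial x)) // (proj1 (truncated_radial x _)).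
have [sE|[k [bk dk]]] := first_difference E.
  rewrite (@wfun_ball i x y) ?subrr ?mul0r //; apply/ball_atP; split => // k _.
  by rewrite /tail_letter E sE.
have [lt|le] := ltnP k (wlevel i).
  by rewrite (proj2 (laplace_kernel_radial x) _ _ bk dk)
    (proj2 (truncated_radial x _) _ _ bk dk) lt.
by rewrite (@wfun_ball i x y) ?subrr ?mul0r //; exact: ball_at_mono bk.
Qed.

(** Every annulus contributes [1 - 1/N], because the kernel is there the
    inverse of the measure of the ball that the annulus bounds. *)
Lemma truncated_integral x n k : (k <= n)%N ->
  ball_integral x (truncated_kernel x n) k = (n - k)%:R * (1 - N%:R^-1).
Proof.
move=> kn; rewrite -{1}(subKn kn); elim: (n - k)%N (leq_subr k n) => [_|d IH dn].
  rewrite subn0 mul0r /ball_integral.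
  rewrite -[RHS](_ : Rint (cst 0) = 0); last by rewrite Rintegral_cst // mul0r.
  apply: eq_Rintegral => y _; have [by_|nb] := pselect (ball_at x n y).
    by rewrite truncated_ball // mul0r.
  by rewrite indicE memNset // mulr0.
rewrite (ball_integralS _ (truncated_radial x n) (truncated_bounded x n)).
rewrite ifT; last by lia.
rewrite (_ : (n - d.+1).+1 = n - d)%N; last by lia.
rewrite IH; last exact: ltnW.
rewrite mass_ell (_ : d.+1%:R * _ = d%:R * (1 - N%:R^-1) + (1 - N%:R^-1)); last first.
  by rewrite -natr1 mulrDl mul1r.
rewrite addrC; congr (_ + _).
rewrite (_ : (n - d = (n - d.+1).+1)%N); last by lia.
by rewrite addnS exprS; field; rewrite expf_neq0 ?andbT // gt_eqF // N_gt0.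
Qed.

Definition laplace_eigenvalue (i : windex) : R :=
  if i.2 is Some vj then 1 + (size vj.1)%:R * (1 - N%:R^-1) else 0.

(** The integral of the truncated kernel is [(|v| + 1) (1 - 1/N)] on a wavelet
    at [v], and the annulus at the level of the wavelet itself adds [1/N]. *)
Lemma laplace_wfun i x :
  piecewise_bounded (ell x) (fun y => (wfun i x - wfun i y) * lkern x y) /\
  Rint (fun y => (wfun i x - wfun i y) * lkern x y) =
    laplace_eigenvalue i * wfun i x.
Proof.
have bT := truncated_bounded x (wlevel i).
have bW : piecewise_bounded (ell x) (fun y => wfun i y * truncated_kernel x (wlevel i) y).
  by under eq_fun do rewrite mulrC; exact: piecewise_bounded_mul (wfun_bounded i).
have E : (fun y => (wfun i x - wfun i y) * lkern x y) =
    (fun y => wfun i x * truncated_kernel x (wlevel i) y +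
      - 1 * (wfun i y * truncated_kernel x (wlevel i) y)).
  by apply/funext => y; rewrite laplace_truncated mulrBl mulN1r.
rewrite E; split; first by apply: piecewise_boundedD; exact: piecewise_boundedZ.
have I F := @piecewise_bounded_integrable (ell x) F.
rewrite RintegralD //; last 2 first.
- exact/I/piecewise_boundedZ.
- exact/I/piecewise_boundedZ.
rewrite !(Rint_scale (gamma := ell x)) // mulN1r.
rewrite -[Rint (truncated_kernel _ _)](_ : ball_integral x (truncated_kernel x (wlevel i)) 0 = _); last first.
  rewrite (Rint_piece bT); apply: eq_Rintegral => y _.
  by rewrite /ball_at.
under [X in _ - X]eq_Rintegral do rewrite mulrC.
rewrite (radial_wfun i (truncated_radial x _)) // truncated_integral // subn0.
rewrite -mulrBr mulrC; congr (_ * _).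
case: i {bT bW E} => [ga [[v j]|]]; rewrite /wlevel /laplace_eigenvalue /=; last first.
  by rewrite subrr.
rewrite truncated_integral // subnn mul0r sub0r opprK ltnSn mass_ell addnS exprS -natr1.
by field; rewrite expf_neq0 ?andbT // gt_eqF // N_gt0.
Qed.

(** * The Laplacian is diagonal *)

Local Notation cfun := (cfun G R).
Implicit Types u f g : cfun.
Local Notation shift := (full_shift N2).
Local Notation e := haar_vector.
Let total := haar_total.

Definition wave_laplace n : R :=
  if @pickle_inv windex n is Some i then laplace_eigenvalue i else 0.

(** The integrability accompanies the value so that both are inherited by
    finite combinations. *)
Definition laplace_image u g : Prop := forall x,
  cintegrable muG setT (fun y => (u x - u y) * (lkern x y)%:C) /\
  cintegral muG setT (fun y => (u x - u y) * (lkern x y)%:C) = g x.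

Lemma laplace_image0 : laplace_image (fun=> 0) (fun=> 0).
Proof.
move=> x; have -> : (fun y : G => (0 - 0) * (lkern x y)%:C) = fun=> 0.
  by apply/funext => y; rewrite subrr mul0r.
by rewrite cint0; split=> //; split; exact: integrable0.
Qed.

Lemma laplace_imageD (c : R[i]) u g u' g' :
  laplace_image u g -> laplace_image u' g' ->
  laplace_image (fun x => c * u x + u' x) (fun x => c * g x + g' x).
Proof.
move=> ug ug' x; have [i E] := ug x; have [i' E'] := ug' x.
have -> : (fun y => (c * u x + u' x - (c * u y + u' y)) * (lkern x y)%:C) =
    (fun y => c * ((u x - u y) * (lkern x y)%:C) + (u' x - u' y) * (lkern x y)%:C).
  by apply/funext => y; ring.
have ci := cintbleZ c i; split; first exact: cintbleD.
by rewrite cintD // cintZ // E E'.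
Qed.

Lemma laplace_image_sum n (c : 'I_n -> R[i]) (u g : 'I_n -> cfun) :
  (forall i, laplace_image (u i) (g i)) ->
  laplace_image (fun x => \sum_i c i * u i x) (fun x => \sum_i c i * g i x).
Proof.
elim: n c u g => [|n IH] c u g ug.
  have E (w : 'I_0 -> cfun) : (fun x => \sum_i c i * w i x) = fun=> 0.
    by apply/funext => x; rewrite big_ord0.
  by rewrite !E; exact: laplace_image0.
have E (w : 'I_n.+1 -> cfun) : (fun x => \sum_i c i * w i x) =
    (fun x => c ord0 * w ord0 x + \sum_(i < n) c (lift ord0 i) * w (lift ord0 i) x).
  by apply/funext => x; rewrite big_ord_recl.
rewrite !E; apply: laplace_imageD => //.
exact: (IH (fun i => c (lift ord0 i)) (fun i => u (lift ord0 i)) (fun i => g (lift ord0 i))).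
Qed.

Lemma laplace_haar n : laplace_image (e n) (fun x => (wave_laplace n)%:C * e n x).
Proof.
move=> x; have [bw Ew] : piecewise_bounded (ell x) (fun y => (wave n x - wave n y) * lkern x y) /\
    Rint (fun y => (wave n x - wave n y) * lkern x y) =
    wave_laplace n * wave n x.
  rewrite /wave /wave_laplace; case: pickle_inv => [i|]; first exact: laplace_wfun.
  have -> : (fun y => ((0 : R) - 0) * lkern x y) = fun=> 0.
    by apply/funext => y; rewrite subrr mul0r.
  split; last by rewrite Rintegral_cst // !mul0r.
  by split; [exact: measurable_cst | exists 0 => y; rewrite normr0 mul0r].
have -> : (fun y => (e n x - e n y) * (lkern x y)%:C) =
    (fun y => (wave_scale n * ((wave n x - wave n y) * lkern x y))%:C).
  by apply/funext => y; rewrite /haar_vector -rmorphB -rmorphM; congr (_%:C); ring.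
have bs := piecewise_boundedZ (wave_scale n) bw.
split; last first.
  rewrite cint_real (Rint_scale _ bw) Ew /haar_vector -rmorphM.
  by congr (_%:C); ring.
split; first exact: (piecewise_bounded_integrable bs).
exact: integrable0.
Qed.

(** ** The core consists of the finite combinations of the Haar system *)

Lemma locally_constantP u : (forall x, \forall y \near (x : groupoid N2), u y = u x) <->
  forall x, exists n, forall y, ball_at x n y -> u y = u x.
Proof.
split=> H x; first by have [n Hn] := nbhs_ball_at (H x); exists n.
by have [n Hn] := H x; apply: filterS (ball_at_nbhs x n).
Qed.

Definition spans_on u gamma v : Prop :=
  lin_span (range e) (fun x => u x * (\1_(cyl gamma v) x : R)%:C).

Lemma spans_on_const u gamma v (r : R[i]) :
  (forall x, cyl gamma v x -> u x = r) -> spans_on u gamma v.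
Proof.
move=> ur; rewrite /spans_on.
rewrite (_ : (fun x => _) = (fun x => r * (\1_(cyl gamma v) x : R)%:C)).
  by apply/lin_spanZ/(cyl_span).
apply/funext => x; have [vx|nvx] := pselect (cyl gamma v x); first by rewrite ur.
by rewrite indicE memNset // !mulr0.
Qed.

Lemma spans_on_children u gamma v :
  (forall a, spans_on u gamma (rcons v a)) -> spans_on u gamma v.
Proof.
move=> H; rewrite /spans_on.
rewrite (_ : (fun x => _) = (fun x => \sum_(a : letter) u x * (\1_(cyl gamma (rcons v a)) x : R)%:C)).
  exact: (@lin_span_sum _ _ _ _ _ _ (fun a x => u x * (\1_(cyl gamma (rcons v a)) x : R)%:C)).
by apply/funext => x; rewrite cyl_indic_split rmorph_sum mulr_sumr.
Qed.

(** Otherwise a nested sequence of cylinders on which this fails shrinks to a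
    point, around which the function is constant. *)
Lemma locally_constant_span u gamma :
  (forall x, exists n, forall y, ball_at x n y -> u y = u x) -> spans_on u gamma [::].
Proof.
move=> lu; apply: contrapT => n0.
have /choice[f fP] : forall v, exists a, ~ spans_on u gamma v -> ~ spans_on u gamma (rcons v a).
  move=> v; have [all|/existsNP[a na]] := pselect (forall a, spans_on u gamma (rcons v a)).
    by exists point => nv; case: nv; exact: spans_on_children.
  by exists a.
have [ig|nig] := pselect (index_set gamma); last first.
  by apply: n0; apply: (@spans_on_const _ _ _ 0) => x; rewrite cyl_nil piece_index.
pose b := fix b n := if n is k.+1 then rcons (b k) (f (b k)) else [::].
have nb n : ~ spans_on u gamma (b n) by elim: n => [|n IH] //=; exact: fP.
pose y : shift := fun k => if (k < size gamma.2)%N then nth point gamma.2 k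
  else f (b (k - size gamma.2)%N).
have [|z [Ez sz]] := piece_surj (y := y) ig.
  apply: (@eq_from_nth _ point); rewrite size_mkseq // => k kn.
  by rewrite nth_mkseq // /y kn.
have bz n : mkseq (tail_letter z) n = b n.
  elim: n => [//|n IH]; rewrite mkseqS IH /= {1}/tail_letter sz Ez /y.
  by rewrite ltnNge leq_addr addKn.
have [n zn] := lu z; apply: (nb n); apply: (@spans_on_const _ _ _ (u z)) => x.
by rewrite -bz -Ez; exact: zn.
Qed.

(** A compact set meets finitely many pieces. *)
Lemma Cc_infty_span u : Cc_infty u -> lin_span (range e) u.
Proof.
move=> [/locally_constantP lu]; rewrite compact_cover.
move=> /(_ (word * word)%type setT (fun gamma => piece gamma)).
case=> [gamma _|x _|D _ Dcov].
- by rewrite -cyl_nil; exact: cyl_open.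
- by exists (ell x).
have -> : u = (fun x => \sum_(gamma <- finmap.enum_fset D) u x * (\1_(cyl gamma [::]) x : R)%:C).
  apply/funext => x; have [u0|u0] := eqVneq (u x) 0.
    by rewrite u0 big1 // => ga _; rewrite mul0r.
  have [|ga gD gx] := Dcov x; first exact: subset_closure.
  rewrite (bigD1_seq ga gD (finmap.fset_uniq D)) /=.
  rewrite cyl_nil indicE mem_set // mulr1 big1 ?addr0 // => ga' gg.
  rewrite cyl_nil indicE memNset ?mulr0 // => gx'; move: gg.
  by rewrite -gx -gx' eqxx.
apply: (@lin_span_sum _ _ _ _ _ _ (fun ga x => u x * (\1_(cyl ga [::]) x : R)%:C)) => ga.
exact: locally_constant_span.
Qed.

Lemma wave_ball n x : exists k, forall y, ball_at x k y -> wave n y = wave n x.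
Proof.
rewrite /wave; case: pickle_inv => [i|]; last by exists 0%N.
by exists (wlevel i) => y; exact: wfun_ball.
Qed.

Lemma wave_out n x : ~ piece (wave_piece n) x -> wave n x = 0.
Proof.
by rewrite /wave /wave_piece; case: pickle_inv => [i|//]; exact: wfun_out.
Qed.

(** The system consists of locally constant functions on compact pieces. *)
Lemma psum_Cc_infty c n : Cc_infty (psum e c n).
Proof.
split.
  apply/locally_constantP; elim: n => [|n IH] x.
    by exists 0%N => y _; rewrite /psum !big_ord0.
  have [k Hk] := wave_ball n x; have [k' Hk'] := IH x.
  exists (maxn k k') => y xy; rewrite psumS /haar_vector (Hk y) ?(Hk' y) //.
    by apply: ball_at_mono xy; exact: leq_maxr.
  by apply: ball_at_mono xy; exact: leq_maxl.
suff [K [cK clK sK]] : exists K : set (groupoid N2),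
    [/\ compact K, closed K & [set x | psum e c n x != 0] `<=` K].
  apply: (@subclosed_compact _ _ K) => //; first exact: closed_closure.
  by move=> x /(closureS sK) xK; exact: clK.
elim: n => [|n [K [cK clK sK]]].
  exists set0; split; [exact: compact0 | exact: closed0 | move=> x /=].
  by rewrite /psum big_ord0 eqxx.
exists (K `|` piece (wave_piece n)); split.
- by apply: compactU => //; exact: piece_compact.
- by apply: closedU => //; rewrite -cyl_nil; exact: cyl_closed.
move=> x /=; rewrite psumS => nx; apply: contrapT => /not_orP[nK np].
have := contra_not (@sK x) nK => /= /negP; rewrite negbK => /eqP p0.
by move: nx; rewrite p0 /haar_vector wave_out // !mulr0 addr0 eqxx.
Qed.

Lemma diag_sum n (l : nat -> R) (c : 'I_n -> R[i]) (k : 'I_n -> nat) :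
  diag muG e l (fun x => \sum_i c i * e (k i) x,
                fun x => \sum_i c i * ((l (k i))%:C * e (k i) x)).
Proof.
have e2 := system_L2 total.
have L2s (F : 'I_n -> cfun) : (forall i, L2 muG (F i)) -> L2 muG (fun x => \sum_i F i x).
  by move=> F2; exact: L2_sum.
split.
- by apply: (L2s (fun i x => c i * e (k i) x)) => i; exact: L2Z.
- by apply: (L2s (fun i x => c i * ((l (k i))%:C * e (k i) x))) => i; exact/L2Z/L2Z.
move=> j; rewrite /= /coef.
rewrite (@dot_suml _ _ _ _ _ _ (fun i x => c i * ((l (k i))%:C * e (k i) x))) //; last by move=> i; exact/L2Z/L2Z.
rewrite (@dot_suml _ _ _ _ _ _ (fun i x => c i * e (k i) x)) //; last by move=> i; exact/L2Z.
rewrite mulr_sumr; apply: eq_bigr => i _; rewrite !dotZl //; last exact: L2Z.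
have [->|kj] := eqVneq (k i) j; first by rewrite mulrCA.
by rewrite (system_orth total kj) !mulr0.
Qed.

Lemma laplace_diag : laplace lambda muG = diag muG e wave_laplace.
Proof.
apply: (op_closure_diag total) => [[f g] /= [/Cc_infty_span]|c n].
  move=> [n [c [u [ue /= fE]]]] /= gE.
  have /choice[k kE] : forall i, exists m, e m = u i by move=> i; have [m _ <-] := ue i; exists m.
  have := diag_sum wave_laplace c k.
  rewrite (_ : (fun x => _) = f); last first.
    by rewrite fE; apply/funext => x; apply: eq_bigr => i _; rewrite kE.
  rewrite (_ : (fun x => _) = g) //.
  have H := laplace_image_sum c (fun i => laplace_haar (k i)).
  rewrite gE; apply/funext => x; have [_ <-] := H x; rewrite fE.
  by congr cintegral; apply/funext => y; congr ((_ - _) * _); apply: eq_bigr => i _; rewrite kE.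
split; first exact: psum_Cc_infty.
have H := laplace_image_sum (fun i : 'I_n => c i) (fun i => laplace_haar i).
apply/funext => x; have [_ /= ->] := H x; rewrite /psum.
by apply: eq_bigr => i _; rewrite mulrCA mulrA.
Qed.

(** * The Dirac operator is diagonal *)

Definition wave_size n : R := (word_size (wave_piece n))%:R.

Lemma wave_laplace_ge0 n : 0 <= wave_laplace n.
Proof.
rewrite /wave_laplace; case: pickle_inv => [[ga [[v j]|]]|] //=.
rewrite addr_ge0 // mulr_ge0 // subr_ge0 invf_le1 ?N_gt0 // ler1n.
exact: ltnW.
Qed.

Lemma ell_measurable gamma : measurable ((@ell N N2 : G -> (word * word)%type) @^-1` [set gamma]).
Proof. exact: piece_measurable. Qed.

Lemma length_diag : length_op muG = diag muG e wave_size.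
Proof.
apply: (op_mult_diag total) => [|x|n|n x].
- exact: (measurable_fun_countable (C := (word * word)%type) (fun c => (word_size c)%:R) ell_measurable).
- by rewrite ler0n.
- by rewrite /wave_size ler0n.
- have [px|px] := pselect (piece (wave_piece n) x); first by rewrite /wave_size -px.
  by rewrite /haar_vector wave_out // !mulr0.
Qed.

Definition const_index (Gamma : set (word * word)) n : bool :=
  if @pickle_inv windex n is Some (gamma, None) then `[< Gamma gamma >] else false.

(** The indicators of the pieces are, up to normalisation, members of the
    system. *)
Lemma indicator_proj_diag (Gamma : set (word * word)) :
  ortho_proj muG (closed_span muG
    [set cindic R (piece gamma : set G) | gamma in Gamma]) =
  diag muG e (fun n => (const_index Gamma n)%:R).
Proof.
have cE gamma : cindic R (piece gamma : set G) =
    (fun x => (wave (pickle ((gamma, None) : windex)) x)%:C).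
  by apply/funext => x; rewrite /wave pickleK_inv /wfun /= cyl_nil.
apply: (ortho_proj_diag total) => [_ [gamma _ <-]|_ n [gamma gG <-]|n].
- rewrite cE; apply: piecewise_bounded_L2.
  exact: wave_bounded.
- rewrite cE => np; rewrite /coef dot_real.
  have [E|ne] := eqVneq (pickle ((gamma, None) : windex)) n.
    by move: np; rewrite -E /const_index pickleK_inv; case: asboolP.
  rewrite (_ : Rintegral _ _ _ = 0) //.
  transitivity (Rint (fun x => wave_scale n *
      (wave (pickle ((gamma, None) : windex)) x * wave n x))).
    by apply: eq_Rintegral => x _; rewrite mulrCA.
  rewrite (Rint_scale _ (piecewise_bounded_mul (wave_bounded _) (wave_bounded n))).
  by rewrite wave_orth ?mulr0.
- rewrite /const_index; case E : pickle_inv => [[gamma [//|]]|//] /asboolP gG.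
  have nE : pickle ((gamma, None) : windex) = n.
    by have := @pickle_invK windex n; rewrite E.
  rewrite (_ : e n = (fun x => (wave_scale n)%:C * cindic R (piece gamma : set G) x)).
    by apply/lin_spanZ/lin_span_sub; exists gamma.
  by apply/funext => x; rewrite cE nE /haar_vector rmorphM.
Qed.

Definition dirac_sign n : R := 2 *
  (const_index [set gamma | index_set gamma /\ size gamma.2 = 1%N] n)%:R + -1.

Lemma dirac_sign_sq n : dirac_sign n ^+ 2 = 1.
Proof. by rewrite /dirac_sign; case: (const_index _ n) => /=; ring. Qed.

(** In both sums the first summand is dominated by the sum: [2 P - 1] is a
    sign, and the eigenvalues of the Laplacian and of the length are
    nonnegative. *)
Lemma dirac_diag : Defs.dirac lambda muG =
  diag muG e (fun n => dirac_sign n * (wave_laplace n + wave_size n)).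
Proof.
rewrite /Defs.dirac /proj_P indicator_proj_diag laplace_diag.
rewrite length_diag (op_id_diag total).
rewrite (_ : (2 : R[i]) = (2 : R)%:C); last by rewrite rmorph_nat.
rewrite (_ : (-1 : R[i]) = (-1 : R)%:C); last by rewrite rmorphN1.
rewrite !(op_scale_diag total) ?oppr_eq0 ?oner_eq0 //.
rewrite (op_add_diag total (M := 4)); last first.
  by move=> n; case: (const_index _ n) => /=; lra.
rewrite (op_add_diag total (M := 1)); last first.
  move=> n; rewrite mul1r ler_sqr ?nnegrE ?addr_ge0 ?wave_laplace_ge0 ?ler0n //.
  by rewrite lerDl ler0n.
rewrite (op_comp_diag total) => [|n]; last by rewrite mulr1; exact: dirac_sign_sq.
by apply: eq_diag => // n _; rewrite mulr1.
Qed.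

Definition heat_eigenvalue t n : R := expR (- t * (wave_laplace n + wave_size n)).

(** The sign of [2 P - 1] disappears in the absolute value. *)
Lemma heat_diag t : heat lambda muG t = diag muG e (heat_eigenvalue t).
Proof.
rewrite /heat /abs_dirac dirac_diag (fun_calc_diag total); last exact: normr_measurable.
rewrite (fun_calc_diag total); last first.
  by apply: measurableT_comp => //; exact: mulrl_measurable.
apply: eq_diag => // n _; rewrite /= /heat_eigenvalue normrM.
have -> : `|dirac_sign n| = 1.
  by apply/eqP; rewrite -(@eqrXn2 _ 2) // ?real_normK ?dirac_sign_sq ?expr1n ?num_real.
by rewrite mul1r ger0_norm // addr_ge0 ?wave_laplace_ge0 // ler0n.
Qed.

(** * The heat kernel *)

Variable t : R.
Hypothesis t_gt : ln N%:R * (1 - N%:R^-1)^-1 < t.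
Local Notation K := (heat_kernel lambda t).
Local Notation h gamma := (@heat_h R N N2 gamma t).
Local Notation H gamma := (@heat_H R N N2 gamma t).

(** The quotient of the eigenvalues of the heat operator at two consecutive
    levels of wavelets. *)
Definition decay : R := expR (- t * (1 - N%:R^-1)).
Definition kernel_power x y : R :=
  piece_dist lambda x y `^ (- delta N lambda + delta' N lambda * t).

Let c_gt0 : 0 < 1 - N%:R^-1 :> R.
Proof. by rewrite subr_gt0 invf_lt1 ?N_gt0 // ltr1n. Qed.

Let N_neq0 : N%:R != 0 :> R.
Proof. by rewrite gt_eqF // N_gt0. Qed.

Lemma lnN_lt : ln N%:R < t * (1 - N%:R^-1).
Proof. by rewrite -ltr_pdivrMr. Qed.

Lemma t_gt0 : 0 < t.
Proof.
apply: le_lt_trans t_gt; rewrite mulr_ge0 // ?invr_ge0 ?(ltW c_gt0) // ln_ge0 //.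
by rewrite ler1n ltnW.
Qed.

Lemma decay_gt0 : 0 < decay.
Proof. exact: expR_gt0. Qed.

(** This is where the condition on [t] enters: the power of the distance in
    the kernel takes the values [(N * decay) ^ k]. *)
Lemma growth_lt1 : N%:R * decay < 1.
Proof.
rewrite -{1}(@lnK R N%:R) ?posrE ?N_gt0 // /decay -expRD expR_lt1.
by rewrite mulNr subr_lt0 lnN_lt.
Qed.

Lemma decay_lt : decay < N%:R^-1.
Proof. by rewrite -[ltRHS]mul1r ltr_pdivlMr ?N_gt0 // mulrC growth_lt1. Qed.

Lemma expNt_lt : expR (- t) < N%:R^-1.
Proof.
apply: le_lt_trans decay_lt.
by rewrite ler_expR mulNr lerN2 ler_piMr ?(ltW t_gt0) // gerBl invr_ge0 ler0n.
Qed.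

Lemma N_expNt_lt1 : N%:R * expR (- t) < 1.
Proof. by rewrite mulrC -ltr_pdivlMr ?N_gt0 // mul1r expNt_lt. Qed.

Lemma invN_lt1 : N%:R^-1 < 1 :> R.
Proof. by rewrite invf_lt1 ?N_gt0 // ltr1n. Qed.

Lemma power_difference x y k : ball_at x k y -> tail_letter y k != tail_letter x k ->
  kernel_power x y = (N%:R * decay) ^+ (size (ell x).2 + k).
Proof.
by move=> bk dk; rewrite /kernel_power (piece_dist_difference _ bk dk)
  lambda_delta_delta'.
Qed.

(** The power of 0 is 0 because the exponent is not 0: the corresponding power
    of [lambda] is [N * decay], which is less than 1. *)
Lemma power_src x y : src y = src x -> kernel_power x y = 0.
Proof.
move=> E; rewrite /kernel_power /piece_dist E /shift_dist.
case: pselect => [ex|_]; first by exfalso; have [k] := ex; rewrite eqxx.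
rewrite powR0 //; apply/eqP => s0.
have := lambda_delta_delta' t; rewrite s0 oppr0 powRr0 => E1.
by have := growth_lt1; rewrite -E1 ltxx.
Qed.

Lemma power_ge0 x y : 0 <= kernel_power x y.
Proof. exact: powR_ge0. Qed.

Lemma power_le x y n : ball_at x n y -> kernel_power x y <= (N%:R * decay) ^+ n.
Proof.
have g0 : 0 <= N%:R * decay by rewrite mulr_ge0 ?ler0n // ltW // decay_gt0.
move=> xy; have [E|[k [bk dk]]] := first_difference (cyl_ell xy).
  by rewrite power_src // exprn_ge0.
rewrite (power_difference bk dk); apply: ler_wiXn2l => //; first exact: ltW growth_lt1.
by rewrite (leq_trans _ (leq_addl _ _)) //; apply/(ball_at_difference _ bk dk).
Qed.

Lemma heat_kernelE x y : ell y = ell x -> K x y =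
  expR (- t * (word_size (ell x))%:R) * (h (ell x) + H (ell x) * kernel_power x y).
Proof. by move=> E; rewrite /heat_kernel E eqxx. Qed.

Lemma heat_kernel_out x y : ell y <> ell x -> K x y = 0.
Proof. by move/eqP => E; rewrite /heat_kernel (negPf E). Qed.

Lemma heat_radial x : radial x (fun k => expR (- t * (word_size (ell x))%:R) *
  (h (ell x) + H (ell x) * (N%:R * decay) ^+ (size (ell x).2 + k))) (K x).
Proof.
split=> [y|k y bk dk]; first exact: heat_kernel_out.
by rewrite heat_kernelE ?(cyl_ell bk) // (power_difference bk dk).
Qed.

Definition heat_bound gamma : R :=
  expR (- t * (word_size gamma)%:R) * (`|h gamma| + `|H gamma|).

Lemma heat_bound_ge0 gamma : 0 <= heat_bound gamma.
Proof. by rewrite mulr_ge0 ?expR_ge0 // addr_ge0. Qed.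

Lemma heat_kernel_le x y : `|K x y| <= heat_bound (ell x) * \1_(piece (ell x)) y.
Proof.
have [E|ne] := pselect (ell y = ell x); last first.
  by rewrite heat_kernel_out // normr0 indicE memNset // mulr0.
rewrite indicE mem_set // mulr1 heat_kernelE // normrM ger0_norm ?expR_ge0 //.
rewrite ler_pM2l ?expR_gt0 //; apply: le_trans (ler_normD _ _) _.
rewrite lerD2l normrM ler_piMr // ger0_norm ?power_ge0 //.
by apply: (@power_le x y 0); rewrite /ball_at cyl_nil.
Qed.

(** ** Measurability *)

Definition first_diff (p : G * G) : option nat :=
  if pselect (exists k, src p.1 k != src p.2 k) is left ex then Some (ex_minn ex) else None.

Definition agree_at (k : nat) : set (G * G) := [set p | src p.1 k = src p.2 k].

Lemma agree_at_measurable k : measurable (agree_at k).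
Proof.
pose S (a : letter) : set G := [set x | src x k = a].
have mS a : measurable (S a).
  apply: sub_gen_smallest; rewrite openE => x xa.
  apply: filterS (ball_at_nbhs x k.+1) => y xy.
  by rewrite /S /= (ball_at_src xy) //; lia.
rewrite (_ : agree_at k = \bigcup_n (if @pickle_inv letter n is Some a then S a `*` S a else set0)).
  apply: bigcupT_measurable => n; case: pickle_inv => [a|//]; exact: measurableX.
apply/seteqP; split=> [p /= E|p [n _]].
  by exists (pickle (src p.1 k : letter)) => //; rewrite pickleK_inv.
by case: pickle_inv => [a|//] [xa ya]; rewrite /agree_at /= xa ya.
Qed.

Lemma first_diff_measurable o : measurable (first_diff @^-1` [set o]).
Proof.
case: o => [k|].
  rewrite (_ : _ @^-1` _ = (\bigcap_i (if (i < k)%N then agree_at i else setT)) `&` ~` agree_at k).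
    apply: measurableI; last by apply: measurableC; exact: agree_at_measurable.
    by apply: bigcapT_measurable => i; case: ifP => _ //; exact: agree_at_measurable.
  apply/seteqP; split=> p; rewrite /first_diff /=.
    case: pselect => // ex; case: ex_minnP => m dm mm [<-]; split; last exact/eqP.
    move=> i _ /=; case: ifP => // im; apply/eqP/negPn/negP => /mm.
    by rewrite leqNgt im.
  move=> [A /eqP D]; case: pselect => [ex|[]]; last by exists k.
  case: ex_minnP => m dm mm; congr Some; apply/eqP; rewrite eqn_leq mm //=.
  rewrite leqNgt; apply/negP => mk; have := A m I; rewrite /= mk => E.
  by rewrite E eqxx in dm.
rewrite (_ : _ @^-1` _ = \bigcap_i agree_at i).
  by apply: bigcapT_measurable => i; exact: agree_at_measurable.
apply/seteqP; split=> p; rewrite /first_diff /=.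
  case: pselect => // nex _ i _; apply/eqP/negPn/negP => di.
  by apply: nex; exists i.
by move=> A; case: pselect => // ex; exfalso; have [k] := ex; rewrite (A k I) eqxx.
Qed.

(** The kernel is a function of the two pairs of words and of the first
    difference, which take countably many values. *)
Lemma heat_kernel_measurable :
  measurable_fun setT (fun p : G * G => K p.1 p.2).
Proof.
pose C : countType := ((word * word) * (word * word) * option nat)%type.
pose code (p : G * G) : C := (ell p.1, ell p.2, first_diff p).
pose phi (c : C) : R := if c.1.2 == c.1.1 then
  expR (- t * (word_size c.1.1)%:R) * (h c.1.1 + H c.1.1 *
   (if c.2 is Some k then lambda ^- k else 0) `^ (- delta N lambda + delta' N lambda * t)) else 0.
rewrite (_ : (fun p => _) = phi \o code).
  apply: measurable_fun_countable => -[[ga ga'] o].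
  rewrite (_ : _ @^-1` _ = (piece ga `*` piece ga') `&` (first_diff @^-1` [set o])).
    apply: measurableI; last exact: first_diff_measurable.
    by apply: measurableX; exact: piece_measurable.
  apply/seteqP; split=> p; first by move=> [<- <- <-].
  by move=> [[/= <- <-] /= <-].
apply/funext => p; rewrite /heat_kernel /phi /code /= /piece_dist /shift_dist /first_diff.
by case: pselect.
Qed.

Lemma heat_section_measurable x : measurable_fun setT (K x : G -> R).
Proof.
exact: (measurableT_comp heat_kernel_measurable (pair1_measurable x)).
Qed.

Lemma heat_section_bounded x : piecewise_bounded (ell x) (K x).
Proof.
split; first exact: heat_section_measurable.
by exists (heat_bound (ell x)); exact: heat_kernel_le.
Qed.

(** ** Action on the Haar system *)

(** The solution of the recurrence of [ball_integralS] that tends to zero,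
    that is, the sum of the contributions of all the annuli inside the ball.
    *)
Definition ball_formula gamma k : R := expR (- t * (word_size gamma)%:R) *
  (h gamma * N%:R ^- (size gamma.2 + k) +
   H gamma * ((1 - N%:R^-1) / (1 - decay)) * decay ^+ (size gamma.2 + k)).

Let NM_neq0 n : N%:R ^+ n != 0 :> R.
Proof. by rewrite expf_neq0. Qed.

Let decay_neq1 : 1 - decay != 0.
Proof. by rewrite subr_eq0 gt_eqF // (lt_trans decay_lt) // invN_lt1. Qed.

Let growth_neq1 : N%:R * decay - 1 != 0.
Proof. by rewrite subr_eq0 lt_eqF // growth_lt1. Qed.

Lemma ball_formulaS gamma k : ball_formula gamma k =
  (N%:R - 1) * (expR (- t * (word_size gamma)%:R) *
    (h gamma + H gamma * (N%:R * decay) ^+ (size gamma.2 + k)) * N%:R ^- (size gamma.2 + k.+1)) +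
  ball_formula gamma k.+1.
Proof.
rewrite /ball_formula addnS !exprS exprMn.
move: (h gamma) (H gamma) (expR (- t * _)) (NM_neq0 (size gamma.2 + k)) decay_neq1 => a b c.
move: (decay ^+ _) => p; move: (N%:R ^+ _) => W; move: decay N_neq0 => q; move: (N%:R) => n n0 W0 q1.
by field; rewrite n0 W0 q1.
Qed.

(** Two solutions of the same recurrence differ by a constant, and both tend
    to zero like the measure of the ball. *)
Lemma heat_ball_integral x k : ball_integral x (K x) k = ball_formula (ell x) k.
Proof.
pose d k := ball_integral x (K x) k - ball_formula (ell x) k.
have dS i : d i = d i.+1.
  rewrite /d (ball_integralS _ (heat_radial x) (heat_section_bounded x)).
  rewrite ball_formulaS mass_ell opprD addrACA (_ : _ - _ = 0) ?add0r //.
  by apply/eqP; rewrite subr_eq0 mulrA.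
have dk n : d k = d (k + n)%N by elim: n => [|n IH]; rewrite ?addn0 // addnS -dS.
pose E := expR (- t * (word_size (ell x))%:R).
pose C := heat_bound (ell x) + E * (`|h (ell x)| + `|H (ell x) * ((1 - N%:R^-1) / (1 - decay))|).
have iN0 : 0 <= N%:R^-1 :> R by rewrite invr_ge0 ler0n.
have Nle n : (N%:R^-1 : R) ^+ (size (ell x).2 + n) <= N%:R^-1 ^+ n.
  by apply: ler_wiXn2l => //; [exact: ltW invN_lt1 | exact: leq_addl].
have small n : `|d n| <= C * N%:R^-1 ^+ n.
  rewrite /C mulrDl; apply: le_trans (ler_normB _ _) _; apply: lerD.
    have := @Rint_cyl_le (ell x) (mkseq (tail_letter x) n) _ (heat_bound (ell x)) (heat_section_bounded x).
    move=> /(_ _)/le_trans; apply.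
      move=> y /cyl_ell yx; apply: le_trans (heat_kernel_le x y) _.
      by rewrite indicE mem_set // mulr1.
    by rewrite size_mkseq mass_ell ler_wpM2l ?heat_bound_ge0 // -exprVn.
  rewrite /ball_formula normrM ger0_norm ?expR_ge0 // -/E -[leRHS]mulrA ler_wpM2l ?expR_ge0 //.
  rewrite [leRHS]mulrDl; apply: le_trans (ler_normD _ _) _; rewrite !normrM; apply: lerD.
    by rewrite ler_wpM2l // -exprVn ger0_norm ?exprn_ge0.
  rewrite ler_wpM2l //; rewrite ger0_norm ?exprn_ge0 // ?(ltW decay_gt0) //.
  apply: le_trans (Nle n); apply: lerXn2r; rewrite ?nnegrE ?(ltW decay_gt0) //.
  exact: ltW decay_lt.
apply/eqP; rewrite -subr_eq0 -/(d k) -normr_le0 leNgt; apply/negP => d0.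
have [n] := geometric_small (C * N%:R^-1 ^+ k) iN0 invN_lt1 d0.
by rewrite -mulrA -exprD ltNge {1}(dk n) small.
Qed.

(** With the ball integrals of [heat_ball_integral], the coefficients [h] and
    [H] combine to the exponential of the eigenvalue: [H] produces the factor
    of the wavelets, and [h] makes the total mass 1 up to the factor of the
    length. *)
Lemma heat_wfun x (i : windex) : Rint (fun y => K x y * wfun i y) =
  expR (- t * (laplace_eigenvalue i + (word_size i.1)%:R)) * wfun i x.
Proof.
rewrite (radial_wfun i (heat_radial x) (heat_section_bounded x)).
have [px|npx] := pselect (piece i.1 x); last by rewrite wfun_out // mul0r mulr0.
rewrite [RHS]mulrC; congr (_ * _); rewrite -px mulrDr expRD [RHS]mulrC.
set m := size (ell x).2; pose Q := expR (t * (1 - N%:R^-1) * m%:R).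
have Qm : Q * decay ^+ m = 1.
  by rewrite /decay -expRM_natr /Q -expRD -[RHS]expR0; congr expR; ring.
have HE : H (ell x) = (N%:R - N%:R * decay) / (N%:R * decay - 1) * (expR (- t) * Q).
  rewrite /heat_H -/decay /Q -expRD; congr (_ * expR _); rewrite -/m.
  by set c := N%:R^-1; ring.
have hE : h (ell x) = N%:R ^+ m * (1 - (N%:R - 1) * expR (- t) / (N%:R * decay - 1)) by [].
have eE k : expR (- t * (1 + k%:R * (1 - N%:R^-1))) = expR (- t) * decay ^+ k.
  by rewrite /decay -expRM_natr -expRD; congr expR; set c := N%:R^-1; ring.
case: i px => [ga [[v j]|]] /= px.
  rewrite !heat_ball_integral /laplace_eigenvalue /= eE mass_ell /ball_formula -/m.
  rewrite hE HE {hE HE eE px}; clearbody m; rewrite !addnS !exprS exprMn !exprD.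
  move: (NM_neq0 m) (NM_neq0 (size v)) N_neq0 decay_neq1 growth_neq1 Qm.
  move: (expR (- t * _)) (expR (- t)) (N%:R ^+ m) (N%:R ^+ size v) (decay ^+ m) (decay ^+ size v) => E et W V p s.
  move: decay (N%:R) Q => q n Q W0 V0 n0 q1 g1 Qp.
  have p0 : p != 0 by apply: contra_eq_neq Qp => ->; rewrite mulr0 eq_sym oner_eq0.
  have -> : Q = p^-1 by apply: (mulIf p0); rewrite Qp mulVf.
  by field; rewrite n0 W0 V0 q1 g1 p0.
rewrite heat_ball_integral /laplace_eigenvalue /= mulr0 expR0 mulr1 /ball_formula -/m addn0.
rewrite hE HE {hE HE eE px}; clearbody m; move: (NM_neq0 m) N_neq0 decay_neq1 growth_neq1 Qm.
move: (expR (- t * _)) (expR (- t)) (N%:R ^+ m) (decay ^+ m) => E et W p.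
move: decay (N%:R) Q => q n Q W0 n0 q1 g1 Qp.
have p0 : p != 0 by apply: contra_eq_neq Qp => ->; rewrite mulr0 eq_sym oner_eq0.
have -> : Q = p^-1 by apply: (mulIf p0); rewrite Qp mulVf.
by field; rewrite n0 W0 q1 g1 p0.
Qed.

Lemma heat_int_op : heat lambda muG t = int_op muG K.
Proof.
rewrite heat_diag.
apply/esym/int_op_haar => [x|x n|n].
- by exists (ell x); exact: heat_section_bounded.
- rewrite /heat_eigenvalue /wave_laplace /wave_size /wave /wave_piece.
  case: pickle_inv => [i|]; first exact: heat_wfun.
  by rewrite mulr0; under eq_Rintegral do rewrite mulr0; rewrite Rintegral_cst // mul0r.
- rewrite expr_le1 // ?expR_ge0 //.
  rewrite -expR0 ler_expR mulNr oppr_le0 mulr_ge0 ?(ltW t_gt0) // addr_ge0 ?ler0n //.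
  exact: wave_laplace_ge0.
Qed.

(** * Continuity and integrability of the heat kernel *)

Let iN0 : 0 <= N%:R^-1 :> R.
Proof. by rewrite invr_ge0 ler0n. Qed.

Let g0 : 0 <= N%:R * decay.
Proof. by rewrite mulr_ge0 ?ler0n // ltW // decay_gt0. Qed.

Lemma balls_nbhs x y m n :
  \forall p \near ((x, y) : groupoid N2 * groupoid N2), ball_at x m p.1 /\ ball_at y n p.2.
Proof.
by exists (ball_at x m, ball_at y n) => //=; split; exact: ball_at_nbhs.
Qed.

Lemma heat_kernel_locally_constant x y : src y <> src x \/ ell y <> ell x ->
  \forall p \near ((x, y) : groupoid N2 * groupoid N2), K p.1 p.2 = K x y.
Proof.
move=> d; have [E|ne] := pselect (ell y = ell x); last first.
  apply: filterS (balls_nbhs x y 0 0) => -[x' y'] /= [/cyl_ell xx /cyl_ell yy].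
  by rewrite !heat_kernel_out // xx yy.
case: d => // ns; have [//|[k [bk dk]]] := first_difference E.
apply: filterS (balls_nbhs x y k.+1 k.+1) => -[x' y'] /=.
move=> [/ball_atP[xx xk] /ball_atP[yy yk]].
have Ex : ell y' = ell x' by rewrite xx yy.
have bk' : ball_at x' k y'.
  apply/ball_atP; split => // i ik; move/ball_atP: bk => [_ /(_ i ik)].
  by rewrite xk ?yk // ltnS ltnW.
have dk' : tail_letter y' k != tail_letter x' k by rewrite xk ?yk.
by rewrite !heat_kernelE // (power_difference bk dk)
  (power_difference bk' dk') xx.
Qed.

(** Off the diagonal the kernel is locally constant. At the diagonal, the
    power of the distance is at most [(N * decay) ^ n] on the ball of level
    [n]. *)
Lemma heat_kernel_continuous :
  continuous (fun p : groupoid N2 * groupoid N2 => K p.1 p.2).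
Proof.
move=> [x y]; have [[sE E]|d] := pselect (src y = src x /\ ell y = ell x); last first.
  by apply: cvg_near_cst; apply: heat_kernel_locally_constant; apply/not_andP.
apply/cvgrPdist_lt => eps e0 /=.
set C := expR (- t * (word_size (ell x))%:R) * `|H (ell x)|.
have [n Cn] := geometric_small C g0 growth_lt1 e0.
apply: filterS (balls_nbhs x y n n) => -[x' y'] /= [/ball_atP[xx xk] /ball_atP[yy yk]].
have Ex : ell y' = ell x' by rewrite xx yy.
apply: le_lt_trans Cn; rewrite !heat_kernelE // xx -mulrBr opprD addrACA subrr add0r.
rewrite (power_src sE) mulr0 sub0r -mulrN normrM ger0_norm ?expR_ge0 //.
rewrite /C -mulrA ler_wpM2l ?expR_ge0 // mulrN normrN normrM ler_wpM2l //.
rewrite ger0_norm ?power_ge0 //; apply: power_le.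
apply/ball_atP; split => // i ik; rewrite xk ?yk //.
by rewrite /tail_letter E sE.
Qed.

(** ** Integrability *)

Definition sizes n k : set G := [set x | size (ell x).1 = n /\ size (ell x).2 = k].

Lemma sizes_measurable n k : measurable (sizes n k).
Proof.
pose C : countType := (word * word)%type.
rewrite (_ : sizes n k = \bigcup_i (if @pickle_inv C i is Some ga then
  (if (size ga.1 == n) && (size ga.2 == k) then piece ga else set0) else set0)).
  apply: bigcupT_measurable => i; case: pickle_inv => [ga|//]; case: ifP => // _.
  exact: piece_measurable.
apply/seteqP; split=> [x [xn xk]|x [i _]].
  exists (pickle (ell x : C)); [by [] | rewrite pickleK_inv].
  by move/eqP: xn => ->; move/eqP: xk => ->.
by case: pickle_inv => [ga|//]; case: ifP => // /andP[/eqP <- /eqP <-] <-.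
Qed.

Lemma card_letter : #|{: letter}| = N.
Proof. by rewrite -[RHS]card_ord. Qed.

Lemma piece_integral gamma :
  (\int[muG]_x (\1_(piece gamma) x)%:E = (cyl_mass gamma 0)%:E)%E.
Proof.
rewrite integral_indic //; last exact: piece_measurable.
by rewrite setIT -cyl_nil cyl_massE.
Qed.

(** There are at most [N ^ (n + k)] pieces with words of these lengths, and
    each has measure [N ^ - k]. *)
Lemma sizes_le n k : (muG (sizes n k) <= (N%:R ^+ n)%:E)%E.
Proof.
pose I := (n.-tuple letter * k.-tuple letter)%type.
pose ga (i : I) : word * word := (tval i.1, tval i.2).
rewrite -(setIT (sizes n k)) -integral_indic //; last exact: sizes_measurable.
have E x : ((\1_(sizes n k) x : R)%:E = \sum_(i : I) (\1_(piece (ga i)) x)%:E)%E.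
  rewrite sumEFin; congr (_%:E); have [[xn xk]|ns] := pselect (sizes n k x); last first.
    rewrite indicE memNset // big1 // => i _; rewrite indicE memNset // => xi.
    by apply: ns; split; rewrite xi size_tuple.
  have xn' : size (ell x).1 == n by apply/eqP.
  have xk' : size (ell x).2 == k by apply/eqP.
  rewrite indicE mem_set // (bigD1 (Tuple xn', Tuple xk')) //=.
  have -> : ga (Tuple xn', Tuple xk') = ell x by [].
  rewrite indicE mem_set //.
  rewrite big1 ?addr0 // => -[i j] ij; rewrite indicE memNset // => xij.
  case/eqP: ij; congr pair; apply: val_inj.
    exact: esym (congr1 fst xij).
  exact: esym (congr1 snd xij).
under eq_integral do rewrite E.
have mp i : measurable_fun setT (fun x : G => (\1_(piece (ga i)) x : R)%:E).
  by apply/measurable_EFinP/measurable_indic; exact: piece_measurable.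
rewrite ge0_integral_sum //.
under eq_bigr do rewrite piece_integral.
rewrite sumEFin lee_fin.
apply: (@le_trans _ _ (\sum_(i : I) N%:R ^- k)).
  apply: ler_sum => i _; rewrite /cyl_mass addn0 size_tuple; case: asboolP => // _.
rewrite sumr_const card_prod !card_tuple card_letter -[leLHS]mulr_natr natrM !natrX mulrCA.
by rewrite mulVf ?mulr1 // expf_neq0 // gt_eqF // N_gt0.
Qed.

Lemma integral_partition (D : set G) : measurable D -> forall A : nat -> set G,
  (forall i, measurable (A i)) -> trivIset setT A -> \bigcup_i A i = D ->
  forall F : G -> \bar R, measurable_fun setT F -> (forall x, 0 <= F x)%E ->
  (\int[muG]_(x in D) F x = \sum_(0 <= i <oo) \int[muG]_(x in A i) F x)%E.
Proof.
move=> mD A mA tA <- F mF F0; apply: ge0_integral_bigcup => //.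
exact: measurable_funS mF.
Qed.

(** Sorting the pieces by the lengths of their words gives a product of two
    geometric series. *)
Lemma geometric_integral (C r s : R) : 0 <= C -> 0 <= r -> 0 <= s -> N%:R * r < 1 -> s < 1 ->
  (\int[muG]_x (C * r ^+ size (ell x).1 * s ^+ size (ell x).2)%:E < +oo)%E.
Proof.
move=> C0 r0 s0 r1 s1; set F := (fun x : G => _).
have F0 x : (0 <= F x)%E by rewrite lee_fin !mulr_ge0 // exprn_ge0.
have mF : measurable_fun setT F.
  apply/measurable_EFinP.
  exact: (measurable_fun_countable (C := (word * word)%type)
    (fun c => C * r ^+ size c.1 * s ^+ size c.2) ell_measurable).
pose A n := \bigcup_k sizes n k.
have mA n : measurable (A n) by apply: bigcupT_measurable => k; exact: sizes_measurable.
have nr0 : 0 <= N%:R * r by rewrite mulr_ge0 // ler0n.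
have Ale n : (\int[muG]_(x in A n) F x <= (C / (1 - s) * (N%:R * r) ^+ n)%:E)%E.
  rewrite (integral_partition (mA n) (A := sizes n)) //; first last.
  - by move=> i j _ _ [x [[_ <-] [_ <-]]].
  - by move=> k; exact: sizes_measurable.
  rewrite (_ : C / (1 - s) * (N%:R * r) ^+ n = C * (N%:R * r) ^+ n / (1 - s)); last by rewrite mulrAC.
  rewrite -geometric_nneseries //; apply: lee_nneseries => [k _ _|k _].
    by apply: integral_ge0 => x _.
  rewrite (eq_integral (fun=> (C * r ^+ n * s ^+ k)%:E)); last first.
    by move=> x /set_mem[xn xk]; rewrite /F xn xk.
  rewrite integral_cst; last exact: sizes_measurable.
  rewrite (_ : C * (N%:R * r) ^+ n * s ^+ k = C * r ^+ n * s ^+ k * N%:R ^+ n); last first.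
    by rewrite exprMn; ring.
  rewrite [leRHS]EFinM; apply: lee_wpmul2l; last exact: sizes_le.
  by rewrite lee_fin !mulr_ge0 // exprn_ge0.
rewrite (integral_partition measurableT (A := A)) //; first last.
- by apply/seteqP; split=> // x _; exists (size (ell x).1) => //; exists (size (ell x).2).
- by move=> i j _ _ [x [[k _ [<- _]] [k' _ [<- _]]]].
apply: le_lt_trans (ltry (C / (1 - s) / (1 - N%:R * r))).
rewrite -geometric_nneseries //; apply: lee_nneseries => [n _ _|n _]; last exact: Ale.
by apply: integral_ge0 => x _; exact: F0.
Qed.

(** The factors [N ^ k] of [h] and [exp (t (1 - 1/N) k)] of [H], for words
    [gamma.2] of length [k], are compensated by the measure [N ^ - k] of the
    piece and by [exp (- t k) <= N ^ - k]. *)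
Lemma heat_section_integral_le x : (\int[muG]_y `|(K x y)%:E| <=
  ((`|h ([::], [::])| + `|(N%:R - N%:R * decay) / (N%:R * decay - 1)|) *
   expR (- t) ^+ size (ell x).1 * N%:R^-1 ^+ size (ell x).2)%:E)%E.
Proof.
have bK := heat_section_bounded x.
have t0 := t_gt0.
apply: (@le_trans _ _ (\int[muG]_y (heat_bound (ell x) * \1_(piece (ell x)) y)%:E)%E).
  apply: ge0_le_integral => //.
  - apply/measurable_EFinP/measurableT_comp => //; by case: bK.
  - by apply/measurable_EFinP/measurable_funM => //; apply: measurable_indic; exact: piece_measurable.
  - by move=> y _; rewrite lee_fin; exact: heat_kernel_le.
under eq_integral do rewrite EFinM.
rewrite ge0_integralZl_EFin ?heat_bound_ge0 //; last first.
  by apply/measurable_EFinP/measurable_indic; exact: piece_measurable.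
rewrite piece_integral.
rewrite -EFinM lee_fin mass_ell addn0 /heat_bound.
set n := size (ell x).1; set k := size (ell x).2; set r := expR (- t).
have -> : expR (- t * (word_size (ell x))%:R) = r ^+ n * r ^+ k.
  by rewrite /r -!expRM_natr -expRD -mulrDr -natrD.
have hE : `|h (ell x)| = N%:R ^+ k * `|h ([::], [::])|.
  by rewrite /heat_h /= expr0 mul1r [LHS]normrM ger0_norm // exprn_ge0 // ler0n.
have HE : `|H (ell x)| = `|(N%:R - N%:R * decay) / (N%:R * decay - 1)| *
    expR (- t * (1 - (1 - N%:R^-1) * k%:R)).
  by rewrite /heat_H [LHS]normrM [X in _ * X = _]ger0_norm ?expR_ge0.
have rk : r ^+ k <= N%:R^-1 ^+ k.
  by apply: lerXn2r; rewrite ?nnegrE ?expR_ge0 // ltW // expNt_lt.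
have rH : r ^+ k * expR (- t * (1 - (1 - N%:R^-1) * k%:R)) <= 1.
  rewrite /r -expRM_natr -expRD -[leRHS]expR0 ler_expR.
  rewrite (_ : _ + _ = - (t * (1 + N%:R^-1 * k%:R))); last by set c := N%:R^-1; ring.
  by rewrite oppr_le0 mulr_ge0 ?(ltW t0) // addr_ge0 // mulr_ge0 // ler0n.
have rn0 : 0 <= r ^+ n by rewrite exprn_ge0 // expR_ge0.
have Nk0 : 0 <= N%:R^-1 ^+ k :> R by rewrite exprn_ge0.
have NK : N%:R ^+ k != 0 :> R by rewrite expf_neq0 // gt_eqF // N_gt0.
rewrite hE HE; move: rk rH Nk0; rewrite exprVn.
move: (`|h _|) (normr_ge0 (h ([::], [::]))) `|_ / _| (normr_ge0 ((N%:R - N%:R * decay) / (N%:R * decay - 1))).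
move=> a a0 b b0; move: (expR (- t * _)) (r ^+ n) rn0 (r ^+ k) (N%:R ^+ k) NK => X p p0 q W W0 qW qX W1.
rewrite [leLHS](_ : _ = p * (a * q + b * (q * X) / W)); last by field.
rewrite [leRHS](_ : _ = p * (a * W^-1 + b * 1 / W)); last by field.
apply: ler_wpM2l => //; apply: lerD; first exact: ler_wpM2l.
by apply: ler_wpM2r => //; exact: ler_wpM2l.
Qed.

(** * Riesz potentials *)

Section on_piece.

Variable gamma : word * word.

Definition apply_kernel (k : G -> G -> R) f : cfun :=
  fun x => cintegral muG setT (fun y => (k x y)%:C * f y).

(** The kernel of the projection onto the constant functions on the piece, as
    [N ^ - size gamma.2] is the measure of the piece. *)
Definition mean_kernel x y : R :=
  N%:R ^+ size gamma.2 * \1_(piece gamma) x * \1_(piece gamma) y.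

Definition riesz_kernel x y : R :=
  \1_(piece gamma) x * (\1_(piece gamma) y * kernel_power x y).

Lemma mean_kernel_bounded x : piecewise_bounded gamma (mean_kernel x).
Proof. by apply: piecewise_boundedZ; rewrite -cyl_nil; exact: piecewise_bounded_cyl. Qed.

(** The kernel is radial with constant [rho], so the two terms in
    [radial_wfun] cancel on wavelets. *)
Lemma mean_wfun x (i : windex) :
  Rint (fun y => mean_kernel x y * wfun i y) =
  (i == (gamma, None))%:R * wfun i x.
Proof.
have [px|npx] := pselect (piece gamma x); last first.
  transitivity (0 : R).
    rewrite -[RHS](_ : Rint (cst 0) = 0); last by rewrite Rintegral_cst // mul0r.
    by apply: eq_Rintegral => y _; rewrite /mean_kernel [\1_(_) x]indicE memNset // mulr0 !mul0r.
  by case: eqVneq => [->|_]; rewrite ?mul0r // wfun_out ?mulr0.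
have rM : radial x (fun=> N%:R ^+ size gamma.2) (mean_kernel x).
  split=> [y ne|k y /cyl_ell E _]; rewrite /mean_kernel.
    by rewrite [\1_(_) y]indicE memNset ?mulr0 // -px => yx; apply: ne.
  by rewrite !indicE !mem_set ?mulr1 // /piece /= E.
have bM := mean_kernel_bounded x; rewrite -px in bM.
have bI k : ball_integral x (mean_kernel x) k = N%:R ^+ size gamma.2 * cyl_mass (ell x) k.
  rewrite /ball_integral (Rint_const_on_cyl (r := N%:R ^+ size gamma.2)).
    by rewrite size_mkseq.
  move=> y /cyl_ell E; by rewrite /mean_kernel !indicE !mem_set ?mulr1 // /piece /= E.
rewrite (radial_wfun i rM bM) mulrC.
case: i => [ga [[v j]|]] /=.
  by rewrite bI subrr; case: eqVneq => [[]|] //; rewrite !mul0r.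
rewrite bI mass_ell addn0 px mulfV ?expf_neq0 // mul1r.
have [->|ne] := eqVneq ga gamma; first by rewrite eqxx mul1r.
rewrite wfun_out ?mulr0 //= => px'; move: ne.
by rewrite -px' px eqxx.
Qed.

Lemma const_proj_int_op : const_proj muG gamma = int_op muG mean_kernel.
Proof.
have -> : const_proj muG gamma = ortho_proj muG (closed_span muG
    [set cindic R (piece ga : set G) | ga in [set gamma]]) by rewrite image_set1.
rewrite indicator_proj_diag.
apply/esym/int_op_haar => [x|x n|n].
- by exists gamma; exact: mean_kernel_bounded.
- rewrite /const_index /wave; case: pickle_inv => [i|]; last first.
    by rewrite mulr0; under eq_Rintegral do rewrite mulr0; rewrite Rintegral_cst // mul0r.
  rewrite mean_wfun; congr (_%:R * _); case: i => [ga [vj|]] /=.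
    by case: eqVneq => [[]|].
  congr nat_of_bool; case: asboolP => [->|ne]; first by rewrite eqxx.
  by apply/eqP => -[ga_gamma]; exact: ne.
- by case: const_index; rewrite ?expr1n ?expr0n ?ler01.
Qed.

Lemma kernel_cintble k f x : L2 muG (fun y => (k x y)%:C) -> L2 muG f ->
  cintegrable muG setT (fun y => (k x y)%:C * f y).
Proof.
move=> k2 f2; have := L2_cintble f2 k2.
by under eq_fun do rewrite conjc_real mulrC.
Qed.

Lemma kernel_int_op k f g : (forall x, L2 muG (fun y => (k x y)%:C)) ->
  int_op muG k (f, g) <-> [/\ L2 muG f, L2 muG g & ae_eq2 muG g (apply_kernel k f)].
Proof.
move=> k2; split=> -[f2 g2 fg]; split=> //; apply: filterS fg => x; first by case.
by move=> /= ->; split=> //; exact: kernel_cintble.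
Qed.

Lemma heat_section_L2 x : L2 muG (fun y => (K x y)%:C).
Proof.
exact: (piecewise_bounded_L2 (heat_section_bounded x)).
Qed.

Let E := expR (- t * (word_size gamma)%:R).

Let E_neq0 : E != 0.
Proof. by rewrite gt_eqF // expR_gt0. Qed.

Lemma heat_H_neq0 : H gamma != 0.
Proof.
have g1 := growth_lt1; have d1 := decay_lt; have n1 := invN_lt1.
rewrite !mulf_neq0 //; last by rewrite gt_eqF // expR_gt0.
  rewrite subr_eq0 -[X in X == _]mulr1 (inj_eq (mulfI N_neq0)) gt_eqF //.
  exact: lt_trans d1 n1.
by rewrite invr_eq0 subr_eq0 lt_eqF.
Qed.

Lemma heat_kernel_split x y : piece gamma x -> K x y =
  E * (h gamma * N%:R ^- size gamma.2 * mean_kernel x y + H gamma * riesz_kernel x y).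
Proof.
move=> px; rewrite /mean_kernel /riesz_kernel [\1_(_) x]indicE mem_set // mul1r.
have [py|npy] := pselect (piece gamma y); last first.
  rewrite heat_kernel_out; last by rewrite px.
  by rewrite indicE memNset // mulr0 mul0r !mulr0 addr0 mulr0.
rewrite heat_kernelE ?px ?py // indicE mem_set // !mulr1 mul1r.
by rewrite mulfVK // expf_neq0.
Qed.

(** The kernel is obtained by solving [heat_kernel_split] for it, since [H]
    does not vanish. *)
Lemma riesz_section_bounded x : piecewise_bounded gamma (riesz_kernel x).
Proof.
have [px|npx] := pselect (piece gamma x); last first.
  rewrite /riesz_kernel [\1_(_) x]indicE memNset //.
  under eq_fun do rewrite mul0r.
  by split; [exact: measurable_cst | exists 0 => y; rewrite normr0 mul0r].
have -> : riesz_kernel x = (fun y => (H gamma)^-1 * E^-1 * K x y +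
    - ((H gamma)^-1 * (h gamma * N%:R ^- size gamma.2)) * mean_kernel x y).
  apply/funext => y; rewrite heat_kernel_split //.
  move: (h gamma) (H gamma) heat_H_neq0 E E_neq0 (N%:R ^+ _) (expf_neq0 (size gamma.2) N_neq0).
  move=> a b b0 c c0 n n0; move: (mean_kernel x y) (riesz_kernel x y) => k1 k2.
  by field; rewrite b0 c0 n0.
apply: piecewise_boundedD; apply: piecewise_boundedZ; last exact: mean_kernel_bounded.
by rewrite -[gamma]px; exact: heat_section_bounded.
Qed.

Lemma mean_section_L2 x : L2 muG (fun y => (mean_kernel x y)%:C).
Proof. exact: piecewise_bounded_L2 (mean_kernel_bounded x). Qed.

Lemma riesz_section_L2 x : L2 muG (fun y => (riesz_kernel x y)%:C).
Proof. exact: (piecewise_bounded_L2 (riesz_section_bounded x)). Qed.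

Lemma apply_kernel_eq0 k f x : (forall y, k x y = 0) -> apply_kernel k f x = 0.
Proof.
move=> k0; rewrite /apply_kernel -(cint0 muG); congr cintegral.
by apply/funext => y; rewrite k0 mul0r.
Qed.

Lemma apply_mean_out f x : ~ piece gamma x -> apply_kernel mean_kernel f x = 0.
Proof.
move=> npx; apply: apply_kernel_eq0 => y.
by rewrite /mean_kernel [\1_(_) x]indicE memNset // mulr0 mul0r.
Qed.

Lemma apply_riesz_out f x : ~ piece gamma x -> apply_kernel riesz_kernel f x = 0.
Proof.
move=> npx; apply: apply_kernel_eq0 => y.
by rewrite /riesz_kernel [\1_(_) x]indicE memNset // mul0r.
Qed.

(** On the piece this is [heat_kernel_split]; elsewhere both sides vanish,
    because the kernel does not connect different pieces. *)
Lemma apply_heat f x : L2 muG f -> vanish_off muG (piece gamma : set G) f ->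
  apply_kernel K f x = E%:C * ((h gamma * N%:R ^- size gamma.2)%:C * apply_kernel mean_kernel f x +
    (H gamma)%:C * apply_kernel riesz_kernel f x).
Proof.
move=> f2 fv; have [px|npx] := pselect (piece gamma x).
  rewrite /apply_kernel.
  have i1 := kernel_cintble (mean_section_L2 x) f2.
  have i2 := kernel_cintble (riesz_section_L2 x) f2.
  have c1 := cintbleZ (h gamma * N%:R ^- size gamma.2)%:C i1.
  have c2 := cintbleZ (H gamma)%:C i2.
  rewrite -!cintZ // -cintD // -cintZ; last exact: cintbleD.
  congr cintegral; apply/funext => y; rewrite heat_kernel_split //.
  by rewrite rmorphM rmorphD !rmorphM; ring.
rewrite apply_mean_out // apply_riesz_out //.
rewrite !mulr0 addr0 mulr0 /apply_kernel -(cint0 muG); apply: cint_ae.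
- have k2 := heat_section_L2 x; apply: cmeasurableM; [by case: k2 | by case: f2].
- exact: cmeasurable_cst.
apply: filterS fv => y fy; have [py|npy] := pselect (piece gamma y); last by rewrite fy ?mulr0.
by rewrite heat_kernel_out ?mul0r // => yx; apply: npx; rewrite -[gamma]py yx.
Qed.

Lemma cint_piece f : cintegral muG (piece gamma : set G) f =
  cintegral muG setT (fun y => (\1_(piece gamma) y : R)%:C * f y).
Proof.
rewrite /cintegral; congr (_ +i* _); rewrite Rintegral_mkcond; apply: eq_Rintegral => y _;
  rewrite patchE indicE ?Re_mul ?Im_mul; case: (y \in _) => /=;
  by rewrite ?mulr1n ?mul1r ?mul0r ?subr0 ?addr0.
Qed.

Lemma cintble_piece f : cintegrable muG setT (fun y => (\1_(piece gamma) y : R)%:C * f y) ->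
  cintegrable muG (piece gamma : set G) f.
Proof.
have mp := piece_measurable gamma.
move=> [ri ii]; split; apply/(integrable_mkcond _ mp).
  apply: eq_integrable ri => // y _; rewrite patchE indicE Re_mul.
  by case: (y \in _) => /=; rewrite ?mul1r !mul0r subr0.
apply: eq_integrable ii => // y _; rewrite patchE indicE Im_mul.
by case: (y \in _) => /=; rewrite ?mul1r !mul0r addr0.
Qed.

Lemma riesz_integrand f x : piece gamma x ->
  (fun y => (\1_(piece gamma) y : R)%:C *
    ((piece_dist lambda x y `^ (- delta N lambda + delta' N lambda * t))%:C * f y)) =
  (fun y => (riesz_kernel x y)%:C * f y).
Proof.
move=> px; apply/funext => y; rewrite /riesz_kernel [\1_(_) x]indicE mem_set // mul1r.
by rewrite mulrA -rmorphM.
Qed.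

Lemma riesz_apply f g : riesz lambda muG gamma (delta' N lambda * t) (f, g) <->
  [/\ L2 muG f, L2 muG g, vanish_off muG (piece gamma : set G) f &
      ae_eq2 muG g (apply_kernel riesz_kernel f)].
Proof.
split=> [[f2 g2 fv gv fg]|[f2 g2 fv fg]]; split=> //.
- apply: filterS2 gv fg => x /= gx fgx.
  have [px|npx] := pselect (piece gamma x); last by rewrite gx // apply_riesz_out.
  by have [_ ->] := fgx px; rewrite cint_piece riesz_integrand.
- by apply: filterS fg => x /= -> npx; rewrite apply_riesz_out.
apply: filterS fg => x /= fgx px; split.
  by apply: cintble_piece; rewrite riesz_integrand //; apply: kernel_cintble => //; exact: riesz_section_L2.
by rewrite fgx cint_piece riesz_integrand.
Qed.

(** Both sides consist of the pairs [(f, g)] with [f] carried by the piece and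
    [g] equal to [apply_kernel K f] almost everywhere. If [g] is given, the
    Riesz potential of [f] that the right-hand side asks for is found by
    solving [apply_heat] for its last term, since [H] does not vanish. *)
Lemma heat_restr : op_restr muG (piece gamma : set G) (heat lambda muG t) =
  op_restr muG (piece gamma : set G)
    (op_scale muG E%:C
      (op_add muG
        (op_scale muG (h gamma * N%:R ^- size gamma.2)%:C (const_proj muG gamma))
        (op_scale muG (H gamma)%:C (riesz lambda muG gamma (delta' N lambda * t))))).
Proof.
rewrite heat_int_op const_proj_int_op.
set c := h gamma * N%:R ^- size gamma.2.
apply/seteqP; split=> -[f g] /= [fg fv]; split=> //; last first.
  move: fg => [u /= [u1 [u2 /= [[p /= fp [p2 pu]] [v /= fr [v2 vu]] uu ue]]] [g2 gu]].
  have [f2 _ pE] := (kernel_int_op f p mean_section_L2).1 fp.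
  have [_ _ _ vE] := (riesz_apply f v).1 fr.
  apply/(kernel_int_op _ _ heat_section_L2); split => //.
  have au : ae_eq2 muG u (fun x => c%:C * apply_kernel mean_kernel f x +
      (H gamma)%:C * apply_kernel riesz_kernel f x).
    apply: ae_eq2_trans ue _; apply: ae_eq2D.
      by apply: ae_eq2_trans pu _; exact: ae_eq2Z.
    by apply: ae_eq2_trans vu _; exact: ae_eq2Z.
  apply: ae_eq2_trans gu _; apply: filterS au => x ->.
  by rewrite apply_heat.
have [f2 g2 gE] := (kernel_int_op f g heat_section_L2).1 fg.
pose p := apply_kernel mean_kernel f.
have p2 : L2 muG p.
  have -> : p = (fun x => (N%:R ^+ size gamma.2)%:C *
      cintegral muG setT (fun y => (\1_(piece gamma) y : R)%:C * f y) * (\1_(cyl gamma [::]) x : R)%:C).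
    apply/funext => x; rewrite cyl_nil mulrC mulrA -cintZ; last first.
      apply: (@kernel_cintble (fun _ y => \1_(piece gamma) y) f x) => //.
      by apply: (piecewise_bounded_L2 (gamma := gamma)); rewrite -cyl_nil; exact: piecewise_bounded_cyl.
    rewrite /p /apply_kernel; congr cintegral; apply/funext => y.
    by rewrite /mean_kernel !rmorphM; ring.
  apply: L2Z; apply: (piecewise_bounded_L2 (gamma := gamma)).
  exact: piecewise_bounded_cyl.
pose v : cfun := fun x => (H gamma)^-1%:C * (E^-1%:C * g x - c%:C * p x).
have v2 : L2 muG v by apply/L2Z/L2B; exact: L2Z.
have CK (z : R) (w : R[i]) : z != 0 -> z%:C * (z^-1%:C * w) = w.
  by move=> z0; rewrite mulrA -rmorphM mulfV // mul1r.
have CK' (z : R) (w : R[i]) : z != 0 -> z^-1%:C * (z%:C * w) = w.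
  by move=> z0; rewrite mulrA -rmorphM mulVf // mul1r.
have H0 := heat_H_neq0.
exists (fun x => c%:C * p x + (H gamma)%:C * v x) => /=; last first.
  split=> //; apply: aeW => x; rewrite /v CK // addrC subrK CK //.
exists (fun x => c%:C * p x), (fun x => (H gamma)%:C * v x); split => /=.
- exists p => /=; last by split; [exact: L2Z | exact: ae_eq2_refl].
  by apply/(kernel_int_op _ _ mean_section_L2); split => //; exact: ae_eq2_refl.
- exists v => /=; last by split; [exact: L2Z | exact: ae_eq2_refl].
  apply/riesz_apply; split => //; apply: filterS gE => x gx.
  by rewrite /v gx apply_heat // -/p CK' // addrAC subrr add0r CK'.
- by apply: L2D; exact: L2Z.
- exact: ae_eq2_refl.
Qed.

End on_piece.

End groupoid_operators.

(** By Tonelli's theorem, from the bound on the integrals of the sections. *)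
Lemma heat_kernel_integrable (R : realType) (N : nat) (N2 : (2 <= N)%N)
  (mu : {measure set (borel_shift N2) -> \bar R})
  (mu_cylinder : forall a : word N2, mu (cylinder a) = (N%:R ^- size a)%:E)
  (muG : {sigma_finite_measure set (borel_groupoid N2) -> \bar R})
  (muG_piece : forall (gamma : word N2 * word N2) (A : set (borel_groupoid N2)),
     index_set gamma -> measurable A -> A `<=` piece gamma ->
     muG A = mu [set src g | g in A])
  (lambda : R) (lambda_gt1 : 1 < lambda)
  (t : R) (t_gt : ln N%:R * (1 - N%:R^-1)^-1 < t) :
  (muG \x muG)%E.-integrable setT (fun p => (heat_kernel lambda t p.1 p.2)%:E).
Proof.
pose K := @heat_kernel R N N2 lambda t.
have iN0 : 0 <= N%:R^-1 :> R by rewrite invr_ge0 ler0n.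
have mK : measurable_fun setT (fun p : borel_groupoid N2 * borel_groupoid N2 => (K p.1 p.2)%:E).
  by apply/measurable_EFinP; exact: heat_kernel_measurable.
apply/(integrable12ltyP muG muG mK).
set C := `|@heat_h R N N2 ([::], [::]) t| +
  `|(N%:R - N%:R * @decay R N t) / (N%:R * @decay R N t - 1)|.
have C0 : 0 <= C by rewrite addr_ge0.
apply: le_lt_trans (geometric_integral mu_cylinder muG_piece C0 (expR_ge0 (- t)) iN0
  (N_expNt_lt1 N2 t_gt) (invN_lt1 _ N2)).
apply: ge0_le_integral => //.
- by move=> x _; apply: integral_ge0.
- apply: (measurable_fun_fubini_tonelli_F (m2 := muG)
    (fun p : borel_groupoid N2 * borel_groupoid N2 => `|(K p.1 p.2)%:E|%E)) => //.
  exact: measurableT_comp mK.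
- apply/measurable_EFinP.
  exact: (measurable_fun_countable (C := (word N2 * word N2)%type)
    (fun c => C * expR (- t) ^+ size c.1 * N%:R^-1 ^+ size c.2) (@ell_measurable N N2)).
- by move=> x _; exact: (heat_section_integral_le mu_cylinder muG_piece lambda_gt1 t_gt).
Qed.

Theorem theorem2 (R : realType) (N : nat) (N2 : (2 <= N)%N)
  (lambda : R) (lambda_gt1 : 1 < lambda)
  (mu : {measure set (borel_shift N2) -> \bar R})
  (mu_cylinder : forall a : word N2, mu (cylinder a) = (N%:R ^- size a)%:E)
  (muG : {sigma_finite_measure set (borel_groupoid N2) -> \bar R})
  (muG_piece : forall (gamma : word N2 * word N2) (A : set (borel_groupoid N2)),
     index_set gamma -> measurable A -> A `<=` piece gamma ->
     muG A = mu [set src g | g in A])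
  (t : R) (t_gt : ln N%:R * (1 - N%:R^-1)^-1 < t) :
  [/\ continuous (fun p : groupoid N2 * groupoid N2 =>
        heat_kernel lambda t p.1 p.2),
      (muG \x muG)%E.-integrable setT
        (fun p => (heat_kernel lambda t p.1 p.2)%:E),
      heat lambda muG t = int_op muG (heat_kernel lambda t) &
      forall gamma : word N2 * word N2, index_set gamma ->
        op_restr muG (piece gamma) (heat lambda muG t) =
        op_restr muG (piece gamma)
          (op_scale muG (expR (- t * (word_size gamma)%:R))%:C
            (op_add muG
              (op_scale muG (heat_h gamma t * N%:R ^- size gamma.2)%:C
                 (const_proj muG gamma))
              (op_scale muG (heat_H gamma t)%:C
                 (riesz lambda muG gamma (delta' N lambda * t)))))].
Proof.
split.
- exact (heat_kernel_continuous lambda_gt1 t_gt).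
- exact (heat_kernel_integrable mu_cylinder muG_piece lambda_gt1 t_gt).
- exact (heat_int_op mu_cylinder muG_piece lambda_gt1 t_gt).
- by move=> gamma _; exact (heat_restr mu_cylinder muG_piece lambda_gt1 t_gt gamma).
Qed.
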